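(* Let $\Phi$ be a finite signature. For every infinite $\Phi$-structure $\mathbf A$, the relation of intensional equivalence on $\mathbf A$ between extended $\Phi$-programs, $$E(\vec x)=^{\mathbf A}_{\mathrm{int}}F(\vec x)\iff \mathrm{int}(\mathbf A,E(\vec x))=\mathrm{int}(\mathbf A,F(\vec x)),$$ is decidable; i.e., for each such $\mathbf A$ there is an algorithm which decides, given extended $\Phi$-programs $E(\vec x),F(\vec x)$ (as syntactic objects), whether they are intensionally equivalent on $\mathbf A$.
   Context: **Terms.** A signature $\Phi$ is a set of function symbols $\phi$, each with $\mathrm{arity}(\phi)\in\mathbb N$ and $\mathrm{sort}(\phi)\in\{\mathsf{ind},\mathsf{boole}\}$. There are individual variables $v_0,v_1,\dots$ (of sort $\mathsf{ind}$) and, for each sort $s$ and $n\in\mathbb N$, infinitely many function variables $p^{s,n}_i$ of sort $s$ and arity $n$. Terms are: $\mathrm{tt},\mathrm{ff}$ (sort $\mathsf{boole}$); individual variables; $p(F_1,\dots,F_n)$ for $p$ a function variable of arity $n$, and $\phi(F_1,\dots,F_n)$ for $\phi\in\Phi$ of arity $n$, where the $F_i$ are terms of sort $\mathsf{ind}$ (the sort of the term is that of $p$, resp. $\phi$); and conditionals ''if $F_0$ then $F_1$ else $F_2$'', also written $\mathrm{cond}(F_0,F_1,F_2)$, with $F_0$ of sort $\mathsf{boole}$ and $F_1,F_2$ of the same sort. Write $\mathsf c(F_1,\dots,F_l)$ for a term whose outermost operation $\mathsf c$ is a symbol of $\Phi$, a function variable or $\mathrm{cond}$ (with $l=3$). **Structures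 and denotations.** $f:X\rightharpoonup W$ denotes a partial function; equality of partial values means both are defined and equal or both are undefined. A (partial) $\Phi$-structure $\mathbf A=(A,\{\phi^{\mathbf A}\}_{\phi\in\Phi})$ has a universe $A$ and partial functions $\phi^{\mathbf A}:A^{\mathrm{arity}(\phi)}\rightharpoonup A_{\mathrm{sort}(\phi)}$, where $A_{\mathsf{ind}}=A$, $A_{\mathsf{boole}}=\{\mathrm{tt},\mathrm{ff}\}$; it is infinite if $A$ is. Given partial functions $\vec p$ (on $A$, of the right arities and sorts) for function variables and elements $\vec x$ of $A$ for individual variables, $\mathrm{den}((\mathbf A,\vec p),F(\vec x))$ is the value (possibly undefined) of the term $F$, defined by the usual compositional recursion: application is strict, and the conditional has the value of $F_1$ if $F_0$ has value $\mathrm{tt}$, the value of $F_2$ if $F_0$ has value $\mathrm{ff}$, and is undefined if $F_0$ is. **Programs.** A $\Phi$-program is an expression $E\equiv E_0 \text{ where } \{p_1(\vec x_1)=E_1,\dots,p_K(\vec x_K)=E_K\}$, $K\ge 0$, where $p_1,\dots,p_K$ are distinct function variables, each $E_i$ is a term whose function variables are among $p_1,\dots,p_K$, and for $1\le i\le K$, $\vec x_i$ is a list of $\mathrm{arity}(p_i)$ distinct individual variables including all those which occur in $E_i$, and $\mathrm{sort}(E_i)=\mathrm{sort}(p_i)$. $E_0$ is the head, the set of equations is the body, and $E_0,\dots,E_K$ are the parts. An extended program $E(\vec x)$ is a pair of a program $E$ and a list $\vec x=(x_1,\dots,x_n)$ of distinct individual variables which includes all those occurring in $E_0$; its arity is $n$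 and its sort is $\mathrm{sort}(E_0)$. Put $\mathrm{set}(E(\vec x))=\{E_0(\vec x),\ p_1(\vec x_1)=E_1,\dots,p_K(\vec x_K)=E_K\}$. Two programs are congruent, $E\equiv_cF$, if $F$ is obtained from $E$ by renaming the bound function variables $p_i$ and the bound individual variables $\vec x_i$ of the body equations and permuting the equations in the body. **Recursors.** On a structure $\mathbf A$, $E(\vec x)$ defines the recursor $\mathfrak r(\mathbf A,E(\vec x))=(\alpha_0,\alpha_1,\dots,\alpha_K):A^n\rightsquigarrow A_s$ ($s=\mathrm{sort}(E_0)$), where $\alpha_0(\vec x,\vec p)=\mathrm{den}((\mathbf A,\vec p),E_0(\vec x))$ and $\alpha_i(\vec x_i,\vec p)=\mathrm{den}((\mathbf A,\vec p),E_i(\vec x_i))$, with $p_i$ ranging over the partial functions $Y_i\rightharpoonup W_i$, $Y_i=A^{\mathrm{arity}(p_i)}$, $W_i=A_{\mathrm{sort}(p_i)}$. Two recursors $\alpha,\beta:X\rightsquigarrow W$ are considered equal if they have the same $K$ and there is a permutation $\pi$ of $\{1,\dots,K\}$ with inverse $\rho$ such that for $i=1,\dots,K$: $Y^\beta_i=Y^\alpha_{\pi(i)}$, $W^\beta_i=W^\alpha_{\pi(i)}$, $\beta_0(x,q_1,\dots,q_K)=\alpha_0(x,q_{\rho(1)},\dots,q_{\rho(K)})$ and $\beta_i(y,q_1,\dots,q_K)=\alpha_{\pi(i)}(y,q_{\rho(1)},\dots,q_{\rho(K)})$ for all arguments. **Reduction and canonical forms.** A term is immediate if it is an individual variable, a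 nullary function variable, or $p(u_1,\dots,u_n)$ with $p$ a function variable and the $u_i$ individual variables; it is irreducible if it is immediate, $\mathrm{tt}$, $\mathrm{ff}$, or $\mathsf c(I_1,\dots,I_l)$ with all $I_i$ immediate. An extended program is irreducible if all its parts are. $E(\vec x)\Rightarrow_1F(\vec x)$ if either (body case) for some equation $p(\vec x_p)=\mathsf c(G_1,\dots,G_l)$ in the body of $E$, some $j$ with $G_j$ not immediate and some function variable $q$ not among $p_1,\dots,p_K$ with $\mathrm{arity}(q)=\mathrm{arity}(p)$, $\mathrm{sort}(q)=\mathrm{sort}(G_j)$, $\mathrm{set}(F(\vec x))$ results from $\mathrm{set}(E(\vec x))$ by replacing that equation by $p(\vec x_p)=\mathsf c(G_1,\dots,G_{j-1},q(\vec x_p),G_{j+1},\dots,G_l)$ and $q(\vec x_p)=G_j$; or (head case) $E_0\equiv\mathsf c(G_1,\dots,G_l)$, $G_j$ is not immediate, $q$ is not among $p_1,\dots,p_K$, $\mathrm{arity}(q)=n$, $\mathrm{sort}(q)=\mathrm{sort}(G_j)$, and $\mathrm{set}(F(\vec x))$ results from $\mathrm{set}(E(\vec x))$ by replacing the head by $\mathsf c(G_1,\dots,G_{j-1},q(\vec x),G_{j+1},\dots,G_l)$ and adding $q(\vec x)=G_j$. $E(\vec x)\Rightarrow F(\vec x)$ if $E\equiv_cF$ or some finite sequence of one-step reductions leads from $E(\vec x)$ to some $F^k(\vec x)$ with $F^k\equiv_cF$. A canonical form $\mathrm{cf}(E(\vec x))$ is any irreducible extended program with $E(\vec x)\Rightarrow\mathrm{cf}(E(\vec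 x))$; it exists and is unique up to congruence, and congruent extended programs define equal recursors. **Intension.** $\mathrm{int}(\mathbf A,E(\vec x))=\mathfrak r(\mathbf A,\mathrm{cf}(E(\vec x)))$. *)

(* Defs.v *)
From HB Require Import structures.
From Stdlib Require Import Relations.
From mathcomp Require Import all_boot.
From mathcomp Require Import boolp classical_sets functions cardinality.

Set Implicit Arguments.
Unset Strict Implicit.
Unset Printing Implicit Defensive.

(** * S-expressions and McCarthy-style recursive programs on them

    The model of computation used to say "there is an algorithm": finite lists
    of mutually recursive first-order definitions over binary trees, with
    call-by-value big-step semantics. *)

Inductive tree := Leaf | Node of tree & tree.

(* [EVar i] is the [i]-th argument of the definition being evaluated and
   [ECall f es] calls the [f]-th definition.  In [EIf], [Leaf] means false and
   every other tree means true. *)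
Inductive expr :=
| EVar of nat
| ELeaf
| ENode of expr & expr
| EHd of expr
| ETl of expr
| EIf of expr & expr & expr
| ECall of nat & seq expr.

Definition hd_tree t := if t is Node l _ then l else Leaf.
Definition tl_tree t := if t is Node _ r then r else Leaf.

Inductive eval (D : seq expr) (env : seq tree) : expr -> tree -> Prop :=
| eval_var i : eval D env (EVar i) (nth Leaf env i)
| eval_leaf : eval D env ELeaf Leaf
| eval_node e1 e2 t1 t2 :
    eval D env e1 t1 -> eval D env e2 t2 -> eval D env (ENode e1 e2) (Node t1 t2)
| eval_hd e t : eval D env e t -> eval D env (EHd e) (hd_tree t)
| eval_tl e t : eval D env e t -> eval D env (ETl e) (tl_tree t)
| eval_true e0 e1 e2 l r t :
    eval D env e0 (Node l r) -> eval D env e1 t -> eval D env (EIf e0 e1 e2) t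
| eval_false e0 e1 e2 t :
    eval D env e0 Leaf -> eval D env e2 t -> eval D env (EIf e0 e1 e2) t
| eval_call f es ts t :
    evals D env es ts -> eval D ts (nth ELeaf D f) t -> eval D env (ECall f es) t
with evals (D : seq expr) (env : seq tree) : seq expr -> seq tree -> Prop :=
| evals_nil : evals D env [::] [::]
| evals_cons e es t ts :
    eval D env e t -> evals D env es ts -> evals D env (e :: es) (t :: ts).

Scheme eval_mut := Minimality for eval Sort Prop
with evals_mut := Minimality for evals Sort Prop.

Lemma eval_functional D env e t t' :
  eval D env e t -> eval D env e t' -> t = t'.
Proof.
move=> ev; move: t'.
pose P env e t := forall t', eval D env e t' -> t = t'.
pose Q env es ts := forall ts', evals D env es ts' -> ts = ts'.
apply: (eval_mut (P := P) (P0 := Q)) ev => {e t} {}env; rewrite /P /Q.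
- by move=> i t' h; inversion h.
- by move=> t' h; inversion h.
- move=> e1 e2 t1 t2 _ IH1 _ IH2 t' h; inversion h; subst.
  by rewrite (IH1 _ H1) (IH2 _ H3).
- by move=> e t _ IH t' h; inversion h; subst; rewrite (IH _ H0).
- by move=> e t _ IH t' h; inversion h; subst; rewrite (IH _ H0).
- move=> e0 e1 e2 l r t _ IH0 _ IH1 t' h; inversion h; subst; first exact: IH1.
  by have := IH0 _ H3.
- move=> e0 e1 e2 t _ IH0 _ IH1 t' h; inversion h; subst; last exact: IH1.
  by have := IH0 _ H3.
- move=> f es ts t _ IH1 _ IH2 t' h; inversion h; subst.
  by apply: IH2; rewrite (IH1 _ H1).
- by move=> ts' h; inversion h.
- move=> e es t ts _ IH1 _ IH2 ts' h; inversion h; subst.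
  by rewrite (IH1 _ H1) (IH2 _ H3).
Qed.

(* Definition 0 is the entry point; its two arguments are the codes of the
   inputs, and the program must halt on all of them. *)
Definition decides (T : Type) (code : T -> tree) (D : seq expr)
    (R : T -> T -> Prop) : Prop :=
  forall x y : T,
    (R x y -> eval D [:: code x; code y] (nth ELeaf D 0) (Node Leaf Leaf)) /\
    (~ R x y -> eval D [:: code x; code y] (nth ELeaf D 0) Leaf).

Definition decidable_relation (T : Type) (code : T -> tree)
    (R : T -> T -> Prop) : Prop :=
  exists D : seq expr, decides code D R.

Definition code_nat (n : nat) : tree := iter n (Node Leaf) Leaf.
Definition code_list (ts : seq tree) : tree := foldr Node Leaf ts.
Definition code_seq (T : Type) (code : T -> tree) (s : seq T) : tree :=
  code_list (map code s).

Lemma code_nat_inj : injective code_nat.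
Proof. by elim=> [|m IH] [|n] //= [/IH ->]. Qed.

Lemma code_list_inj : injective code_list.
Proof. by elim=> [|t s IH] [|t' s'] //= [-> /IH ->]. Qed.

Lemma code_seq_inj (T : Type) (code : T -> tree) :
  injective code -> injective (code_seq code).
Proof. by move=> codeI s s' /code_list_inj /(inj_map codeI). Qed.

Fixpoint eq_tree (t u : tree) : bool :=
  match t, u with
  | Leaf, Leaf => true
  | Node t1 t2, Node u1 u2 => eq_tree t1 u1 && eq_tree t2 u2
  | _, _ => false
  end.

Lemma eq_treeP : Equality.axiom eq_tree.
Proof.
elim=> [|t1 IH1 t2 IH2] [|u1 u2] /=; try by constructor.
by apply: (iffP andP) => [[/IH1 -> /IH2 ->]|[<- <-]] //; split; [apply/IH1|apply/IH2].
Qed.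

HB.instance Definition _ := hasDecEq.Build tree eq_treeP.

(** * Signatures and terms *)

Variant sort := ind | boole.

Definition is_boole (s : sort) : bool := if s is boole then true else false.

Lemma is_boole_inj : injective is_boole.
Proof. by case; case. Qed.

HB.instance Definition _ := hasDecEq.Build sort (inj_eqAxiom is_boole_inj).

(* The arity and the sort of a symbol, a function variable, a program, ... *)
Definition ftype : Type := (nat * sort)%type.

Record signature := Signature {
  symbol :> finType;
  typ : symbol -> ftype
}.

(* [(n, s, i)] is the function variable p^{s,n}_i. *)
Definition fvar : Type := (ftype * nat)%type.
Definition fv_type (p : fvar) : ftype := p.1.

Section Terms.
Variable Phi : signature.

Variant op := OpVar of fvar | OpSym of Phi | OpCond.

Inductive term :=
| Tt
| Ff
| Var of nat
| App of op & seq term.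

Lemma term_ind_nested (P : term -> Prop) :
  P Tt -> P Ff -> (forall v, P (Var v)) ->
  (forall c ts, (forall n, n < size ts -> P (nth Tt ts n)) -> P (App c ts)) ->
  forall t, P t.
Proof.
move=> Ptt Pff PV PA; fix IH 1 => t.
case: t => [||v|c ts]; [exact: Ptt|exact: Pff|exact: PV|apply: PA].
elim: ts => [|t ts IHts]; first by case.
by case=> [|n] /=; [move=> _; exact: IH|exact: IHts].
Qed.

Definition code_fvar (p : fvar) : tree :=
  Node (code_nat p.1.1) (Node (code_nat (is_boole p.1.2)) (code_nat p.2)).

Definition code_op (c : op) : tree :=
  match c with
  | OpVar p => Node (code_nat 0) (code_fvar p)
  | OpSym f => Node (code_nat 1) (code_nat (enum_rank f))
  | OpCond => Node (code_nat 2) Leaf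
  end.

Fixpoint code_term (t : term) : tree :=
  match t with
  | Tt => Node (code_nat 0) Leaf
  | Ff => Node (code_nat 1) Leaf
  | Var v => Node (code_nat 2) (code_nat v)
  | App c ts => Node (code_nat 3) (Node (code_op c) (code_list (map code_term ts)))
  end.

Lemma code_fvar_inj : injective code_fvar.
Proof.
move=> [[n s] i] [[m r] j] [/code_nat_inj /= -> h /code_nat_inj /= ->].
by move: h; case: s; case: r.
Qed.

Lemma code_op_inj : injective code_op.
Proof.
case=> [p|f|] [q|g|] // [].
- by move=> h1 h2 h3; congr OpVar; apply: code_fvar_inj; rewrite /code_fvar h1 h2 h3.
- by move=> /code_nat_inj /val_inj /enum_rank_inj ->.
Qed.

Lemma code_term_inj : injective code_term.
Proof.
elim/term_ind_nested=> [||v|c ts IH] [||w|d us] // [].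
  by move=> /code_nat_inj ->.
move=> /code_op_inj -> /code_list_inj tsus; congr App.
elim: ts us IH tsus => [|t ts IHts] [|u us] //= IH [tu tsus].
congr cons; [exact: (IH 0 isT _ tu)|exact: (IHts us (fun n => IH n.+1))].
Qed.

HB.instance Definition _ := hasDecEq.Build term (inj_eqAxiom code_term_inj).

(* Result sort of [c] applied to arguments of sorts [ss], where [None] means
   "ill-formed". *)
Definition op_sort (c : op) (ss : seq (option sort)) : option sort :=
  match c with
  | OpVar p => if ss == nseq (fv_type p).1 (Some ind) then Some (fv_type p).2 else None
  | OpSym f => if ss == nseq (typ f).1 (Some ind) then Some (typ f).2 else None
  | OpCond =>
      if ss is [:: Some boole; s1; s2] then (if s1 == s2 then s1 else None) else None
  end.

(* The elements of [term] are raw; the terms of sort [s] are those with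
   [tsort t = Some s]. *)
Fixpoint tsort (t : term) : option sort :=
  match t with
  | Tt | Ff => Some boole
  | Var _ => Some ind
  | App c ts => op_sort c (map tsort ts)
  end.

Fixpoint ivars (t : term) : seq nat :=
  match t with
  | Tt | Ff => [::]
  | Var v => [:: v]
  | App _ ts => flatten (map ivars ts)
  end.

Fixpoint fvars (t : term) : seq fvar :=
  match t with
  | Tt | Ff | Var _ => [::]
  | App c ts => (if c is OpVar p then [:: p] else [::]) ++ flatten (map fvars ts)
  end.

Fixpoint rename (sigma : fvar -> fvar) (tau : nat -> nat) (t : term) : term :=
  match t with
  | Tt => Tt
  | Ff => Ff
  | Var v => Var (tau v)
  | App c ts =>
      App (if c is OpVar p then OpVar (sigma p) else c) (map (rename sigma tau) ts)
  end.

Definition is_var (t : term) : bool := if t is Var _ then true else false.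

Definition immediate (t : term) : bool :=
  match t with
  | Var _ => true
  | App (OpVar _) us => all is_var us
  | _ => false
  end.

Definition irreducible_term (t : term) : bool :=
  match t with
  | Tt | Ff | Var _ => true
  | App _ ts => immediate t || all immediate ts
  end.

(* [q(x_1, ..., x_n)] for a list of individual variables [x_1, ..., x_n] *)
Definition fapp (q : fvar) (xs : seq nat) : term := App (OpVar q) (map Var xs).

(** * Programs *)

(* [(p, xs, E)] is the equation [p(xs) = E]. *)
Definition equation : Type := (fvar * seq nat * term)%type.
Definition lhs (e : equation) : fvar := e.1.1.
Definition params (e : equation) : seq nat := e.1.2.
Definition rhs (e : equation) : term := e.2.

Definition wf_equation (ps : seq fvar) (e : equation) : bool :=
  [&& size (params e) == (fv_type (lhs e)).1,
      uniq (params e),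
      all (mem (params e)) (ivars (rhs e)),
      all (mem ps) (fvars (rhs e)) &
      tsort (rhs e) == Some (fv_type (lhs e)).2].

Definition wf_program (E0 : term) (es : seq equation) : bool :=
  [&& uniq (map lhs es),
      tsort E0 != None,
      all (mem (map lhs es)) (fvars E0) &
      all (wf_equation (map lhs es)) es].

Record program := Program {
  head : term;
  body : seq equation;
  programP : wf_program head body
}.

Definition wf_extprogram (E : program) (xs : seq nat) : bool :=
  uniq xs && all (mem xs) (ivars (head E)).

Record extprogram := ExtProgram {
  prog :> program;
  xvars : seq nat;
  extprogramP : wf_extprogram prog xvars
}.

Definition bound_fvars (E : program) : seq fvar := map lhs (body E).

(* The default value is never used, the head of a program being well-formed. *)
Definition psort (E : program) : sort := odflt ind (tsort (head E)).

Definition code_equation (e : equation) : tree :=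
  Node (code_fvar (lhs e)) (Node (code_seq code_nat (params e)) (code_term (rhs e))).

Definition code_extprogram (E : extprogram) : tree :=
  Node (code_seq code_nat (xvars E))
    (Node (code_term (head E)) (code_seq code_equation (body E))).

Lemma code_equation_inj : injective code_equation.
Proof.
move=> [[p xs] t] [[q ys] u] [h1 h2 h3 /(code_seq_inj code_nat_inj) hxs].
move=> /code_term_inj htu; move: hxs htu; rewrite /params /rhs /= => -> ->.
by congr (_, _, _); apply: code_fvar_inj; rewrite /code_fvar h1 h2 h3.
Qed.

Lemma code_extprogram_inj : injective code_extprogram.
Proof.
move=> [[h b wE] xs wx] [[h' b' wE'] xs' wx'] [].
move=> /(code_seq_inj code_nat_inj) /= e1 /code_term_inj /= e2.
move=> /(code_seq_inj code_equation_inj) /= e3.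
move: wx wx'; rewrite -{}e1; move: wE'; rewrite -{}e2 -{}e3 => wE'.
by rewrite (bool_irrelevance wE' wE) => wx wx'; rewrite (bool_irrelevance wx' wx).
Qed.

(* [tau p] renames the bound individual variables of the equation whose
   left-hand side has the function variable [p]. *)
Definition rename_equation (sigma : fvar -> fvar) (tau : fvar -> nat -> nat)
    (e : equation) : equation :=
  (sigma (lhs e), map (tau (lhs e)) (params e), rename sigma (tau (lhs e)) (rhs e)).

Definition congruent (E F : program) : Prop :=
  exists (sigma : fvar -> fvar) (tau : fvar -> nat -> nat),
    [/\ {in bound_fvars E, forall p, fv_type (sigma p) = fv_type p},
        {in bound_fvars E &, injective sigma},
        {in body E, forall e, {in params e &, injective (tau (lhs e))}},
        head F = rename sigma id (head E) &
        perm_eq (body F) (map (rename_equation sigma tau) (body E))].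

Definition congruent_ext (E F : extprogram) : Prop :=
  xvars F = xvars E /\ congruent E F.

(** * Reduction and canonical forms *)

(* The left-hand sides in a body being distinct, bodies are equal as sets iff
   they are permutations of each other. *)
Variant red1 (E F : extprogram) : Prop :=
| red1_body (p : fvar) (xs : seq nat) (c : op) (Gs : seq term) (j : nat) (q : fvar) of
    xvars F = xvars E &
    (p, xs, App c Gs) \in body E &
    j < size Gs & ~~ immediate (nth Tt Gs j) &
    q \notin bound_fvars E &
    (fv_type q).1 = (fv_type p).1 & tsort (nth Tt Gs j) = Some (fv_type q).2 &
    head F = head E &
    perm_eq (body F)
      [:: (p, xs, App c (set_nth Tt Gs j (fapp q xs))), (q, xs, nth Tt Gs j)
        & rem (p, xs, App c Gs) (body E)]
| red1_head (c : op) (Gs : seq term) (j : nat) (q : fvar) of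
    xvars F = xvars E &
    head E = App c Gs &
    j < size Gs & ~~ immediate (nth Tt Gs j) &
    q \notin bound_fvars E &
    (fv_type q).1 = size (xvars E) & tsort (nth Tt Gs j) = Some (fv_type q).2 &
    head F = App c (set_nth Tt Gs j (fapp q (xvars E))) &
    perm_eq (body F) ((q, xvars E, nth Tt Gs j) :: body E).

Definition reduces (E F : extprogram) : Prop :=
  exists2 G, clos_refl_trans_1n extprogram red1 E G & congruent_ext G F.

Definition irreducible (E : program) : bool :=
  irreducible_term (head E) && all (fun e => irreducible_term (rhs e)) (body E).

Definition canonical_form (E F : extprogram) : Prop :=
  irreducible F /\ reduces E F.

End Terms.

Arguments Tt {Phi}.
Arguments Ff {Phi}.
Arguments Var {Phi} _.
Arguments OpVar {Phi} _.
Arguments OpCond {Phi}.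

(** * Structures and recursors *)

Definition dom (A : Type) (s : sort) : Type := if s is boole then bool else A.

(* Partial functions [A^n -> A_s], where [(n, s) = c] *)
Definition pfun (A : Type) (c : ftype) : Type := c.1.-tuple A -> option (dom A c.2).

Record structure (Phi : signature) := Structure {
  universe :> Type;
  interp : forall f : Phi, pfun universe (typ f)
}.

Arguments interp {Phi} s f _.

Definition resort (A : Type) (s s' : sort) : dom A s -> option (dom A s') :=
  match s, s' with
  | ind, ind => fun a => Some a
  | boole, boole => fun b => Some b
  | _, _ => fun _ => None
  end.

(* Strict application; undefined also if the number of arguments is wrong or
   if [s'] is not the sort of the function. *)
Definition strict_seq (T : Type) (xs : seq (option T)) : option (seq T) :=
  foldr (fun x r => obind (fun a => omap (cons a) r) x) (Some [::]) xs.

Definition apply (A : Type) (c : ftype) (f : pfun A c) (args : seq (option A))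
    (s' : sort) : option (dom A s') :=
  obind (fun xs : seq A =>
    obind (fun t : c.1.-tuple A => obind (@resort A c.2 s') (f t)) (insub xs))
  (strict_seq args).

(* The value of [t], as a term of sort [s], when the distinct function variables
   [ps i] are given the values [q i] and the distinct individual variables [vs]
   are given the values [xs]. *)
Section Denotation.
Variables (Phi : signature) (A : structure Phi).
Variables (K : nat) (ps : 'I_K -> fvar) (q : forall i, pfun A (fv_type (ps i))).
Variables (vs : seq nat) (xs : seq A).

Fixpoint den (t : term Phi) (s : sort) : option (dom A s) :=
  match t with
  | Tt => @resort A boole s true
  | Ff => @resort A boole s false
  | Var v => obind (@resort A ind s) (onth xs (index v vs))
  | App (OpVar p) ts =>
      if [pick i | ps i == p] is Some i
      then apply (@q i) (map (fun u => den u ind) ts) s else None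
  | App (OpSym f) ts => apply (interp A f) (map (fun u => den u ind) ts) s
  | App OpCond [:: t0; t1; t2] =>
      obind (fun b : bool => if b then den t1 s else den t2 s) (den t0 boole)
  | App OpCond _ => None
  end.

End Denotation.

(* A recursor [A^n ~> A_s] with [(n, s) = rtype].  The sets [Y_i] and [W_i] are
   recorded as the arity and the sort [rsig i], so that [Y_i = Y_j] means
   equality of arities rather than of Rocq types.  The functionals take the
   tuple of partial functions as first argument. *)
Record recursor (A : Type) := Recursor {
  rtype : ftype;
  rsize : nat;
  rsig : 'I_rsize -> ftype;
  rhead : (forall j, pfun A (rsig j)) -> pfun A rtype;
  rbody : forall i, (forall j, pfun A (rsig j)) -> pfun A (rsig i)
}.

Arguments rsig {A} r i.
Arguments rhead {A} r q _.
Arguments rbody {A} r i q _.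

Definition cast (A : Type) (c c' : ftype) (e : c = c') (f : pfun A c) : pfun A c' :=
  eq_rect c (pfun A) f c' e.

Definition recursor_eq (A : Type) (alpha beta : recursor A) : Prop :=
  exists (_ : rsize beta = rsize alpha)
    (pi : 'I_(rsize beta) -> 'I_(rsize alpha))
    (rho : 'I_(rsize alpha) -> 'I_(rsize beta))
    (_ : cancel pi rho) (rhoK : cancel rho pi)
    (e0 : rtype beta = rtype alpha)
    (e : forall i, rsig beta i = rsig alpha (pi i)),
  forall q : (forall i, pfun A (rsig beta i)),
  let q_rho j : pfun A (rsig alpha j) :=
    cast (etrans (e (rho j)) (congr1 (rsig alpha) (rhoK j))) (@q (rho j)) in
  (forall x, cast e0 (rhead beta q) x = rhead alpha q_rho x) /\
  (forall i y, cast (e i) (rbody beta i q) y = rbody alpha (pi i) q_rho y).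

Section Intension.
Variables (Phi : signature) (A : structure Phi).

Definition recursor_of (E : extprogram Phi) : recursor A :=
  let eqn (i : 'I_(size (body E))) := tnth (in_tuple (body E)) i in
  let ps i := lhs (eqn i) in
  @Recursor A (size (xvars E), psort E) (size (body E))
    (fun i => fv_type (ps i))
    (fun q x => den q (xvars E) x (head E) (psort E))
    (fun i q y => den q (params (eqn i)) y (rhs (eqn i)) (fv_type (ps i)).2).

(* Canonical forms exist and are unique up to congruence, and congruent
   programs define equal recursors, so the choice of [E'] and [F'] is
   immaterial. *)
Definition intensionally_equivalent (E F : extprogram Phi) : Prop :=
  exists E' F' : extprogram Phi,
    [/\ canonical_form E E', canonical_form F F' &
        recursor_eq (recursor_of E') (recursor_of F')].

End Intension.

(* Main.v *)
(* A canonical form of a program has one equation for each occurrence of a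
   non-immediate proper subterm (and one for each equation of the program), so
   it is determined up to congruence and can be computed.  Two canonical forms
   define equal recursors iff some bijection of their equations turns them, part
   by part, into pairs of irreducible terms with the same denotation for all
   values of the function variables and individual variables.

   Whether such an identity [t = u] holds is decided by finitely many facts about
   the structure.  If [t] is [p(I_1, ..., I_n)] with some [I_j] not a variable,
   then, the universe being infinite, the [I_j] can be given distinct values
   different from those of the variables, and the value of [p] there is
   unconstrained; so [u] must be [t].  Otherwise identify the variables in all
   possible ways.  When distinct variables have distinct values, distinct
   immediate terms take independent values, so each of these instances depends
   only on the outermost operations, on the kinds of their immediate arguments
   and on which of these arguments coincide.  As the signature is finite, there
   are finitely many such patterns, and the list of the valid ones is hard-wired
   into the algorithm. *)

Require Import Defs.
From Stdlib Require Import Relations.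
From mathcomp Require Import all_boot.
From mathcomp Require Import boolp classical_sets functions cardinality.
Import Defs.

Set Implicit Arguments.
Unset Strict Implicit.
Unset Printing Implicit Defensive.

(** * Programs on trees *)

(** Intensional equivalence refers to canonical forms reached by some reduction, so the computed one
    must be matched with an arbitrary one. This needs no confluence argument: [flattening] describes
    an irreducible program by the subterm positions of the original one, and the description is
    pulled back along reduction steps, starting from the irreducible end. The algorithm chooses no
    fresh function variables; it names each new equation by the path of its subterm, and an
    injective dictionary ([tree_name]) links these names to the variables of any given reduction.
    Equality of recursors involves casts between types of partial functions. The semantic arguments
    therefore use values in [A + bool] and valuations with arity and sort erased. Validity of a
    pattern is stated for abstract assignments to immediate constituents ([admissible]), since these
    can be moved between pairs of terms with the same pattern. Realizing them by valuations is a
    second use of the infinite universe. The table is selected classically: each structure has its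
    algorithm, but the table is not computed from the structure. *)

Definition run (D : seq expr) (f : nat) (ts : seq tree) (t : tree) : Prop :=
  eval D ts (nth ELeaf D f) t.

Section WeakestPrecondition.
Variable D : seq expr.

(** The continuation style lets simplification run through the whole text of a definition and leave
    goals only for its calls. A call asks for a run with known result, which is where induction
    hypotheses and earlier runs enter. *)
Fixpoint wp (env : seq tree) (e : expr) (Q : tree -> Prop) : Prop :=
  match e with
  | EVar i => Q (nth Leaf env i)
  | ELeaf => Q Leaf
  | ENode e1 e2 => wp env e1 (fun t1 => wp env e2 (fun t2 => Q (Node t1 t2)))
  | EHd e => wp env e (fun t => Q (hd_tree t))
  | ETl e => wp env e (fun t => Q (tl_tree t))
  | EIf e0 e1 e2 =>
      wp env e0 (fun t => if t is Node _ _ then wp env e1 Q else wp env e2 Q)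
  | ECall f es =>
      (fix wps es (k : seq tree -> Prop) : Prop :=
         if es is e :: es' then wp env e (fun t => wps es' (fun ts => k (t :: ts)))
         else k [::]) es (fun ts => exists2 t, run D f ts t & Q t)
  end.

Lemma wp_eval env e Q : wp env e Q -> exists2 t, eval D env e t & Q t.
Proof.
move: e Q; fix IH 1 => -[i||e1 e2|e|e|e0 e1 e2|f es] Q /=.
- by move=> q; exists (nth Leaf env i) => //; apply: eval_var.
- by move=> q; exists Leaf => //; apply: eval_leaf.
- move=> /IH[t1 h1] /IH[t2 h2 q].
  by exists (Node t1 t2) => //; apply: eval_node.
- by move=> /IH[t h q]; exists (hd_tree t) => //; apply: eval_hd.
- by move=> /IH[t h q]; exists (tl_tree t) => //; apply: eval_tl.
- move=> /IH[[|l r] h0] /IH[t h q]; exists t => //.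
  + exact: eval_false h0 h.
  + exact: eval_true h0 h.
- set k := fun ts => _; move=> h.
  suff [ts h1 [t h2 q]] : exists2 ts, evals D env es ts & k ts.
    by exists t => //; apply: eval_call h1 h2.
  move: (k) h => {Q}k; elim: es k => [|e es IHes] k.
    by move=> q; exists [::] => //; apply: evals_nil.
  move=> /IH[t h /IHes[ts hs q]].
  by exists (t :: ts) => //; apply: evals_cons.
Qed.

Lemma wp_run f ts t : wp ts (nth ELeaf D f) (fun u => u = t) -> run D f ts t.
Proof. by move=> /wp_eval[u h <-]. Qed.

End WeakestPrecondition.

Fixpoint quote (t : tree) : expr :=
  if t is Node l r then ENode (quote l) (quote r) else ELeaf.

Lemma eval_quote D env t : eval D env (quote t) t.
Proof.
elim: t => [|l IHl r IHr] /=; first exact: eval_leaf.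
exact: eval_node.
Qed.

Definition code_bool (b : bool) : tree := if b then Node Leaf Leaf else Leaf.

(** * The text of the decision program and its list routines *)

Section Program.

Let V0 := EVar 0.
Let V1 := EVar 1.
Let V2 := EVar 2.
Let V3 := EVar 3.
Let V4 := EVar 4.
Let Two := ENode ELeaf (ENode ELeaf ELeaf).
Let Three := ENode ELeaf Two.
Let True_ := ENode ELeaf ELeaf.
Let And e1 e2 := EIf e1 e2 ELeaf.
Let Or e1 e2 := EIf e1 True_ e2.

Definition fn_main := 0.
Definition fn_cat := 1.
Definition fn_eq := 2.
Definition fn_mem := 3.
Definition fn_index := 4.
Definition fn_lookup := 5.
Definition fn_consall := 6.
Definition fn_inserts := 7.
Definition fn_insall := 8.
Definition fn_perms := 9.
Definition fn_conseach := 10.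
Definition fn_words := 11.
Definition fn_allvar := 12.
Definition fn_imm := 13.
Definition fn_sort := 14.
Definition fn_nth := 15.
Definition fn_sorts := 16.
Definition fn_vars := 17.
Definition fn_topargs := 18.
Definition fn_top := 19.
Definition fn_flat := 20.
Definition fn_kids := 21.
Definition fn_flats := 22.
Definition fn_cf := 23.
Definition fn_subst := 24.
Definition fn_substs := 25.
Definition fn_key := 26.
Definition fn_args := 27.
Definition fn_profile := 28.
Definition fn_pattern := 29.
Definition fn_table := 30.
Definition fn_test := 31.
Definition fn_allwords := 32.
Definition fn_samesize := 33.
Definition fn_pair := 34.
Definition fn_pairs := 35.
Definition fn_names := 36.
Definition fn_try := 37.
Definition fn_check := 38.
Definition fn_sametypes := 39.
Definition fn_newname := 40.

(* The constructor tags of [code_term] and [code_op] are unary numbers, and are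
   tested as such; [isVar] is meaningful only when [isApp] fails. *)
Let isApp e := ETl (ETl (EHd e)).
Let isVar e := ETl (EHd e).
Let opOf e := EHd (ETl e).
Let argsOf e := ETl (ETl e).
Let nameOf e := ETl (opOf e).

Let e_main := ECall fn_check [:: ECall fn_cf [:: V0]; ECall fn_cf [:: V1]].
Let e_cat := EIf V0 (ENode (EHd V0) (ECall fn_cat [:: ETl V0; V1])) V1.
Let e_eq :=
  EIf V0
    (EIf V1 (And (ECall fn_eq [:: EHd V0; EHd V1]) (ECall fn_eq [:: ETl V0; ETl V1]))
       ELeaf)
    (EIf V1 ELeaf True_).
Let e_mem :=
  EIf V1 (Or (ECall fn_eq [:: V0; EHd V1]) (ECall fn_mem [:: V0; ETl V1])) ELeaf.
Let e_index :=
  EIf V1 (EIf (ECall fn_eq [:: V0; EHd V1]) ELeaf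
            (ENode ELeaf (ECall fn_index [:: V0; ETl V1]))) ELeaf.
Let e_lookup :=
  EIf V1 (EIf (ECall fn_eq [:: V0; EHd V1]) (EHd V2)
            (ECall fn_lookup [:: V0; ETl V1; ETl V2])) ELeaf.
Let e_consall :=
  EIf V1 (ENode (ENode V0 (EHd V1)) (ECall fn_consall [:: V0; ETl V1])) ELeaf.
Let e_inserts :=
  ENode (ENode V0 V1)
    (EIf V1 (ECall fn_consall [:: EHd V1; ECall fn_inserts [:: V0; ETl V1]]) ELeaf).
Let e_insall :=
  EIf V1 (ECall fn_cat [:: ECall fn_inserts [:: V0; EHd V1];
                           ECall fn_insall [:: V0; ETl V1]]) ELeaf.
Let e_perms :=
  EIf V0 (ECall fn_insall [:: EHd V0; ECall fn_perms [:: ETl V0]])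
    (ENode ELeaf ELeaf).
Let e_conseach :=
  EIf V0 (ECall fn_cat [:: ECall fn_consall [:: EHd V0; V1];
                           ECall fn_conseach [:: ETl V0; V1]]) ELeaf.
Let e_words :=
  EIf V1 (ECall fn_conseach [:: V0; ECall fn_words [:: V0; ETl V1]])
    (ENode ELeaf ELeaf).
Let e_allvar :=
  EIf V0 (EIf (isApp (EHd V0)) ELeaf
            (And (isVar (EHd V0)) (ECall fn_allvar [:: ETl V0]))) True_.
Let e_imm :=
  EIf (isApp V0) (EIf (EHd (opOf V0)) ELeaf (ECall fn_allvar [:: argsOf V0]))
    (EIf (ETl (EHd V0)) True_ ELeaf).
Let e_sort :=
  EIf (isApp V0)
    (EIf (EHd (opOf V0))
       (EIf (ETl (EHd (opOf V0))) (ECall fn_sort [:: EHd (ETl (argsOf V0))])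
          (ECall fn_nth [:: ETl (opOf V0); ECall fn_sorts [::]]))
       (EHd (ETl (nameOf V0))))
    (EIf (ETl (EHd V0)) ELeaf True_).
Let e_nth := EIf V0 (ECall fn_nth [:: ETl V0; ETl V1]) (EHd V1).
Let e_vars := EIf V0 (ENode (ENode Two (EHd V0)) (ECall fn_vars [:: ETl V0])) ELeaf.
Let e_newname := ENode (ENode V0 V1) (ENode (ECall fn_sort [:: V2]) ELeaf).
Let e_topargs :=
  EIf V3
    (ENode
       (EIf (ECall fn_imm [:: EHd V3]) (EHd V3)
          (ENode Three (ENode (ENode ELeaf (ECall fn_newname [:: V0; V2; EHd V3]))
                          (ECall fn_vars [:: V1]))))
       (ECall fn_topargs [:: V0; V1; ENode ELeaf V2; ETl V3])) ELeaf.
Let e_top :=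
  EIf (isApp V2)
    (ENode Three (ENode (opOf V2) (ECall fn_topargs [:: V0; V1; ELeaf; argsOf V2])))
    V2.
Let e_flat :=
  ENode (ENode V0 (ENode V1 (ECall fn_top [:: V0; V1; V2])))
    (EIf (isApp V2) (ECall fn_kids [:: V0; V1; ELeaf; argsOf V2]) ELeaf).
Let e_kids :=
  EIf V3
    (ECall fn_cat
       [:: EIf (ECall fn_imm [:: EHd V3]) ELeaf
             (ECall fn_flat [:: ECall fn_newname [:: V0; V2; EHd V3]; V1; EHd V3]);
           ECall fn_kids [:: V0; V1; ENode ELeaf V2; ETl V3]]) ELeaf.
Let e_flats :=
  EIf V0
    (ECall fn_cat [:: ECall fn_flat [:: EHd (EHd V0); EHd (ETl (EHd V0));
                                       ETl (ETl (EHd V0))];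
                      ECall fn_flats [:: ETl V0]]) ELeaf.
Let e_cf :=
  ECall fn_cat [:: ECall fn_flat [:: True_; EHd V0; EHd (ETl V0)];
                   ECall fn_flats [:: ETl (ETl V0)]].
Let e_subst :=
  EIf (isApp V4)
    (ENode Three
       (ENode (EIf (EHd (opOf V4)) (opOf V4)
                 (ENode ELeaf (ECall fn_lookup [:: nameOf V4; V0; V1])))
          (ECall fn_substs [:: V0; V1; V2; V3; argsOf V4])))
    (EIf (ETl (EHd V4)) (ENode Two (ECall fn_lookup [:: ETl V4; V2; V3])) V4).
Let e_substs :=
  EIf V4 (ENode (ECall fn_subst [:: V0; V1; V2; V3; EHd V4])
            (ECall fn_substs [:: V0; V1; V2; V3; ETl V4])) ELeaf.
Let e_key :=
  EIf (ECall fn_imm [:: V0]) ELeaf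
    (EIf (isApp V0) (EIf (EHd (opOf V0)) (ENode (opOf V0) True_) (ENode ELeaf True_))
       V0).
Let e_args :=
  EIf (ECall fn_imm [:: V0]) (ENode V0 ELeaf) (EIf (isApp V0) (argsOf V0) ELeaf).
Let e_profile :=
  EIf V0
    (ENode (ENode (EIf (isApp (EHd V0)) (ENode (EHd (ETl (nameOf (EHd V0)))) ELeaf)
                     ELeaf)
              (ECall fn_index [:: EHd V0; V1]))
       (ECall fn_profile [:: ETl V0; V1])) ELeaf.
Let e_pattern :=
  ENode (ECall fn_key [:: V0])
    (ENode (ECall fn_key [:: V1])
       (ECall fn_profile
          [:: ECall fn_cat [:: ECall fn_args [:: V0]; ECall fn_args [:: V1]];
              ECall fn_cat [:: ECall fn_args [:: V0]; ECall fn_args [:: V1]]])).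
Let e_test :=
  Or (ECall fn_eq [:: V0; V1])
    (ECall fn_mem [:: ECall fn_pattern [:: V0; V1]; ECall fn_table [::]]).
Let e_allwords :=
  EIf V4
    (And (ECall fn_test
            [:: ECall fn_subst [:: V0; V0; EHd (ETl V2); EHd V4; ETl (ETl V2)];
                ECall fn_subst [:: V1; V0; EHd (ETl V3); EHd V4; ETl (ETl V3)]])
       (ECall fn_allwords [:: V0; V1; V2; V3; ETl V4])) True_.
Let e_samesize :=
  EIf V0 (EIf V1 (ECall fn_samesize [:: ETl V0; ETl V1]) ELeaf) (EIf V1 ELeaf True_).
Let e_pair :=
  And (ECall fn_samesize [:: EHd (ETl V2); EHd (ETl V3)])
    (ECall fn_allwords [:: V0; V1; V2; V3;
                           ECall fn_words [:: EHd (ETl V2); EHd (ETl V2)]]).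
Let e_pairs :=
  EIf V2 (EIf V3 (And (ECall fn_pair [:: V0; V1; EHd V2; EHd V3])
                    (ECall fn_pairs [:: V0; V1; ETl V2; ETl V3])) ELeaf)
    (EIf V3 ELeaf True_).
Let e_names := EIf V0 (ENode (EHd (EHd V0)) (ECall fn_names [:: ETl V0])) ELeaf.
Let e_sametypes :=
  EIf V0
    (EIf V1
       (And (ECall fn_samesize [:: EHd (ETl (EHd V0)); EHd (ETl (EHd V1))])
          (And (ECall fn_eq [:: EHd (ETl (EHd (EHd V0))); EHd (ETl (EHd (EHd V1)))])
             (ECall fn_sametypes [:: ETl V0; ETl V1]))) ELeaf)
    (EIf V1 ELeaf True_).
Let e_try :=
  EIf V2
    (Or (And (ECall fn_sametypes [:: ETl V0; EHd V2])
           (ECall fn_pairs [:: ECall fn_names [:: ETl V0]; ECall fn_names [:: EHd V2];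
                               V0; ENode V1 (EHd V2)]))
       (ECall fn_try [:: V0; V1; ETl V2])) ELeaf.
Let e_check := ECall fn_try [:: V0; EHd V1; ECall fn_perms [:: ETl V1]].

(* The order is that of the indices [fn_main], [fn_cat], ...; [srt] lists the
   sorts of the symbols and [tbl] the valid patterns. *)
Definition decision_program (srt tbl : tree) : seq expr :=
  [:: e_main; e_cat; e_eq; e_mem; e_index; e_lookup; e_consall; e_inserts;
      e_insall; e_perms; e_conseach; e_words; e_allvar; e_imm; e_sort; e_nth;
      quote srt; e_vars; e_topargs; e_top; e_flat; e_kids; e_flats; e_cf;
      e_subst; e_substs; e_key; e_args; e_profile; e_pattern; quote tbl; e_test;
      e_allwords; e_samesize; e_pair; e_pairs; e_names; e_try; e_check;
      e_sametypes; e_newname].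

Variables srt tbl : tree.
Notation P := (decision_program srt tbl).

Lemma run_sorts ts : run P fn_sorts ts srt.
Proof. exact: eval_quote. Qed.

Lemma run_table ts : run P fn_table ts tbl.
Proof. exact: eval_quote. Qed.

Lemma run_cat s1 s2 :
  run P fn_cat [:: code_list s1; code_list s2] (code_list (s1 ++ s2)).
Proof.
elim: s1 => [|x s1 IH]; apply: wp_run => //=.
by exists (code_list (s1 ++ s2)).
Qed.

Lemma run_eq t u : run P fn_eq [:: t; u] (code_bool (t == u)).
Proof.
elim: t u => [|t1 IH1 t2 IH2] [|u1 u2]; apply: wp_run => //=.
exists (code_bool (t1 == u1)); first exact: IH1.
rewrite [Node _ _ == _]/(eq_op _ _) /= -!/(eq_op _ _).
case: eqP => //= _; exists (code_bool (t2 == u2)) => //; exact: IH2.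
Qed.
Lemma run_mem x s : run P fn_mem [:: x; code_list s] (code_bool (x \in s)).
Proof.
elim: s => [|y s IH]; apply: wp_run => //=.
exists (code_bool (x == y)); first exact: run_eq.
by rewrite in_cons; case: eqP => //= _; exists (code_bool (x \in s)).
Qed.

Lemma run_index x s : run P fn_index [:: x; code_list s] (code_nat (index x s)).
Proof.
elim: s => [|y s IH]; apply: wp_run => //=.
exists (code_bool (x == y)); first exact: run_eq.
by rewrite eq_sym; case: eqP => //= _; exists (code_nat (index x s)).
Qed.

Definition lookup (x : tree) (ks vs : seq tree) : tree :=
  if x \in ks then nth Leaf vs (index x ks) else Leaf.

Lemma run_lookup x ks vs :
  run P fn_lookup [:: x; code_list ks; code_list vs] (lookup x ks vs).
Proof.
elim: ks vs => [|k ks IH] vs; apply: wp_run => //=.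
exists (code_bool (x == k)); first exact: run_eq.
have tlE : tl_tree (code_list vs) = code_list (behead vs) by case: vs.
rewrite tlE /lookup in_cons /= eq_sym; case: eqP => /= _.
  by case: vs {tlE IH}.
exists (lookup x ks (behead vs)) => //.
by rewrite /lookup; case: ifP => // _; rewrite nth_behead.
Qed.

Definition code_lists (ss : seq (seq tree)) : tree := code_list (map code_list ss).

Lemma run_consall x ss :
  run P fn_consall [:: x; code_lists ss] (code_lists (map (cons x) ss)).
Proof.
elim: ss => [|s ss IH]; apply: wp_run => //=.
by exists (code_lists (map (cons x) ss)).
Qed.

Fixpoint inserts (T : Type) (x : T) (s : seq T) : seq (seq T) :=
  (x :: s) :: if s is y :: s' then map (cons y) (inserts x s') else [::].

Lemma run_inserts x s :
  run P fn_inserts [:: x; code_list s] (code_lists (inserts x s)).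
Proof.
elim: s => [|y s IH]; apply: wp_run => //=.
exists (code_lists (inserts x s)) => //.
by exists (code_lists (map (cons y) (inserts x s))) => //; apply: run_consall.
Qed.

Fixpoint perms (T : Type) (s : seq T) : seq (seq T) :=
  if s is x :: s' then flatten (map (inserts x) (perms s')) else [:: [::]].

Lemma run_catl ss1 ss2 :
  run P fn_cat [:: code_lists ss1; code_lists ss2] (code_lists (ss1 ++ ss2)).
Proof. by rewrite /code_lists map_cat; apply: run_cat. Qed.

Lemma run_insall x ss :
  run P fn_insall [:: x; code_lists ss]
    (code_lists (flatten (map (inserts x) ss))).
Proof.
elim: ss => [|s ss IH]; apply: wp_run => //=.
exists (code_lists (inserts x s)); first exact: run_inserts.
exists (code_lists (flatten (map (inserts x) ss))) => //.
eexists; [exact: run_catl|by []].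
Qed.

Lemma run_perms s : run P fn_perms [:: code_list s] (code_lists (perms s)).
Proof.
elim: s => [|x s IH]; apply: wp_run => //=.
exists (code_lists (perms s)) => //.
eexists; [exact: run_insall|by []].
Qed.

Fixpoint words (T : Type) (xs : seq T) (n : nat) : seq (seq T) :=
  if n is n'.+1 then flatten [seq map (cons x) (words xs n') | x <- xs]
  else [:: [::]].

Lemma run_conseach xs ss :
  run P fn_conseach [:: code_list xs; code_lists ss]
    (code_lists (flatten [seq map (cons x) ss | x <- xs])).
Proof.
elim: xs => [|x xs IH]; apply: wp_run => //=.
exists (code_lists (map (cons x) ss)); first exact: run_consall.
exists (code_lists (flatten [seq map (cons y) ss | y <- xs])) => //.
eexists; [exact: run_catl|by []].
Qed.

(** The second argument serves only as a unary length; [e_pair] passes the parameter list itself. *)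
Lemma run_words xs (s : seq tree) :
  run P fn_words [:: code_list xs; code_list s] (code_lists (words xs (size s))).
Proof.
elim: s => [|x s IH]; apply: wp_run => //=.
exists (code_lists (words xs (size s))) => //.
eexists; [exact: run_conseach|by []].
Qed.

Lemma run_nth i s : run P fn_nth [:: code_nat i; code_list s] (nth Leaf s i).
Proof.
elim: i s => [|i IH] s; apply: wp_run => //=; first by case: s.
have tlE : tl_tree (code_list s) = code_list (behead s) by case: s.
by rewrite tlE; eexists; [exact: IH|rewrite nth_behead].
Qed.

Lemma run_samesize (s1 s2 : seq tree) :
  run P fn_samesize [:: code_list s1; code_list s2]
    (code_bool (size s1 == size s2)).
Proof.
elim: s1 s2 => [|x1 s1 IH] [|x2 s2]; apply: wp_run => //=.
by exists (code_bool (size s1 == size s2)).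
Qed.

Definition code_var (x : nat) : tree := Node (code_nat 2) (code_nat x).

Lemma run_vars xs :
  run P fn_vars [:: code_seq code_nat xs] (code_seq code_var xs).
Proof.
elim: xs => [|x xs IH]; apply: wp_run => //=.
by exists (code_seq code_var xs).
Qed.
End Program.

(** * Programs on codes of terms *)

Section TermPrograms.
Variable Phi : signature.
Implicit Types (t u : term Phi) (ts : seq (term Phi)) (c : op Phi).

Lemma term_ind_mem (Q : term Phi -> Prop) :
  Q Tt -> Q Ff -> (forall v, Q (Var v)) ->
  (forall c ts, {in ts, forall t, Q t} -> Q (App c ts)) -> forall t, Q t.
Proof.
move=> Qtt Qff QV QA; apply: term_ind_nested => // c ts IH; apply: QA => t.
by move=> /(nthP Tt)[n /IH + <-].
Qed.

Lemma flatten_subP (T : eqType) (ss : seq (seq T)) (B : {pred T}) :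
  all (mem B) (flatten ss) = all (all (mem B)) ss.
Proof. by elim: ss => //= s ss IH; rewrite all_cat IH. Qed.

Lemma fvars_args (B : {pred fvar}) c ts :
  all (mem B) (fvars (App c ts)) -> {in ts, forall t, all (mem B) (fvars t)}.
Proof.
rewrite /= all_cat flatten_subP all_map => /andP[_ /allP h] t /h; exact.
Qed.

Lemma ivars_args (B : {pred nat}) c ts :
  all (mem B) (ivars (App c ts)) -> {in ts, forall t, all (mem B) (ivars t)}.
Proof. by rewrite /= flatten_subP all_map => /allP h t /h. Qed.

Lemma op_sort_args c ts s :
  op_sort c (map (@tsort Phi) ts) = Some s ->
  {in ts, forall t, exists s', tsort t = Some s'}.
Proof.
have nseqP n : map (@tsort Phi) ts == nseq n (Some ind) ->
    {in ts, forall t, exists s', tsort t = Some s'}.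
  move=> /eqP h t /(map_f (@tsort Phi)); rewrite h mem_nseq => /andP[_ /eqP ->].
  by exists ind.
case: c => [p|f|] /=.
- by case: ifP => // /nseqP.
- by case: ifP => // /nseqP.
- case: ts {nseqP} => [//|t0 [|t1 [|t2 [|t3 ts]]]] //=; last first.
  + by case: (tsort t0) => // -[].
  + case e0: (tsort t0) => [[]|] //; case: eqP => // e1 e2 t.
    rewrite !inE => /or3P[] /eqP ->; first by exists boole.
    * by exists s.
    * by exists s; rewrite -e1.
  + by case: (tsort t0) => // -[].
  + by case: (tsort t0) => // -[].
Qed.

(** The names of function variables are left open: [code_fvar] gives the input format, while path
    names give the format of the computed canonical form. *)
Fixpoint code_gen (cn : fvar -> tree) t : tree :=
  match t with
  | Tt => Node (code_nat 0) Leaf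
  | Ff => Node (code_nat 1) Leaf
  | Var v => Node (code_nat 2) (code_nat v)
  | App c ts =>
      Node (code_nat 3)
        (Node (if c is OpVar p then Node (code_nat 0) (cn p) else code_op c)
           (code_list (map (code_gen cn) ts)))
  end.

Lemma code_gen_fvar t : code_gen code_fvar t = code_term t.
Proof.
elim/term_ind_mem: t => [||v|c ts IH] //=.
have -> : map (code_gen code_fvar) ts = map (@code_term Phi) ts by apply/eq_in_map.
by case: c {IH}.
Qed.

Lemma code_gen_inj (B : {pred fvar}) cn : {in B &, injective cn} ->
  forall t u, all (mem B) (fvars t) -> all (mem B) (fvars u) ->
  code_gen cn t = code_gen cn u -> t = u.
Proof.
move=> cnI; elim/term_ind_mem => [||v|c ts IH] [||w|d us] //.
  by move=> _ _ [/code_nat_inj ->].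
move=> ht hu [hop /code_list_inj hts]; congr App.
  move: ht hu hop; case: c {IH} => [p|f|]; case: d => [q|g|] //=.
  + by move=> /andP[hp _] /andP[hq _] [/cnI ->].
  + by move=> _ _ [/code_nat_inj /val_inj /enum_rank_inj ->].
have {}ht := fvars_args ht; have {}hu := fvars_args hu.
elim: ts us IH ht hu hts => [|t ts IHts] [|u us] //= IH ht hu [htu hts].
congr cons.
  exact: (IH _ (mem_head _ _) _ (ht _ (mem_head _ _)) (hu _ (mem_head _ _)) htu).
apply: IHts hts => [v vts|v vts|v vts].
- by apply: IH; rewrite in_cons vts orbT.
- by apply: ht; rewrite in_cons vts orbT.
- by apply: hu; rewrite in_cons vts orbT.
Qed.

Definition sort_table : tree :=
  code_list [seq code_bool (is_boole (typ f).2) | f <- enum Phi].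

(** The program reads the sort of a function variable at this place of its name, whether the name is
    a [code_fvar] or a [newname]. *)
Definition sort_respecting (cn : fvar -> tree) (p : fvar) : Prop :=
  hd_tree (tl_tree (cn p)) = code_bool (is_boole (fv_type p).2).

Variable tbl : tree.
Notation P := (decision_program sort_table tbl).

Lemma run_allvar cn ts :
  run P fn_allvar [:: code_list (map (code_gen cn) ts)]
    (code_bool (all (@is_var Phi) ts)).
Proof.
elim: ts => [|t ts IH]; apply: wp_run => //=.
case: t => [||v|c us] //=.
by exists (code_bool (all (@is_var Phi) ts)).
Qed.

Lemma run_imm cn t :
  run P fn_imm [:: code_gen cn t] (code_bool (immediate t)).
Proof.
apply: wp_run; case: t => [||v|[p|f|] ts] //=.
by eexists; [exact: run_allvar|].
Qed.

Definition sort_of t : sort := odflt ind (tsort t).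

Lemma run_sort cn t :
  {in fvars t, forall p, sort_respecting cn p} -> tsort t != None ->
  run P fn_sort [:: code_gen cn t] (code_bool (is_boole (sort_of t))).
Proof.
elim/term_ind_mem: t => [||v|c ts IH] hcn wt; apply: wp_run => //=.
case: c hcn wt IH => [p|f|] hcn wt IH /=.
- rewrite /sort_of; move: wt => /=; case: ifP => //= _ _.
  by apply: hcn; rewrite mem_head.
- rewrite /sort_of; move: wt => /=; case: ifP => //= _ _.
  exists sort_table; first exact: run_sorts.
  exists (nth Leaf [seq code_bool (is_boole (typ f).2) | f <- enum Phi] (enum_rank f)).
    exact: run_nth.
  rewrite (nth_map f) ?nth_enum_rank//.
  by rewrite -cardE ltn_ord.
- have [s hs] : exists s, tsort (App OpCond ts) = Some s.
    by case e : (tsort _) wt => [s|] // _; exists s.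
  have hts := op_sort_args hs.
  case: ts IH hcn hs hts {wt} => [//|t0 [|t1 [|t2 [|t3 ts]]]] //=;
    try by case: (tsort t0) => // -[].
  move=> IH hcn hs hts.
  (* A well-sorted conditional has the sort of its middle argument, the only one that the program
     inspects. *)
  exists (code_bool (is_boole (sort_of t1))).
    apply: IH; rewrite ?inE ?eqxx ?orbT//.
      by move=> p hp; apply: hcn; rewrite !mem_cat hp ?orbT.
    by have [|s' ->] := hts t1; rewrite // !inE eqxx orbT.
  rewrite {2}/sort_of [tsort _]hs /sort_of.
  by move: hs; case: (tsort t0) => // -[] //; case: ifP => // _ ->.
Qed.

(* The name given to the equation for the [j]-th argument of a term whose own
   equation is named [m].  The sort is where [code_fvar] has it. *)
Definition newname (m : tree) (j : nat) (s : sort) : tree :=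
  Node (Node m (code_nat j)) (Node (code_bool (is_boole s)) Leaf).

Lemma run_newname cn m j t :
  {in fvars t, forall p, sort_respecting cn p} -> tsort t != None ->
  run P fn_newname [:: m; code_nat j; code_gen cn t] (newname m j (sort_of t)).
Proof.
move=> h1 h2; apply: wp_run => /=.
by eexists; [exact: (run_sort h1 h2)|].
Qed.

Lemma sort_respecting_code_fvar p : sort_respecting code_fvar p.
Proof. by rewrite /sort_respecting /=; case: (p.1.2). Qed.

Definition code_call (q : tree) (xs : seq nat) : tree :=
  Node (code_nat 3) (Node (Node Leaf q) (code_seq code_var xs)).

Fixpoint code_topargs (m : tree) (xs : seq nat) (j : nat) ts : seq tree :=
  if ts is t :: ts' then
    (if immediate t then code_gen code_fvar t else code_call (newname m j (sort_of t)) xs)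
      :: code_topargs m xs j.+1 ts'
  else [::].

Definition code_top (m : tree) (xs : seq nat) t : tree :=
  if t is App c ts
  then Node (code_nat 3) (Node (code_op c) (code_list (code_topargs m xs 0 ts)))
  else code_gen code_fvar t.

Lemma run_topargs m xs j ts :
  {in ts, forall t, tsort t != None} ->
  run P fn_topargs [:: m; code_seq code_nat xs; code_nat j;
                       code_list (map (code_gen code_fvar) ts)]
    (code_list (code_topargs m xs j ts)).
Proof.
elim: ts j => [|t ts IH] j wts; apply: wp_run => //=.
exists (code_bool (immediate t)); first exact: run_imm.
have {}IH : run P fn_topargs [:: m; code_seq code_nat xs; Node Leaf (code_nat j);
    code_list (map (code_gen code_fvar) ts)] (code_list (code_topargs m xs j.+1 ts)).
  by apply: (IH j.+1) => u uts; apply: wts; rewrite in_cons uts orbT.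
case: ifP => /= _.
  by eexists; [exact: IH|].
eexists; first apply: run_newname.
- by move=> p _; apply: sort_respecting_code_fvar.
- by apply: wts; rewrite mem_head.
- eexists; first exact: run_vars.
  by eexists; [exact: IH|].
Qed.

Definition wsorted t := tsort t != None.

Lemma wsorted_args c ts : wsorted (App c ts) -> {in ts, forall t, wsorted t}.
Proof.
rewrite /wsorted; case e : (tsort _) => [s|] // _ t /(op_sort_args e)[s' ->] //.
Qed.

Lemma run_top m xs t : wsorted t ->
  run P fn_top [:: m; code_seq code_nat xs; code_gen code_fvar t] (code_top m xs t).
Proof.
case: t => [||v|c ts] wt; apply: wp_run => //=.
eexists; first by apply: (run_topargs m xs 0); apply: wsorted_args wt.
by case: c {wt}.
Qed.

(** * Positions of the non-immediate proper subterms *)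

(** Paths come in preorder, the order in which [fn_flat] and [fn_kids] emit equations, so the two
    lists agree literally. Nothing below an immediate argument is listed, its own arguments being
    variables. *)
Fixpoint positions t : seq (seq nat * term Phi) :=
  if t is App c ts then
    (fix go (j : nat) ts :=
       if ts is t :: ts' then
         (if immediate t then [::]
          else ([:: j], t) :: [seq (j :: x.1, x.2) | x <- positions t])
         ++ go j.+1 ts'
       else [::]) 0 ts
  else [::].

Definition position1 (j : nat) t : seq (seq nat * term Phi) :=
  if immediate t then [::]
  else ([:: j], t) :: [seq (j :: x.1, x.2) | x <- positions t].

Fixpoint positions_from (j : nat) ts : seq (seq nat * term Phi) :=
  if ts is t :: ts' then position1 j t ++ positions_from j.+1 ts' else [::].

Lemma positions_App c ts : positions (App c ts) = positions_from 0 ts.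
Proof. by rewrite /=; elim: ts 0 => //= t ts IH j; rewrite IH. Qed.

Definition subterms t : seq (term Phi) := if t is App _ ts then ts else [::].

Fixpoint path_name (m : tree) t (l : seq nat) : tree :=
  if l is j :: l' then
    path_name (newname m j (sort_of (nth Tt (subterms t) j))) (nth Tt (subterms t) j) l'
  else m.

Definition code_part (m : tree) (xs : seq nat) t : tree :=
  Node m (Node (code_seq code_nat xs) (code_top m xs t)).

Definition code_flat (m : tree) (xs : seq nat) t : seq tree :=
  [seq code_part (path_name m t x.1) xs x.2 | x <- ([::], t) :: positions t].

(** The arguments [ts0] already treated are carried along because [path_name] looks an argument up
    by its index in the whole term. *)
Lemma run_kids m xs c ts0 ts :
  {in ts, forall t, wsorted t} ->
  {in ts, forall t, forall m xs, run P fn_flat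
    [:: m; code_seq code_nat xs; code_gen code_fvar t] (code_list (code_flat m xs t))} ->
  run P fn_kids [:: m; code_seq code_nat xs; code_nat (size ts0);
                    code_list (map (code_gen code_fvar) ts)]
    (code_list [seq code_part (path_name m (App c (ts0 ++ ts)) x.1) xs x.2
               | x <- positions_from (size ts0) ts]).
Proof.
elim: ts ts0 => [|t ts IH] ts0 wts hts; apply: wp_run => //=.
have := IH (rcons ts0 t); rewrite cat_rcons size_rcons => {}IH.
exists (code_bool (immediate t)); first exact: run_imm.
have {}IH := IH
  (fun u uts => wts u (mem_behead (s := t :: ts) uts))
  (fun u uts => hts u (mem_behead (s := t :: ts) uts)).
rewrite map_cat /position1; case: ifP => /= _.
  eexists; first exact: IH.
  by eexists; [exact: (run_cat _ _ [::])|].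
eexists; first apply: run_newname.
- by move=> p _; apply: sort_respecting_code_fvar.
- by apply: wts; rewrite mem_head.
- eexists; first by apply: hts; rewrite mem_head.
  eexists; first exact: IH.
  eexists; first exact: run_cat.
  rewrite /code_flat nth_cat ltnn subnn /= -map_comp; congr (Node _ (code_list (_ ++ _))).
  by apply: eq_map => -[l u] /=; rewrite nth_cat ltnn subnn.
Qed.

Lemma run_flat m xs t : wsorted t ->
  run P fn_flat [:: m; code_seq code_nat xs; code_gen code_fvar t]
    (code_list (code_flat m xs t)).
Proof.
elim/term_ind_mem: t m xs => [||v|c ts IH] m xs wt; apply: wp_run => /=;
  (eexists; first by apply: (run_top _ _ wt)) => //.
have wts := wsorted_args wt.
eexists; first apply: (run_kids m xs c [::]) => //.
  by move=> t tts m' xs'; apply: IH => //; apply: wts.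
by rewrite -(positions_App c).
Qed.

Definition root_parts (E : extprogram Phi) : seq (option fvar * seq nat * term Phi) :=
  (None, xvars E, Defs.head E) :: [seq (Some (lhs e), params e, rhs e) | e <- body E].

(** The head has no function variable of its own. [Node Leaf Leaf] is no [code_fvar p], since the
    right child of the latter is a [Node]. *)
Definition root_name (o : option fvar) : tree :=
  if o is Some p then code_fvar p else Node Leaf Leaf.

Definition code_cf (E : extprogram Phi) : seq tree :=
  flatten [seq code_flat (root_name r.1.1) r.1.2 r.2 | r <- root_parts E].

Lemma wsorted_head (E : extprogram Phi) : wsorted (Defs.head E).
Proof. by have /and4P[] := programP E. Qed.

Lemma wsorted_rhs (E : extprogram Phi) : {in body E, forall e, wsorted (rhs e)}.
Proof.
have /and4P[_ _ _ /allP h] := programP E => e /h /and5P[_ _ _ _ /eqP].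
by rewrite /wsorted => ->.
Qed.

Lemma run_cf (E : extprogram Phi) :
  run P fn_cf [:: code_extprogram E] (code_list (code_cf E)).
Proof.
have run_flats es : {in es, forall e, wsorted (rhs e)} ->
    run P fn_flats [:: code_seq (@code_equation Phi) es]
    (code_list (flatten [seq code_flat (code_fvar (lhs e)) (params e) (rhs e) | e <- es])).
  elim: es => [|e es IH] wes; apply: wp_run => //=.
  rewrite -code_gen_fvar.
  eexists; first by apply: run_flat; apply: wes; rewrite mem_head.
  eexists; first by apply: IH => e' e's; apply: wes; rewrite in_cons e's orbT.
  by eexists; [exact: run_cat|].
apply: wp_run => /=; rewrite -code_gen_fvar.
eexists; first exact: run_flat (wsorted_head E).
eexists; first by apply: run_flats; exact: wsorted_rhs.
by eexists; [exact: run_cat|rewrite /code_cf /= -map_comp].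
Qed.

(** * Substitution and patterns on codes *)

Lemma run_subst kf vf kv vv cn cn' (sg : fvar -> fvar) (th : nat -> nat) t :
  {in fvars t, forall p, lookup (cn p) kf vf = cn' (sg p)} ->
  {in ivars t, forall x, lookup (code_nat x) kv vv = code_nat (th x)} ->
  run P fn_subst [:: code_list kf; code_list vf; code_list kv; code_list vv;
                     code_gen cn t] (code_gen cn' (rename sg th t)).
Proof.
elim/term_ind_mem: t => [||v|c ts IH] hf hv; apply: wp_run => //=.
  by eexists; [exact: run_lookup|rewrite hv ?mem_head].
have {}IH : run P fn_substs [:: code_list kf; code_list vf; code_list kv; code_list vv;
    code_list (map (code_gen cn) ts)]
    (code_list (map (code_gen cn') (map (rename sg th) ts))).
  have {hf}: {in flatten (map (@fvars Phi) ts),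
      forall p, lookup (cn p) kf vf = cn' (sg p)}.
    by move=> p hp; apply: hf; rewrite /= mem_cat hp orbT.
  move: hv => /=; elim: ts IH => [|t ts IHts] IH hv hf; apply: wp_run => //=.
  eexists; first apply: IH; first exact: mem_head.
  - by move=> p hp; apply: hf; rewrite /= mem_cat hp.
  - by move=> p hp; apply: hv; rewrite /= mem_cat hp.
  - eexists; first apply: IHts => [u uts|x hx|p hp].
    + by apply: IH; rewrite in_cons uts orbT.
    + by apply: hv; rewrite mem_cat hx orbT.
    + by apply: hf; rewrite /= mem_cat hp orbT.
    + by [].
case: c hf {hv} => [p|f|] hf /=.
- eexists; first exact: run_lookup.
  by eexists; [exact: IH|rewrite hf ?mem_head].
- by eexists; [exact: IH|].
- by eexists; [exact: IH|].
Qed.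

(** The outermost operation without its arguments. The right child separates the constants ([Leaf])
    from applications ([Node Leaf Leaf]); the name of a function variable is dropped, as it varies
    over an infinite set. *)
Definition term_key t : tree :=
  if immediate t then Leaf else
  match t with
  | Tt => Node (code_nat 0) Leaf
  | Ff => Node (code_nat 1) Leaf
  | Var _ => Leaf
  | App (OpVar _) _ => Node Leaf (Node Leaf Leaf)
  | App c _ => Node (code_op c) (Node Leaf Leaf)
  end.

Definition term_args t : seq (term Phi) :=
  if immediate t then [:: t] else subterms t.

Definition flag t : tree :=
  if t is App (OpVar p) _ then Node (code_bool (is_boole (fv_type p).2)) Leaf else Leaf.

(** Indices of first occurrence encode which constituents coincide. In [pattern] both terms share
    one list, so that coincidences across the two terms are recorded as well. *)
Definition profile (ts us : seq (term Phi)) : seq tree :=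
  [seq Node (flag t) (code_nat (index t us)) | t <- ts].

Definition pattern t u : tree :=
  Node (term_key t) (Node (term_key u)
    (code_list (profile (term_args t ++ term_args u) (term_args t ++ term_args u)))).

Lemma run_key cn t : run P fn_key [:: code_gen cn t] (term_key t).
Proof.
apply: wp_run => /=; exists (code_bool (immediate t)); first exact: run_imm.
by rewrite /term_key; case: t => [||v|[p|f|] ts] //=; case: (all _ _).
Qed.

Lemma run_args cn t :
  run P fn_args [:: code_gen cn t] (code_list (map (code_gen cn) (term_args t))).
Proof.
apply: wp_run => /=; exists (code_bool (immediate t)); first exact: run_imm.
by rewrite /term_args; case: t => [||v|[p|f|] ts] //=; case: (all _ _).
Qed.

Section Names.
Variables (B : {pred fvar}) (cn : fvar -> tree).
Hypothesis cn_inj : {in B &, injective cn}.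
Hypothesis cn_sort : {in B, forall p, sort_respecting cn p}.

Lemma index_code_gen t ts : all (mem B) (fvars t) ->
  {in ts, forall u, all (mem B) (fvars u)} ->
  index (code_gen cn t) (map (code_gen cn) ts) = index t ts.
Proof.
move=> ht; elim: ts => //= u ts IH hts.
rewrite IH => [|v vts]; last by apply: hts; rewrite in_cons vts orbT.
have -> // : (code_gen cn u == code_gen cn t) = (u == t).
apply/eqP/eqP => [|-> //].
by apply: (code_gen_inj cn_inj) => //; apply: hts; rewrite mem_head.
Qed.

Lemma run_profile ts us :
  {in ts, forall t, all (mem B) (fvars t)} -> {in us, forall t, all (mem B) (fvars t)} ->
  all (@immediate Phi) ts ->
  run P fn_profile [:: code_list (map (code_gen cn) ts);
                       code_list (map (code_gen cn) us)] (code_list (profile ts us)).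
Proof.
elim: ts => [|t ts IH] hts hus; first by move=> _; apply: wp_run.
move=> /= /andP[it its]; apply: wp_run => /=.
have ht : all (mem B) (fvars t) by apply: hts; rewrite mem_head.
have {IH its}IH := IH (fun u uts => hts u (mem_behead (s := t :: ts) uts)) hus its.
case: t it hts ht => [||v|[p|f|] vs] // _ hts ht /=;
  (eexists; first exact: run_index); (eexists; first exact: IH).
  by rewrite (index_code_gen (t := Var v)).
rewrite (index_code_gen (t := App (OpVar p) vs))//.
have pB : p \in B by case/andP: ht.
by have := cn_sort pB; rewrite /sort_respecting => ->.
Qed.

Lemma irreducible_args t : irreducible_term t -> all (@immediate Phi) (term_args t).
Proof.
rewrite /term_args; case: ifP => [/= -> //|]; case: t => //= c ts.
by rewrite /immediate; case: c => [p ->|f|].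
Qed.

Lemma term_args_fvars t : all (mem B) (fvars t) ->
  {in term_args t, forall u, all (mem B) (fvars u)}.
Proof.
move=> ht u; rewrite /term_args; case: ifP => _; first by rewrite inE => /eqP ->.
case: t ht => [||v|c ts] ht //=; exact: fvars_args ht u.
Qed.

Lemma run_pattern t u :
  all (mem B) (fvars t) -> all (mem B) (fvars u) ->
  irreducible_term t -> irreducible_term u ->
  run P fn_pattern [:: code_gen cn t; code_gen cn u] (pattern t u).
Proof.
move=> ht hu it iu; apply: wp_run => /=.
eexists; first exact: run_key.
eexists; first exact: run_key.
do 2![eexists; first exact: run_args; eexists; first exact: run_args;
  eexists; first exact: run_cat].
have h : {in term_args t ++ term_args u, forall v, all (mem B) (fvars v)}.
  by move=> v; rewrite mem_cat => /orP[]; apply: term_args_fvars.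
eexists; last by [].
rewrite -map_cat; apply: run_profile => //.
by rewrite all_cat !irreducible_args.
Qed.

Definition test (T : seq tree) t u : bool := (t == u) || (pattern t u \in T).

Lemma run_test T t u : tbl = code_list T ->
  all (mem B) (fvars t) -> all (mem B) (fvars u) ->
  irreducible_term t -> irreducible_term u ->
  run P fn_test [:: code_gen cn t; code_gen cn u] (code_bool (test T t u)).
Proof.
move=> tE ht hu it iu; apply: wp_run => /=.
eexists; first exact: run_eq.
have -> : (code_gen cn t == code_gen cn u) = (t == u).
  by apply/eqP/eqP => [|-> //]; apply: (code_gen_inj cn_inj).
rewrite /test; case: eqP => //= _.
eexists; first exact: run_pattern.
eexists; first exact: run_table.
by rewrite tE; eexists; [exact: run_mem|].
Qed.

End Names.

(** * Renaming, words and permutations *)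

Lemma rename_comp sg1 th1 sg2 th2 t :
  rename sg2 th2 (rename sg1 th1 t) = rename (sg2 \o sg1) (th2 \o th1) t.
Proof.
elim/term_ind_mem: t => //= c ts IH; congr App; first by case: c {IH}.
by rewrite -map_comp; apply/eq_in_map.
Qed.

Lemma fvars_rename sg th t : fvars (rename sg th t) = map sg (fvars t).
Proof.
elim/term_ind_mem: t => //= c ts IH; rewrite map_cat map_flatten -!map_comp.
have /eq_in_map -> : {in ts, @fvars Phi \o rename sg th =1 map sg \o @fvars Phi} by [].
by case: c {IH}.
Qed.

Lemma ivars_rename sg th t : ivars (rename sg th t) = map th (ivars t).
Proof.
elim/term_ind_mem: t => //= c ts IH; rewrite map_flatten -!map_comp.
by have /eq_in_map -> : {in ts, @ivars Phi \o rename sg th =1 map th \o @ivars Phi} by [].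
Qed.

Lemma tsort_rename sg th t : {in fvars t, forall p, fv_type (sg p) = fv_type p} ->
  tsort (rename sg th t) = tsort t.
Proof.
elim/term_ind_mem: t => //= c ts IH h; rewrite -map_comp.
have -> : map (@tsort Phi \o rename sg th) ts = map (@tsort Phi) ts.
  apply/eq_in_map => u uts; apply: IH => // p pu; apply: h.
  by rewrite mem_cat; apply/orP; right; apply/flatten_mapP; exists u.
by case: c h {IH} => //= p h; rewrite h ?mem_head.
Qed.

Lemma is_var_rename sg th t : is_var (rename sg th t) = is_var t.
Proof. by case: t. Qed.

Lemma immediate_rename sg th t : immediate (rename sg th t) = immediate t.
Proof.
case: t => [||v|[p|f|] ts] //=.
by rewrite all_map; apply: eq_all => u; apply: is_var_rename.
Qed.

Lemma irreducible_rename sg th t :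
  irreducible_term (rename sg th t) = irreducible_term t.
Proof.
have im := immediate_rename sg th t; case: t im => //= c ts im.
congr (_ || _); first exact: im.
by rewrite all_map; apply: eq_all => u; apply: immediate_rename.
Qed.

Lemma all_words (xs : seq nat) n w :
  w \in words xs n -> size w = n /\ all (mem xs) w.
Proof.
elim: n w => [|n IH] w /=; first by rewrite inE => /eqP ->.
by move=> /flatten_mapP[x xxs /mapP[v /IH[<- hv] ->]] /=; rewrite xxs.
Qed.

Lemma mem_words (T : eqType) (xs : seq T) n w :
  size w = n -> all (mem xs) w -> w \in words xs n.
Proof.
move=> <-; elim: w {n} => //= x w IH /andP[xxs /IH hw].
by apply/flatten_mapP; exists x => //; apply: map_f.
Qed.

Lemma words_map (T T' : Type) (f : T -> T') xs n :
  words (map f xs) n = map (map f) (words xs n).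
Proof.
elim: n => //= n ->; rewrite map_flatten -!map_comp; congr flatten.
by apply: eq_map => x /=; rewrite -!map_comp.
Qed.

Lemma perms_map (T T' : Type) (f : T -> T') s :
  perms (map f s) = map (map f) (perms s).
Proof.
elim: s => //= x s ->; rewrite map_flatten -!map_comp; congr flatten.
apply: eq_map => s' /=; elim: s' => //= y s' ->.
by rewrite -!map_comp.
Qed.

Lemma mem_perms (T : eqType) (s s' : seq T) : s' \in perms s -> perm_eq s' s.
Proof.
elim: s s' => [|x s IH] s' /=; first by rewrite inE => /eqP ->.
move=> /flatten_mapP[s1 /IH s1s]; rewrite -(perm_cons x) in s1s.
move=> h; apply: perm_trans s1s; elim: s1 s' h => [|y s1 IHs] s' /=.
  by rewrite inE => /eqP ->.
rewrite inE => /predU1P[-> //|/mapP[s2 /IHs h ->]].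
rewrite -(perm_cons y) in h; apply: perm_trans h _.
exact/permPl/(perm_catCA [:: y] [:: x] s1).
Qed.

Lemma perms_mem (T : eqType) (s s' : seq T) : perm_eq s' s -> s' \in perms s.
Proof.
elim: s s' => [|x s IH] s' /=; first by move=> /perm_nilP ->.
move=> h; have xs' : x \in s' by rewrite (perm_mem h) mem_head.
case/splitPr: xs' h => s1 s2 h; apply/flatten_mapP; exists (s1 ++ s2).
  apply: IH; rewrite -(perm_cons x); apply: perm_trans h; rewrite perm_sym.
  exact/permPl/(perm_catCA s1 [:: x] s2).
elim: s1 {h} => [|y s1 IHs] /=; first by case: s2 => *; rewrite mem_head.
by rewrite in_cons map_f ?orbT.
Qed.

Lemma index_map_in (T T' : eqType) (f : T -> T') (B : {pred T}) :
  {in B &, injective f} -> forall x s, x \in B -> {subset s <= B} ->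
  index (f x) (map f s) = index x s.
Proof.
move=> fI x s xB; elim: s => //= y s IH hs.
rewrite IH => [|z zs]; last by apply: hs; rewrite in_cons zs orbT.
by rewrite (inj_in_eq fI)// hs// mem_head.
Qed.

(** The default [p] makes this the identity off [ps] when the lists have equal length, so that it
    can preserve types everywhere. *)
Definition lift_map (ps qs : seq fvar) (p : fvar) : fvar := nth p qs (index p ps).

Definition subst_at (xs w : seq nat) (v : nat) : nat := nth 0 w (index v xs).

(* The words [w] are the substitutions of variables of [xs] for those of [xs]:
   they identify the variables in all possible ways. *)
Definition same_part_test T (sg : fvar -> fvar) (xs : seq nat) t (ys : seq nat) u :=
  (size xs == size ys) &&
  all (fun w => test T (rename id (subst_at xs w) t) (rename sg (subst_at ys w) u))
    (words xs (size xs)).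

Definition code_eqn (m : tree) (cn : fvar -> tree) (xs : seq nat) t : tree :=
  Node m (Node (code_seq code_nat xs) (code_gen cn t)).

Definition good_part (ps : seq fvar) (xs : seq nat) t : Prop :=
  [/\ irreducible_term t, all (mem ps) (fvars t) & all (mem xs) (ivars t)].

(** * Comparison of parts and of programs *)

Section Pairing.
Variables (T : seq tree) (cn1 cn2 : fvar -> tree) (ps qs : seq fvar).
Hypothesis tblE : tbl = code_list T.
Hypothesis cn1_inj : {in ps &, injective cn1}.
Hypothesis cn2_inj : {in qs &, injective cn2}.
Hypothesis cn1_sort : {in ps, forall p, sort_respecting cn1 p}.
Hypothesis size_ps : size ps = size qs.

Let sg := lift_map qs ps.

Lemma lookup_names p : p \in qs -> lookup (cn2 p) (map cn2 qs) (map cn1 ps) = cn1 (sg p).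
Proof.
move=> pqs; rewrite /lookup map_f// (index_map_in cn2_inj)//.
by rewrite (nth_map p)// size_ps index_mem.
Qed.

Lemma lookup_vars (xs w : seq nat) x : x \in xs -> size xs = size w ->
  lookup (code_nat x) (map code_nat xs) (map code_nat w) = code_nat (subst_at xs w x).
Proof.
move=> xxs ew; rewrite /lookup map_f// index_map; last exact: code_nat_inj.
by rewrite (nth_map 0)// -ew index_mem.
Qed.

Lemma run_allwords m1 xs t m2 ys u (ws : seq (seq nat)) :
  good_part ps xs t -> good_part qs ys u -> size xs = size ys ->
  {in ws, forall w, size w = size xs} ->
  run P fn_allwords [:: code_list (map cn1 ps); code_list (map cn2 qs);
    code_eqn m1 cn1 xs t; code_eqn m2 cn2 ys u; code_lists (map (map code_nat) ws)]
    (code_bool (all (fun w => test T (rename id (subst_at xs w) t)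
                                (rename sg (subst_at ys w) u)) ws)).
Proof.
move=> [it /allP ht /allP vt] [iu /allP hu /allP vu] exy.
elim: ws => [|w ws IH] hws; apply: wp_run => //=.
have ew : size w = size xs by apply: hws; rewrite mem_head.
eexists.
  apply: (run_subst (cn' := cn1) (sg := id) (th := subst_at xs w)) => [p /ht pps|x /vt xxs].
    rewrite /lookup map_f// (index_map_in cn1_inj)//.
    by rewrite (nth_map p) ?index_mem// nth_index.
  exact: lookup_vars.
eexists.
  (* The second term is rewritten with the names of the first program; both terms are then coded by
     [cn1] and can be compared. *)
  apply: (run_subst (cn' := cn1) (sg := sg) (th := subst_at ys w)) => [p /hu pqs|x /vu xys].
    exact: lookup_names.
  by rewrite -lookup_vars// -exy.
eexists.
  apply: (run_test (B := mem ps) cn1_inj cn1_sort tblE);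
    rewrite ?irreducible_rename// fvars_rename.
  - by rewrite map_id; apply/allP.
  - apply/allP => _ /mapP[p /hu pqs ->] /=.
    by rewrite mem_nth// size_ps index_mem.
case: (test _ _ _) => //=.
by eexists; first by apply: IH => v vws; apply: hws; rewrite in_cons vws orbT.
Qed.

Lemma run_pair m1 xs t m2 ys u :
  good_part ps xs t -> good_part qs ys u ->
  run P fn_pair [:: code_list (map cn1 ps); code_list (map cn2 qs);
    code_eqn m1 cn1 xs t; code_eqn m2 cn2 ys u]
    (code_bool (same_part_test T sg xs t ys u)).
Proof.
move=> gt gu; apply: wp_run => /=.
eexists; first exact: run_samesize.
rewrite !size_map /same_part_test; case: eqP => //= exy.
eexists; first exact: run_words.
eexists; last by [].
rewrite words_map size_map.
by apply: run_allwords => // w /all_words[].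
Qed.

Definition code_parts cn (l : seq (tree * seq nat * term Phi)) : tree :=
  code_list [seq code_eqn x.1.1 cn x.1.2 x.2 | x <- l].

Definition same_parts_test (sg : fvar -> fvar) (l1 l2 : seq (tree * seq nat * term Phi)) :=
  all2 (fun x y => same_part_test T sg x.1.2 x.2 y.1.2 y.2) l1 l2.

Lemma run_pairs l1 l2 :
  {in l1, forall x, good_part ps x.1.2 x.2} ->
  {in l2, forall x, good_part qs x.1.2 x.2} ->
  run P fn_pairs [:: code_list (map cn1 ps); code_list (map cn2 qs);
    code_parts cn1 l1; code_parts cn2 l2] (code_bool (same_parts_test sg l1 l2)).
Proof.
elim: l1 l2 => [|x1 l1 IH] [|x2 l2] h1 h2; apply: wp_run => //=.
eexists; first by apply: run_pair; [apply: h1|apply: h2]; rewrite mem_head.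
case: same_part_test => //=.
by eexists; first by apply: IH => z zl; [apply: h1|apply: h2];
  rewrite in_cons zl orbT.
Qed.

End Pairing.

Definition body_parts (cn : fvar -> tree) (es : seq (equation Phi)) :=
  [seq (cn (lhs e), params e, rhs e) | e <- es].

Lemma run_names cn es :
  run P fn_names [:: code_parts cn (body_parts cn es)]
    (code_list (map cn (map (@lhs Phi) es))).
Proof.
elim: es => [|e es IH]; apply: wp_run => //=.
by eexists; [exact: IH|].
Qed.

(** A [newname] contains no arity, so arities are compared through the lengths of the parameter
    lists. *)
Definition same_types (es fs : seq (equation Phi)) : bool :=
  all2 (fun e f : equation Phi => (size (params e) == size (params f)) &&
    ((fv_type (lhs e)).2 == (fv_type (lhs f)).2)) es fs.

Lemma run_sametypes cn1 cn2 es fs :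
  {in map (@lhs Phi) es, forall p, sort_respecting cn1 p} ->
  {in map (@lhs Phi) fs, forall p, sort_respecting cn2 p} ->
  run P fn_sametypes [:: code_parts cn1 (body_parts cn1 es);
    code_parts cn2 (body_parts cn2 fs)] (code_bool (same_types es fs)).
Proof.
elim: es fs => [|e es IH] [|f fs] h1 h2; apply: wp_run => //=.
eexists; first exact: run_samesize.
rewrite !size_map; case: eqP => //= _.
eexists; first exact: run_eq.
have h1e : sort_respecting cn1 (lhs e) by apply: h1; rewrite mem_head.
have h2f : sort_respecting cn2 (lhs f) by apply: h2; rewrite mem_head.
rewrite h1e h2f.
have -> : (code_bool (is_boole (fv_type (lhs e)).2) ==
  code_bool (is_boole (fv_type (lhs f)).2)) =
  ((fv_type (lhs e)).2 == (fv_type (lhs f)).2).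
  by case: (fv_type (lhs e)).2; case: (fv_type (lhs f)).2.
case: eqP => //= _.
by eexists; first by apply: IH => p hp; [apply: h1|apply: h2]; rewrite in_cons hp orbT.
Qed.

(** [sg] leads from the second program to the first, the direction in which the algorithm
    renames. *)
Definition aligned_test T (xs : seq nat) t (es : seq (equation Phi)) (ys : seq nat) u
    (fs : seq (equation Phi)) : bool :=
  let sg := lift_map (map (@lhs Phi) fs) (map (@lhs Phi) es) in
  [&& same_types es fs, same_part_test T sg xs t ys u &
      all2 (fun e f => same_part_test T sg (params e) (rhs e) (params f) (rhs f)) es fs].

Definition programs_test T (xs : seq nat) t (es : seq (equation Phi)) (ys : seq nat) u
    (fs : seq (equation Phi)) : bool :=
  has (aligned_test T xs t es ys u) (perms fs).

Definition good_body (es : seq (equation Phi)) : Prop :=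
  {in es, forall e, good_part (map (@lhs Phi) es) (params e) (rhs e)}.

Lemma good_body_perm es fs : perm_eq es fs -> good_body es -> good_body fs.
Proof.
move=> h g e; rewrite -(perm_mem h) => /g[h1 /allP h2 h3]; split=> //.
by apply/allP => p /h2 /=; rewrite -(perm_mem (perm_map _ h)).
Qed.

Lemma run_check T cn1 cn2 m1 xs t es m2 ys u fs :
  tbl = code_list T ->
  {in map (@lhs Phi) es &, injective cn1} -> {in map (@lhs Phi) fs &, injective cn2} ->
  {in map (@lhs Phi) es, forall p, sort_respecting cn1 p} ->
  {in map (@lhs Phi) fs, forall p, sort_respecting cn2 p} ->
  good_part (map (@lhs Phi) es) xs t -> good_part (map (@lhs Phi) fs) ys u ->
  good_body es -> good_body fs ->
  run P fn_check [:: code_parts cn1 ((m1, xs, t) :: body_parts cn1 es);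
    code_parts cn2 ((m2, ys, u) :: body_parts cn2 fs)]
    (code_bool (programs_test T xs t es ys u fs)).
Proof.
move=> tE I1 I2 S1 S2 gt gu ges gfs; apply: wp_run => /=.
eexists; first exact: run_perms.
eexists; last by [].
rewrite /programs_test.
have -> : perms [seq code_eqn x.1.1 cn2 x.1.2 x.2 | x <- body_parts cn2 fs] =
  [seq [seq code_eqn x.1.1 cn2 x.1.2 x.2 | x <- body_parts cn2 fs'] | fs' <- perms fs].
  rewrite /body_parts -map_comp perms_map; apply: eq_map => s.
  by rewrite -map_comp.
have : {in perms fs, forall fs', perm_eq fs' fs} by move=> ?; apply: mem_perms.
elim: (perms fs) => [|fs' pl IH] hpl; apply: wp_run => //=.
have pf : perm_eq fs fs' by rewrite perm_sym; apply: hpl; rewrite mem_head.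
have pm : map (@lhs Phi) fs =i map (@lhs Phi) fs' by apply/perm_mem/perm_map.
have {}IH := IH (fun s sp => hpl s (mem_behead (s := fs' :: pl) sp)).
eexists; first by apply: run_sametypes => // p; rewrite -pm => /S2.
rewrite /aligned_test; case st : (same_types es fs') => /=; last first.
  by eexists; [exact: IH|].
have es' : size es = size fs' by move: st; rewrite /same_types all2E => /andP[/eqP].
eexists; first exact: run_names.
eexists; first exact: run_names.
eexists.
  apply: (@run_pairs T cn1 cn2 (map (@lhs Phi) es) (map (@lhs Phi) fs') tE I1 _ S1 _
    ((m1, xs, t) :: body_parts cn1 es) ((m2, ys, u) :: body_parts cn2 fs')).
  - by move=> p q; rewrite -!pm; apply: I2.
  - by rewrite !size_map.
  - by move=> x; rewrite inE => /predU1P[->//|/mapP[e ee ->]]; exact: ges.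
  - move=> x; rewrite inE => /predU1P[->|/mapP[e ee ->]] /=.
      case: gu => h1 /allP h2 h3; split=> //.
      by apply/allP => p /h2 /=; rewrite -pm.
    exact: (good_body_perm pf gfs).
rewrite /= /same_parts_test.
set b1 := same_part_test _ _ _ _ _ _; case: b1 => //=; last first.
  by eexists; [exact: IH|].
have -> : forall (F : seq nat -> term Phi -> seq nat -> term Phi -> bool),
  all2 (fun x y => F x.1.2 x.2 y.1.2 y.2) (body_parts cn1 es) (body_parts cn2 fs') =
  all2 (fun e f => F (params e) (rhs e) (params f) (rhs f)) es fs'.
  move=> F; rewrite /body_parts; clear; elim: es fs' => [|e es IH] [|f fs] //=.
  by rewrite IH.
case: all2 => //=.
by eexists; [exact: IH|].
Qed.

End TermPrograms.

(** * Untyped denotations *)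

Section Semantics.
Variables (Phi : signature) (A : structure Phi).
Implicit Types (t u : term Phi) (ts : seq (term Phi)) (k : ftype).
Notation V := (A + bool)%type.

(** With both sorts of values in one type, a renaming of function variables or an equality of
    function types acts on denotations without casts. *)
Definition vinj (s : Defs.sort) : dom A s -> V :=
  match s with ind => inl | boole => inr end.

Definition vproj (s : Defs.sort) (w : V) : option (dom A s) :=
  match s, w with
  | ind, inl a => Some a
  | boole, inr b => Some b
  | _, _ => None
  end.

Definition vsort (w : V) : Defs.sort := if w is inl _ then ind else boole.

Lemma vinjK s : pcancel (@vinj s) (@vproj s).
Proof. by case: s. Qed.

Lemma vsort_vinj s d : vsort (@vinj s d) = s.
Proof. by case: s d. Qed.

Lemma vprojK s w : vsort w = s -> omap (@vinj s) (vproj s w) = Some w.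
Proof. by move=> <-; case: w. Qed.

Definition ucall k (f : pfun A k) (xs : seq A) : option V :=
  obind (fun x : k.1.-tuple A => omap (@vinj k.2) (f x)) (insub xs).

Definition as_ind (w : option V) : option A := if w is Some (inl a) then Some a else None.

Definition uapply (f : seq A -> option V) (ws : seq (option V)) : option V :=
  obind f (strict_seq (map as_ind ws)).

Definition ucond (ws : seq (option V)) : option V :=
  match ws with [:: Some (inr b); w1; w2] => if b then w1 else w2 | _ => None end.

(* Values are untyped here: [rho p] stands for a partial function of type
   [fv_type p] when [typed_valuation rho]. *)
Definition valuation := fvar -> seq A -> option V.

Definition typed_valuation (rho : valuation) : Prop :=
  forall p xs w, rho p xs = Some w -> size xs = (fv_type p).1 /\ vsort w = (fv_type p).2.

Fixpoint uden (rho : valuation) (eta : nat -> option A) t : option V :=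
  match t with
  | Tt => Some (inr true)
  | Ff => Some (inr false)
  | Var v => omap inl (eta v)
  | App (OpVar p) ts => uapply (rho p) (map (uden rho eta) ts)
  | App (OpSym f) ts => uapply (ucall (interp A f)) (map (uden rho eta) ts)
  | App OpCond ts => ucond (map (uden rho eta) ts)
  end.

Lemma ucall_some k (f : pfun A k) xs w : ucall f xs = Some w ->
  size xs = k.1 /\ vsort w = k.2.
Proof.
rewrite /ucall; case: insubP => //= x /eqP -> _.
by case: (f x) => //= d [<-]; rewrite vsort_vinj.
Qed.

Lemma uden_typed rho eta t s w : typed_valuation rho ->
  tsort t = Some s -> uden rho eta t = Some w -> vsort w = s.
Proof.
move=> tr; elim/term_ind_mem: t s w => [||v|c ts IH] s w.
- by move=> [<-] [<-].
- by move=> [<-] [<-].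
- by move=> [<-] /=; case: (eta v) => //= a [<-].
case: c => [p|f|] /=.
- case: ifP => // _ [<-]; rewrite /uapply.
  by case: (strict_seq _) => //= xs /tr[].
- case: ifP => // _ [<-]; rewrite /uapply.
  by case: (strict_seq _) => //= xs /ucall_some[].
- case: ts IH => [//|t0 [|t1 [|t2 [|t3 ts]]]] IH /=;
    try by case: (tsort t0) => // -[].
  case: (tsort t0) => // -[] //; case: eqP => // e12 e1.
  case: (uden rho eta t0) => [[|b]|] //; case: b => h.
  + by apply: IH h => //; rewrite !inE eqxx !orbT.
  + by apply: IH h; rewrite -?e12// !inE eqxx !orbT.
Qed.

Lemma eq_in_uden rho1 rho2 eta1 eta2 t :
  {in fvars t, forall p xs, rho1 p xs = rho2 p xs} -> {in ivars t, eta1 =1 eta2} ->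
  uden rho1 eta1 t = uden rho2 eta2 t.
Proof.
elim/term_ind_mem: t => [||v|c ts IH] hr he //=.
  by rewrite he// mem_head.
have -> : map (uden rho1 eta1) ts = map (uden rho2 eta2) ts.
  apply/eq_in_map => t tts; apply: IH => // x hx; [apply: hr|apply: he] => /=.
    by rewrite mem_cat; apply/orP; right; apply/flatten_mapP; exists t.
  by apply/flatten_mapP; exists t.
case: c hr {IH he} => [p|f|] hr //.
rewrite /uapply; congr obind; apply/funext => xs; apply: hr.
by rewrite mem_head.
Qed.

Lemma uden_rename rho eta sg th t :
  uden rho eta (rename sg th t) = uden (fun p => rho (sg p)) (fun x => eta (th x)) t.
Proof.
elim/term_ind_mem: t => [||v|c ts IH] //=.
rewrite -map_comp.
have /eq_in_map -> : {in ts, uden rho eta \o rename sg th =1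
  uden (fun p => rho (sg p)) (fun x => eta (th x))} by [].
by case: c {IH}.
Qed.

Lemma resortE s s' (d : dom A s) : @resort A s s' d = vproj s' (vinj d).
Proof. by case: s s' d => -[]. Qed.

Section Valuation.
Variables (K : nat) (ps : 'I_K -> fvar) (q : forall i, pfun A (fv_type (ps i))).

Definition valuation_of : valuation := fun p xs =>
  if [pick i | ps i == p] is Some i then ucall (@q i) xs else None.

Lemma valuation_of_typed : typed_valuation valuation_of.
Proof.
move=> p xs w; rewrite /valuation_of; case: pickP => // i /eqP <-.
exact: ucall_some.
Qed.

Lemma valuation_ofE i : injective ps -> valuation_of (ps i) = ucall (@q i).
Proof.
move=> psI; apply/funext => xs; rewrite /valuation_of.
by case: pickP => [j /eqP/psI ->//|/(_ i)]; rewrite eqxx.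
Qed.

Definition at_args (vs : seq nat) (xs : seq A) (v : nat) : option A :=
  onth xs (index v vs).

Lemma apply_uapply k (f : pfun A k) (ws : seq (option V)) s :
  apply f (map as_ind ws) s = obind (vproj s) (uapply (ucall f) ws).
Proof.
rewrite /apply /uapply; case: (strict_seq _) => //= xs.
rewrite /ucall; case: (insub xs) => //= x.
by case: (f x) => //= d; rewrite resortE.
Qed.

Lemma as_indE w : as_ind w = obind (vproj ind) w.
Proof. by case: w => [[]|]. Qed.

Lemma den_uden vs xs t s :
  den q vs xs t s = obind (vproj s) (uden valuation_of (at_args vs xs) t).
Proof.
elim/term_ind_mem: t s => [||v|c ts IH] s.
- exact: (@resortE boole).
- exact: (@resortE boole).
- by rewrite /= /at_args; case: (onth _ _) => //= a; apply: (@resortE ind).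
have hts : map (fun u => den q vs xs u ind) ts =
    map as_ind (map (uden valuation_of (at_args vs xs)) ts).
  by rewrite -map_comp; apply/eq_in_map => u uts; rewrite IH//= as_indE.
case: c => [p|f|] /=.
- rewrite hts /valuation_of; case: pickP => [i _|_]; first exact: apply_uapply.
  by rewrite /uapply; case: (strict_seq _).
- by rewrite hts; apply: apply_uapply.
- case: ts IH {hts} => [//|t0 [|t1 [|t2 [|t3 ts]]]] IH //=.
  + by case: (uden _ _ t0) => [[]|].
  + by case: (uden _ _ t0) => [[]|].
  + rewrite !IH ?inE ?eqxx ?orbT//.
    by case: (uden _ _ t0) => [[a|[]]|].
  + by case: (uden _ _ t0) => [[]|].
Qed.

End Valuation.

(** An equation between typed partial functions may be proved after erasure; by [ucall_cast],
    erasure removes the casts of [recursor_eq]. *)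
Lemma ucall_inj k : injective (@ucall k).
Proof.
move=> f g h; apply/funext => x; have /(congr1 (@^~ (val x))) := h.
rewrite /ucall valK /=; case: (f x) (g x) => [d|] [d'|] //= [].
by move=> /(congr1 (vproj k.2)); rewrite !vinjK => -[->].
Qed.

Lemma ucall_cast k k' (e : k = k') (f : pfun A k) : ucall (cast e f) = ucall f.
Proof. by case: _ / e. Qed.

Definition pfun_of k (f : seq A -> option V) : pfun A k :=
  fun x => obind (vproj k.2) (f x).

Lemma ucall_pfun_of k f :
  (forall xs w, f xs = Some w -> size xs = k.1 /\ vsort w = k.2) ->
  ucall (@pfun_of k f) = f.
Proof.
move=> h; apply/funext => xs; rewrite /ucall /pfun_of.
case: insubP => [x _ <-|] /=.
  by case e : (f (val x)) => [w|] //=; have [_ /vprojK] := h _ _ e.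
by case e : (f xs) => [w|] //=; have [-> _] := h _ _ e; rewrite eqxx.
Qed.

(** * Equality of recursors *)

Definition same_part (sg : fvar -> fvar) (xs : seq nat) t (ys : seq nat) u : Prop :=
  size xs = size ys /\
  forall (rho : valuation) a, typed_valuation rho -> size a = size xs ->
    uden (fun p => rho (sg p)) (at_args xs a) t = uden rho (at_args ys a) u.

(** Equality of recursors without casts: the permutation of indices becomes a renaming [sg] of
    function variables, and families of typed functions become typed valuations. *)
Definition equivalent (E F : extprogram Phi) : Prop :=
  tsort (Defs.head E) = tsort (Defs.head F) /\
  exists sg : fvar -> fvar,
  [/\ forall p, fv_type (sg p) = fv_type p,
      perm_eq (bound_fvars F) (map sg (bound_fvars E)),
      same_part sg (xvars E) (Defs.head E) (xvars F) (Defs.head F) &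
      forall e f, e \in body E -> f \in body F -> lhs f = sg (lhs e) ->
        same_part sg (params e) (rhs e) (params f) (rhs f)].

Lemma uniq_bound (E : program Phi) : uniq (bound_fvars E).
Proof. by have /and4P[] := programP E. Qed.

Lemma head_fvars (E : program Phi) :
  all (mem (bound_fvars E)) (fvars (Defs.head E)).
Proof. by have /and4P[] := programP E. Qed.

Lemma tsort_head (E : program Phi) : tsort (Defs.head E) = Some (psort E).
Proof. by have /and4P[_ + _ _] := programP E; rewrite /psort; case: (tsort _). Qed.

Lemma wf_body (E : program Phi) e : e \in body E ->
  [/\ size (params e) = (fv_type (lhs e)).1, uniq (params e),
      all (mem (params e)) (ivars (rhs e)),
      all (mem (bound_fvars E)) (fvars (rhs e)) &
      tsort (rhs e) = Some (fv_type (lhs e)).2].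
Proof.
have /and4P[_ _ _ /allP h] := programP E.
by move=> /h /and5P[/eqP ? ? ? ? /eqP].
Qed.

Lemma uniq_map_inj (T T' : eqType) (f : T -> T') (s : seq T) :
  uniq (map f s) -> {in s &, injective f}.
Proof.
move=> u x y xs ys e; suff h : index x s = index y s.
  by rewrite -(nth_index x xs) h nth_index.
apply/eqP; rewrite -(nth_uniq (f x) _ _ u) ?size_map ?index_mem//.
by rewrite !(nth_map x) ?index_mem// !nth_index// e.
Qed.

Lemma index_lift_map (ps qs : seq fvar) i d : uniq ps -> i < size ps -> size qs = size ps ->
  lift_map ps qs (nth d ps i) = nth d qs i.
Proof.
move=> u ip e; rewrite /lift_map index_uniq//; apply: set_nth_default.
by rewrite e.
Qed.

Lemma lift_map_type (ps qs : seq fvar) : map fv_type ps = map fv_type qs ->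
  forall p, fv_type (lift_map ps qs p) = fv_type p.
Proof.
move=> e p; have es : size ps = size qs by have := congr1 size e; rewrite !size_map.
rewrite /lift_map; have [pps|pps] := boolP (p \in ps); last first.
  by rewrite nth_default// -es leqNgt index_mem.
by rewrite -(nth_map _ (fv_type p)) -?es ?index_mem// -e (nth_map p) ?index_mem// nth_index.
Qed.

Lemma lift_mapK (sg : fvar -> fvar) (ps : seq fvar) : uniq (map sg ps) ->
  {in ps, forall p, lift_map (map sg ps) ps (sg p) = p}.
Proof.
move=> u p pps; rewrite /lift_map (index_map_in (uniq_map_inj u))//.
by rewrite nth_index.
Qed.

Lemma typed_valuation_comp rho (sg : fvar -> fvar) : typed_valuation rho ->
  (forall p, fv_type (sg p) = fv_type p) -> typed_valuation (fun p => rho (sg p)).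
Proof. by move=> tr tsg p xs w /tr; rewrite tsg. Qed.

Lemma same_part_inverse (ps qs : seq fvar) sg sg' xs t ys u :
  (forall p, fv_type (sg' p) = fv_type p) -> {in ps, cancel sg sg'} ->
  all (mem ps) (fvars t) -> same_part sg xs t ys u -> same_part sg' ys u xs t.
Proof.
move=> tsg' K /allP ht [es h]; split=> // rho a tr ea.
rewrite -(h (fun p => rho (sg' p)) a) ?es//; last exact: typed_valuation_comp.
by apply: eq_in_uden => // p /ht/= pps ?; rewrite K.
Qed.

Lemma equivalent_sym E F : equivalent E F -> equivalent F E.
Proof.
move=> [es [sg [sgt sgp hh hb]]]; split=> //.
have u : uniq (map sg (bound_fvars E)) by rewrite -(perm_uniq sgp) uniq_bound.
pose sg' := lift_map (map sg (bound_fvars E)) (bound_fvars E).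
have sgK : {in bound_fvars E, cancel sg sg'} := lift_mapK u.
have tsg' : forall p, fv_type (sg' p) = fv_type p.
  by apply: lift_map_type; rewrite -map_comp; apply: eq_map.
exists sg'; split=> //.
- rewrite perm_sym (perm_trans (perm_map _ sgp))// -map_comp.
  by rewrite map_id_in.
- exact: (same_part_inverse (bound_fvars E)) (head_fvars E) hh.
- move=> f e fF eE ef; have [_ _ _ he _] := wf_body eE.
  apply: (same_part_inverse (bound_fvars E) tsg' sgK he); apply: hb => //.
  have : lhs f \in bound_fvars F by apply: map_f.
  by rewrite (perm_mem sgp) ef => /mapP[p pE ->]; rewrite sgK.
Qed.

Lemma same_part_trans sg1 sg2 xs t ys u zs v :
  (forall p, fv_type (sg2 p) = fv_type p) -> same_part sg1 xs t ys u ->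
  same_part sg2 ys u zs v -> same_part (sg2 \o sg1) xs t zs v.
Proof.
move=> tsg [e1 h1] [e2 h2]; split; first by rewrite e1.
move=> rho a tr ea; rewrite -h2// -?e1//.
by rewrite -(h1 (fun p => rho (sg2 p)))//; apply: typed_valuation_comp.
Qed.

Lemma equivalent_trans E F G : equivalent E F -> equivalent F G -> equivalent E G.
Proof.
move=> [es1 [sg1 [t1 p1 h1 b1]]] [es2 [sg2 [t2 p2 h2 b2]]]; split; first by rewrite es1.
exists (sg2 \o sg1); split.
- by move=> p /=; rewrite t2.
- by rewrite (perm_trans p2)// map_comp perm_map.
- exact: same_part_trans h1 h2.
- move=> e g eE gG eg.
  have : sg1 (lhs e) \in bound_fvars F by rewrite (perm_mem p1) map_f//; apply: map_f.
  move=> /mapP[f fF ef].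
  apply: same_part_trans t2 (b1 _ _ eE fF (esym ef)) (b2 _ _ fF gG _).
  by rewrite eg /= ef.
Qed.

Lemma congruent_equivalent E F : congruent_ext E F -> equivalent E F.
Proof.
move=> [ex [sg [tau [sgt sgI tauI hd hb]]]].
(* A congruence preserves types on the bound variables only, whereas [equivalent] asks for it
   everywhere. *)
pose sg' p := if p \in bound_fvars E then sg p else p.
have sgE : {in bound_fvars E, sg' =1 sg} by move=> p; rewrite /sg' => ->.
have tsg' : forall p, fv_type (sg' p) = fv_type p.
  by move=> p; rewrite /sg'; case: ifP => // /sgt.
split.
  by rewrite hd tsort_rename// => p /(allP (head_fvars E))/= /sgt.
have part xs t th : all (mem (bound_fvars E)) (fvars t) -> all (mem xs) (ivars t) ->
    {in xs &, injective th} -> same_part sg' xs t (map th xs) (rename sg th t).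
  move=> /allP ht /allP vt thI; split; first by rewrite size_map.
  move=> rho a _ ea; rewrite uden_rename; apply: eq_in_uden => [p /ht pE ?|x /vt/= xxs].
    by rewrite sgE.
  by rewrite /at_args (index_map_in thI).
exists sg'; split=> //.
- have -> : map sg' (bound_fvars E) = map (@lhs Phi \o rename_equation sg tau) (body E).
    by rewrite /bound_fvars -map_comp; apply/eq_in_map => e eE /=; rewrite sgE// map_f.
  by have := perm_map (@lhs Phi) hb; rewrite -map_comp.
- rewrite ex hd -{2}(map_id (xvars E)); apply: part => //; first exact: head_fvars.
  by have /andP[] := extprogramP E.
- move=> e f eE fF ef.
  have := fF; rewrite (perm_mem hb) => /mapP[e' e'E fe'].
  have ee' : e = e'.
    have : lhs f = sg (lhs e') by rewrite fe'.
    rewrite ef sgE ?map_f// => /sgI h.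
    by apply: (uniq_map_inj (uniq_bound E)) => //; apply: h; apply: map_f.
  rewrite fe' -ee'; have [_ _ h1 h2 _] := wf_body eE.
  by apply: part => //; apply: tauI.
Qed.
Lemma ucall_den K (ps : 'I_K -> fvar) (q : forall i, pfun A (fv_type (ps i))) k vs t :
  tsort t = Some k.2 ->
  @ucall k (fun x => den q vs x t k.2) =
  fun a => if size a == k.1 then uden (valuation_of q) (at_args vs a) t else None.
Proof.
move=> st; apply/funext => a; rewrite /ucall.
case: insubP => [x -> <-|/negPf -> //] /=; rewrite den_uden.
case e : (uden _ _ _) => [w|] //=.
by apply: vprojK; apply: uden_typed st e; apply: valuation_of_typed.
Qed.

Definition lhs_nth (E : program Phi) (i : 'I_(size (body E))) : fvar :=
  lhs (tnth (in_tuple (body E)) i).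

Definition eqn_nth (E : program Phi) (i : 'I_(size (body E))) : equation Phi :=
  tnth (in_tuple (body E)) i.

Lemma mem_eqn_nth E i : @eqn_nth E i \in body E.
Proof. exact: mem_tnth. Qed.

Lemma lhs_nthE E i d : @lhs_nth E i = nth d (bound_fvars E) i.
Proof.
by rewrite /bound_fvars (nth_map (eqn_nth i)) ?ltn_ord// /lhs_nth (tnth_nth (eqn_nth i)).
Qed.

Lemma lhs_nth_inj E : injective (@lhs_nth E).
Proof.
move=> i j; rewrite (lhs_nthE i (lhs_nth i)) (lhs_nthE j (lhs_nth i)) => /eqP.
by rewrite nth_uniq ?size_map ?uniq_bound// => /eqP/val_inj.
Qed.

Lemma mem_lhs_nth E i : @lhs_nth E i \in bound_fvars E.
Proof. exact/map_f/mem_eqn_nth. Qed.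

Lemma eqn_nth_surj (E : program Phi) e : e \in body E -> exists i, e = @eqn_nth E i.
Proof.
move=> eE; have ie : index e (body E) < size (body E) by rewrite index_mem.
by exists (Ordinal ie); rewrite /eqn_nth (tnth_nth e) nth_index.
Qed.

Lemma lhs_nth_surj (E : program Phi) p : p \in bound_fvars E -> exists i, p = @lhs_nth E i.
Proof. by move=> /mapP[e /eqn_nth_surj[i ->] ->]; exists i. Qed.

Section RecursorEq.
Variables (E F : extprogram Phi) (sg : fvar -> fvar).
Variable pi : 'I_(size (body F)) -> 'I_(size (body E)).
Variable rh : 'I_(size (body E)) -> 'I_(size (body F)).
Hypothesis sgE : forall j, sg (@lhs_nth E j) = @lhs_nth F (rh j).
Hypothesis rhK : cancel rh pi.
Variable ety : forall i, fv_type (@lhs_nth F i) = fv_type (@lhs_nth E (pi i)).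
Variable q : forall i, pfun A (fv_type (@lhs_nth F i)).

(** This is [q_rho] in [recursor_eq], with the recursor of [E] as [alpha] and that of [F] as
    [beta]. *)
Definition transported j : pfun A (fv_type (@lhs_nth E j)) :=
  cast (etrans (ety (rh j)) (congr1 (fun j => fv_type (@lhs_nth E j)) (rhK j))) (@q (rh j)).

Lemma valuation_of_transported p : p \in bound_fvars E ->
  valuation_of transported p = valuation_of q (sg p).
Proof.
move=> /lhs_nth_surj[j ->]; rewrite sgE !valuation_ofE; try exact: lhs_nth_inj.
by rewrite /transported ucall_cast.
Qed.

Lemma uden_transported eta t : all (mem (bound_fvars E)) (fvars t) ->
  uden (valuation_of transported) eta t = uden (fun p => valuation_of q (sg p)) eta t.
Proof.
move=> /allP ht; apply: eq_in_uden => // p /ht pE xs.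
by rewrite valuation_of_transported.
Qed.
End RecursorEq.

Lemma recursor_eqP E F :
  recursor_eq (recursor_of A E) (recursor_of A F) <-> equivalent E F.
Proof.
split.
- move=> [/= er [pi [rh [piK [rhK [e0 [e H]]]]]]].
  case: (e0) => exv eps.
  have szE : size (bound_fvars E) = size (body E) by rewrite size_map.
  pose ss := [seq @lhs_nth F (rh j) | j <- enum 'I_(size (body E))].
  pose sg := lift_map (bound_fvars E) ss.
  have bE : bound_fvars E = [seq @lhs_nth E j | j <- enum 'I_(size (body E))].
    transitivity (map (@lhs Phi)
      [seq tnth (in_tuple (body E)) i | i <- enum 'I_(size (body E))]).
      by rewrite map_tnth_enum.
    by rewrite -map_comp.
  have sgE j : sg (@lhs_nth E j) = @lhs_nth F (rh j).
    rewrite (lhs_nthE j (lhs_nth (rh j))) /sg index_lift_map ?uniq_bound ?szE//.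
      by rewrite (nth_map j) ?size_enum_ord// nth_ord_enum.
    by rewrite size_map size_enum_ord.
  have tsg : forall p, fv_type (sg p) = fv_type p.
    apply: lift_map_type; rewrite bE -!map_comp; apply: eq_map => j /=.
    by rewrite (e (rh j)) rhK.
  (* On the bound variables of [F], every typed valuation comes from a family of partial functions,
     so the equations for all [q] give those for all valuations. *)
  have Hq rho : typed_valuation rho -> exists2 q : forall i, pfun A (fv_type (@lhs_nth F i)),
      forall p xs, p \in bound_fvars F -> valuation_of q p xs = rho p xs & True.
    move=> tr; exists (fun i => pfun_of (rho (@lhs_nth F i))) => // p xs.
    move=> /lhs_nth_surj[i ->]; rewrite valuation_ofE; last exact: lhs_nth_inj.
    by rewrite ucall_pfun_of// => ys w; apply: tr.
  split; first by rewrite !tsort_head eps.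
  exists sg; split => //.
  + apply: uniq_perm; rewrite ?uniq_bound//.
      rewrite bE -map_comp map_inj_uniq ?enum_uniq// => i j /=.
      by rewrite !sgE => /lhs_nth_inj/(can_inj rhK).
    move=> p; apply/idP/mapP => [/lhs_nth_surj[i ->]|[p' /lhs_nth_surj[j ->] ->]].
      by exists (@lhs_nth E (pi i)); rewrite ?mem_lhs_nth// sgE piK.
    by rewrite sgE mem_lhs_nth.
  + split=> // rho a tr ea; have [q hq _] := Hq _ tr; have [h _] := H q.
    have {}h : ucall (rhead (recursor_of A F) q) a =
        ucall (rhead (recursor_of A E) (transported rhK e q)) a.
      by rewrite -(ucall_cast e0); congr (ucall _ a); apply/funext.
    move: h; rewrite /= !ucall_den ?tsort_head//= ea -exv eqxx.
    rewrite (uden_transported sgE) ?head_fvars// => h.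
    have <- : uden (valuation_of q) (at_args (xvars F) a) (Defs.head F) =
        uden rho (at_args (xvars F) a) (Defs.head F).
      by apply: eq_in_uden => // p /(allP (head_fvars F)) pF xs; apply: hq.
    rewrite h; apply: eq_in_uden => // p /(allP (head_fvars E)) pE xs.
    by rewrite hq//; have [j ->] := lhs_nth_surj pE; rewrite sgE mem_lhs_nth.
  + move=> _ _ /eqn_nth_surj[j ->] /eqn_nth_surj[i ->] ij.
    have {ij}ij : j = pi i.
      by apply: (can_inj rhK); rewrite piK; apply: lhs_nth_inj; rewrite -sgE.
    rewrite {j}ij.
    have [sF _ _ vF tF] := wf_body (mem_eqn_nth i).
    have [sE _ _ vE tE] := wf_body (mem_eqn_nth (pi i)).
    have ss' : size (params (eqn_nth (pi i))) = size (params (eqn_nth i)).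
      by rewrite sF sE; exact: (congr1 fst (esym (e i))).
    split=> // rho a tr ea; have [q hq _] := Hq _ tr; have [_ h] := H q.
    have {}h : ucall (rbody (recursor_of A F) i q) a =
        ucall (rbody (recursor_of A E) (pi i) (transported rhK e q)) a.
      by rewrite -(ucall_cast (e i)); congr (ucall _ a); apply/funext => x; apply: h.
    move: h; rewrite /= (ucall_den _ _ tF) (ucall_den _ _ tE) -sF -sE -ss' ea eqxx.
    rewrite (uden_transported sgE)// => h.
    have <- : uden (valuation_of q) (at_args (params (eqn_nth i)) a) (rhs (eqn_nth i)) =
        uden rho (at_args (params (eqn_nth i)) a) (rhs (eqn_nth i)).
      by apply: eq_in_uden => // p /(allP vF) pF xs; apply: hq.
    rewrite h; apply: eq_in_uden => // p /(allP vE) pE xs.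
    by rewrite hq//; have [j ->] := lhs_nth_surj pE; rewrite sgE mem_lhs_nth.
- move=> [es [sg [tsg psg hh hb]]].
  have er : size (body F) = size (body E).
    by have := perm_size psg; rewrite !size_map.
  have usg : uniq (map sg (bound_fvars E)) by rewrite -(perm_uniq psg) uniq_bound.
  have rhP j : exists i, sg (@lhs_nth E j) = @lhs_nth F i.
    by apply: lhs_nth_surj; rewrite (perm_mem psg) map_f// mem_lhs_nth.
  have piP i : exists j, @lhs_nth F i = sg (@lhs_nth E j).
    have : lhs_nth i \in bound_fvars F := mem_lhs_nth i.
    by rewrite (perm_mem psg) => /mapP[p /lhs_nth_surj[j ->] ->]; exists j.
  (* The two index maps are read off from [sg]. They are mutually inverse because left-hand sides
     are distinct and [sg] is injective on those of [E]. *)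
  have [rh sgE] := choice rhP; have [pi piE] := choice piP.
  have piK : cancel pi rh by move=> i; apply: lhs_nth_inj; rewrite -sgE -piE.
  have rhK : cancel rh pi.
    move=> j; apply: lhs_nth_inj; apply: (uniq_map_inj usg); rewrite ?mem_lhs_nth//.
    by rewrite -piE sgE.
  have e i : fv_type (@lhs_nth F i) = fv_type (@lhs_nth E (pi i)) by rewrite piE tsg.
  have [exv Hh] := hh.
  have e0 : (size (xvars F), psort F) = (size (xvars E), psort E).
    by rewrite exv; congr (_, _); move: es; rewrite !tsort_head => -[].
  exists er, pi, rh, piK, rhK, e0, e => q.
  split.
  + move=> x; suff -> : cast e0 (rhead (recursor_of A F) q) =
      rhead (recursor_of A E) (transported rhK e q) by [].
    apply: ucall_inj; rewrite ucall_cast /= !ucall_den ?tsort_head//=.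
    apply/funext => a; rewrite exv; case: eqP => // ea.
    rewrite (uden_transported sgE) ?head_fvars// -Hh//; last by rewrite exv.
    exact: valuation_of_typed.
  + move=> i x; suff -> : cast (e i) (rbody (recursor_of A F) i q) =
      rbody (recursor_of A E) (pi i) (transported rhK e q) by [].
    have [sF _ _ vF tF] := wf_body (mem_eqn_nth i).
    have [sE _ _ vE tE] := wf_body (mem_eqn_nth (pi i)).
    apply: ucall_inj; rewrite ucall_cast /= (ucall_den _ _ tF) (ucall_den _ _ tE).
    have [ss' Hb] : same_part sg (params (eqn_nth (pi i))) (rhs (eqn_nth (pi i)))
        (params (eqn_nth i)) (rhs (eqn_nth i)).
      by apply: hb; rewrite ?mem_eqn_nth//; apply: piE.
    apply/funext => a; rewrite -sF -sE ss'; case: eqP => // ea.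
    rewrite (uden_transported sgE)// -Hb//; last by rewrite ss'.
    exact: valuation_of_typed.
Qed.
End Semantics.

(** * Reduction and flattening *)

Section Reduction.
Local Arguments positions : simpl never.
Variable Phi : signature.
Implicit Types (t u : term Phi) (ts : seq (term Phi)) (c : op Phi).
Implicit Types (E F G : extprogram Phi) (nu mu : seq nat -> fvar).

Fixpoint top_args nu (l : seq nat) (xs : seq nat) (j : nat) ts : seq (term Phi) :=
  if ts is t :: ts' then
    (if immediate t then t else fapp Phi (nu (rcons l j)) xs)
      :: top_args nu l xs j.+1 ts'
  else [::].

Definition top nu (l : seq nat) (xs : seq nat) t : term Phi :=
  if t is App c ts then App c (top_args nu l xs 0 ts) else t.

Definition flat_eqn nu (xs : seq nat) (x : seq nat * term Phi) : equation Phi :=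
  (nu x.1, xs, top nu x.1 xs x.2).

Definition part_eqns nu (xs : seq nat) t : seq (equation Phi) :=
  [seq flat_eqn nu xs x | x <- ([::], t) :: positions t].

Local Arguments part_eqns : simpl never.

(* [G] is a canonical form of [E] reached without congruences: [nu (Some p) l] is
   the function variable of its equation for the subterm at path [l] of the
   equation of [E] for [p], and [nu None] does the same for the head. *)
Definition flattening E G (nu : option fvar -> seq nat -> fvar) : Prop :=
  [/\ xvars G = xvars E,
      Defs.head G = top (nu None) [::] (xvars E) (Defs.head E),
      {in bound_fvars E, forall p, nu (Some p) [::] = p} &
      perm_eq (body G)
        ([seq flat_eqn (nu None) (xvars E) x | x <- positions (Defs.head E)] ++
         flatten [seq part_eqns (nu (Some (lhs e))) (params e) (rhs e) | e <- body E])].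

Lemma top_args_ext nu mu l m xs j ts :
  (forall k, nu (l ++ k) = mu (m ++ k)) -> top_args nu l xs j ts = top_args mu m xs j ts.
Proof.
move=> h; elim: ts j => //= t ts IH j.
by rewrite IH -!cats1 h.
Qed.

Lemma flat_eqn_ext nu mu l m xs t : (forall k, nu (l ++ k) = mu (m ++ k)) ->
  flat_eqn nu xs (l, t) = flat_eqn mu xs (m, t).
Proof.
move=> h; rewrite /flat_eqn /=; congr (_, _, _).
  by have := h [::]; rewrite !cats0.
by case: t => //= c ts; rewrite (top_args_ext _ _ _ h).
Qed.

Lemma positions_from_cat j ts1 ts2 :
  positions_from j (ts1 ++ ts2) = positions_from j ts1 ++ positions_from (j + size ts1) ts2.
Proof.
elim: ts1 j => [|t ts1 IH] j /=; first by rewrite addn0.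
by rewrite IH -catA addSnnS.
Qed.

Lemma positions_from_path j ts x : x \in positions_from j ts ->
  exists i l, [/\ x.1 = i :: l, j <= i & i < j + size ts].
Proof.
elim: ts j => //= t ts IH j; rewrite mem_cat => /orP[|/IH[i [l [-> h1 h2]]]]; last first.
  by exists i, l; split => //; [apply: ltnW|rewrite addnS -addSn].
rewrite /position1; case: ifP => // _; rewrite inE => /predU1P[->|/mapP[y _ ->]] /=.
  by exists j, [::]; rewrite addnS ltnS leq_addr.
by exists j, y.1; rewrite addnS ltnS leq_addr.
Qed.

(** This undoes a reduction step on names. The step turned argument [j] into an equation of its own,
    whose subterms are named by [mu]; in the unreduced term they lie below [j]. *)
Definition splice nu (j : nat) mu (l : seq nat) : fvar :=
  if l is i :: l' then if i == j then mu l' else nu l else nu l.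

Lemma immediate_fapp q xs : immediate (fapp Phi q xs).
Proof. by rewrite /= all_map; apply/allP. Qed.

Lemma top_args_cat nu l xs i us1 us2 : top_args nu l xs i (us1 ++ us2) =
  top_args nu l xs i us1 ++ top_args nu l xs (i + size us1) us2.
Proof.
elim: us1 i => [|u us1 IH] i /=; first by rewrite addn0.
by rewrite IH addSnnS.
Qed.

Lemma top_args_splice nu j mu xs i us : (forall k, i <= k < i + size us -> k != j) ->
  top_args (splice nu j mu) [::] xs i us = top_args nu [::] xs i us.
Proof.
elim: us i => //= u us IH i hi; rewrite IH => [|k /andP[h1 h2]].
  by rewrite (negPf (hi i _))// leqnn addnS ltnS leq_addr.
by apply: hi; rewrite (ltnW h1) addnS -addSn.
Qed.

Lemma split_top c ts1 ts2 u xs nu mu : ~~ immediate u ->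
  top (splice nu (size ts1) mu) [::] xs (App c (ts1 ++ u :: ts2)) =
  top nu [::] xs (App c (ts1 ++ fapp Phi (mu [::]) xs :: ts2)).
Proof.
move=> /negPf nu_; rewrite /top !top_args_cat /top_args -!/(top_args _ _ _ _ _).
rewrite nu_ immediate_fapp /= eqxx !top_args_splice//.
- by move=> k /andP[h _]; rewrite gtn_eqF.
- by move=> k /andP[_ h]; rewrite ltn_eqF.
Qed.

(** The argument [u] and the positions below it yield exactly the equations of the split-off part,
    while its replacement is immediate and yields none. They stand in the middle of the first list,
    hence only a permutation. *)
Lemma split_positions c ts1 ts2 u xs nu mu : ~~ immediate u ->
  perm_eq
    [seq flat_eqn (splice nu (size ts1) mu) xs x | x <- positions (App c (ts1 ++ u :: ts2))]
    ([seq flat_eqn nu xs x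
     | x <- positions (App c (ts1 ++ fapp Phi (mu [::]) xs :: ts2))] ++ part_eqns mu xs u).
Proof.
move=> /negPf nu_; set j := size ts1.
rewrite !positions_App !positions_from_cat /positions_from -!/(positions_from _ _).
rewrite /position1 nu_ immediate_fapp !map_cat.
have same i us : (forall k, i <= k < i + size us -> k != j) ->
    [seq flat_eqn (splice nu j mu) xs x | x <- positions_from i us] =
    [seq flat_eqn nu xs x | x <- positions_from i us].
  move=> h; apply/eq_in_map => -[l s] /positions_from_path[k [m [/= -> h1 h2]]].
  by apply: flat_eqn_ext => m'; rewrite /= (negPf (h _ _))// h1.
rewrite !same; first last.
- by move=> k /andP[_ h]; rewrite ltn_eqF.
- by move=> k /andP[h _]; rewrite gtn_eqF.
rewrite -catA perm_cat2l perm_catC perm_cat2l.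
rewrite /part_eqns !map_cons -map_comp add0n.
rewrite (@flat_eqn_ext (splice nu j mu) mu [:: j] [::]) => [|k /=]; last by rewrite eqxx.
rewrite perm_cons; apply/permP => P; congr count.
by apply: eq_map => -[l s]; apply: flat_eqn_ext => k /=; rewrite eqxx.
Qed.

Lemma set_nth_cat (T : Type) (x0 : T) s j y : j < size s ->
  set_nth x0 s j y = take j s ++ y :: drop j.+1 s.
Proof.
elim: s j => [|x s IH] [|j] //=; first by rewrite drop0.
by move=> /IH ->.
Qed.

Lemma split_nth (T : Type) (x0 : T) s j : j < size s ->
  s = take j s ++ nth x0 s j :: drop j.+1 s.
Proof. by move=> js; rewrite -(drop_nth x0)// cat_take_drop. Qed.

Lemma perm_flatten_map (T T' : eqType) (f : T -> seq T') s1 s2 :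
  perm_eq s1 s2 -> perm_eq (flatten (map f s1)) (flatten (map f s2)).
Proof. by move=> h; apply/perm_flatten/perm_map. Qed.

(** The flattening of the reduct is pulled back by splicing the names for the new equation [q] into
    those for the reduced part. Iterated from the irreducible end, this shows that the order of
    reductions affects only names and the order of equations. *)
Lemma flattening_red1 E F G (nu : option fvar -> seq nat -> fvar) : red1 E F -> flattening F G nu ->
  exists nu' : option fvar -> seq nat -> fvar, flattening E G nu'.
Proof.
case=> [p xs c Gs j q|c Gs j q].
- move=> ex pE jG nG qE _ _ hF pF [gx gh gp gb].
  pose nu' o := if o == Some p then splice (nu o) j (nu (Some q)) else nu o.
  have memF : bound_fvars F =i q :: bound_fvars E.
    move=> r; rewrite (perm_mem (perm_map (@lhs Phi) pF)) /= !inE.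
    rewrite (perm_mem (perm_map (@lhs Phi) (perm_to_rem pE))) /= inE.
    by rewrite orbCA.
  have nuq : nu (Some q) [::] = q by rewrite gp// memF mem_head.
  exists nu'; split => //.
  + by rewrite gx.
  + by rewrite gh hF ex.
  + move=> r rE; rewrite /nu'; have nur : nu (Some r) [::] = r.
      by rewrite gp// memF in_cons rE orbT.
    by case: ifP.
  rewrite (perm_trans gb)// hF ex perm_cat2l.
  rewrite (perm_trans (perm_flatten_map _ pF))//.
  rewrite perm_sym; apply: perm_trans (perm_flatten_map _ (perm_to_rem pE)) _ => /=.
  rewrite /lhs /params /rhs /=.
  (* [nu'] differs from [nu] only at [p], and no other equation has the left-hand side [p]. *)
  have -> : [seq part_eqns (nu' (Some e.1.1)) e.1.2 e.2 | e <- rem (p, xs, App c Gs) (body E)]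
     = [seq part_eqns (nu (Some e.1.1)) e.1.2 e.2 | e <- rem (p, xs, App c Gs) (body E)].
    apply/eq_in_map => e eR; rewrite /nu'; case: eqP => // -[ep].
    have := uniq_bound E; rewrite (perm_uniq (perm_map (@lhs Phi) (perm_to_rem pE))) /=.
    by have := map_f (@lhs Phi) eR; rewrite {1}/lhs ep => ->.
  rewrite {1}/nu' eqxx -!cat_cons catA perm_cat2r.
  have sz : j = size (take j Gs) by rewrite size_take jG.
  have := split_positions c (take j Gs) (drop j.+1 Gs) xs (nu (Some p)) (nu (Some q)) nG.
  have := split_top c (take j Gs) (drop j.+1 Gs) xs (nu (Some p)) (nu (Some q)) nG.
  rewrite -sz -split_nth// nuq -(set_nth_cat Tt)// => htop hpos.
  have -> : nu' (Some p) = splice (nu (Some p)) j (nu (Some q)) by rewrite /nu' eqxx.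
  rewrite cat_cons [flat_eqn _ _ ([::], App c Gs)](_ : _ =
    flat_eqn (nu (Some p)) xs ([::], App c (set_nth Tt Gs j (fapp Phi q xs)))).
    by rewrite perm_cons.
  by rewrite /flat_eqn [(_, _).2]/= htop.
- move=> ex hE jG nG qE _ _ hF pF [gx gh gp gb].
  pose nu' o := if o is None then splice (nu o) j (nu (Some q)) else nu o.
  have memF : bound_fvars F =i q :: bound_fvars E.
    by move=> r; rewrite (perm_mem (perm_map (@lhs Phi) pF)).
  have nuq : nu (Some q) [::] = q by rewrite gp// memF mem_head.
  have sz : j = size (take j Gs) by rewrite size_take jG.
  have := split_positions c (take j Gs) (drop j.+1 Gs) (xvars E) (nu None) (nu (Some q)) nG.
  have := split_top c (take j Gs) (drop j.+1 Gs) (xvars E) (nu None) (nu (Some q)) nG.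
  rewrite -sz -split_nth// nuq -(set_nth_cat Tt)// => htop hpos.
  exists nu'; split => //.
  + by rewrite gx.
  + by rewrite gh hE hF ex -htop.
  + by move=> r rE; rewrite /nu' /= gp// memF in_cons rE orbT.
  rewrite (perm_trans gb)// hF ex hE.
  have := perm_flatten_map
    (fun e => part_eqns (nu (Some (lhs e))) (params e) (rhs e)) pF.
  rewrite -(perm_cat2l [seq flat_eqn (nu None) (xvars E) x
    | x <- positions (App c (set_nth Tt Gs j (fapp Phi q (xvars E))))]) => hfl.
  by apply: perm_trans hfl _; rewrite /= -cat_cons catA perm_cat2r perm_sym.
Qed.

Lemma irreducible_all_immediate c ts :
  irreducible_term (App c ts) = all (@immediate Phi) ts.
Proof.
rewrite /=; case: c => [p|f|] //; apply/orb_idl => h.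
by apply: sub_all h => -[].
Qed.

Lemma irreducible_positions t : irreducible_term t -> positions t = [::].
Proof.
case: t => // c ts; rewrite irreducible_all_immediate positions_App.
elim: ts 0 => //= u ts IH j /andP[h1 h2].
by rewrite /position1 h1 IH.
Qed.

Lemma irreducible_top nu l xs t : irreducible_term t -> top nu l xs t = t.
Proof.
case: t => // c ts; rewrite irreducible_all_immediate /= => h; congr App.
by elim: ts 0 h => //= u ts IH j /andP[-> h2]; rewrite IH.
Qed.

(** The function variable [(0, ind, 0)] given to [None] is arbitrary: an irreducible head has no
    positions, so nothing is named by it. *)
Lemma flattening_refl G : irreducible G ->
  flattening G G (fun o _ => odflt (0, ind, 0) o).
Proof.
move=> /andP[ih /allP ib]; split => //; first by rewrite irreducible_top.
rewrite irreducible_positions//=.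
suff -> : [seq part_eqns (fun _ => odflt (0, ind, 0) (Some (lhs e))) (params e) (rhs e)
    | e <- body G] = [seq [:: e] | e <- body G].
  by elim: (body G) => //= e es; rewrite perm_cons.
apply/eq_in_map => e eG; rewrite /part_eqns irreducible_positions ?ib//=.
by rewrite /flat_eqn irreducible_top ?ib//; case: e {eG} => -[].
Qed.

Lemma flattening_red E G : clos_refl_trans_1n _ (@red1 Phi) E G -> irreducible G ->
  exists nu : option fvar -> seq nat -> fvar, flattening E G nu.
Proof.
elim=> {E G} [G|E F G EF _ IH] iG; first by eexists; apply: flattening_refl.
by have [nu] := IH iG; apply: flattening_red1.
Qed.

(** A reduction to a canonical form may end with a congruence; the program just before it is
    irreducible too, and that is the one described by a flattening. *)
Lemma congruent_irreducible E F : congruent E F -> irreducible F -> irreducible E.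
Proof.
move=> [sg [tau [_ _ _ hh hb]]]; rewrite {1}/irreducible hh => /andP[ih /allP ib].
rewrite irreducible_rename in ih; apply/andP; split=> //; apply/allP => e eE.
rewrite -(irreducible_rename sg (tau (lhs e))).
by apply: (ib (rename_equation sg tau e)); rewrite (perm_mem hb) map_f.
Qed.

(** * Existence of canonical forms *)

Section ReplacedTerm.
Variables (c : op Phi) (ts1 ts2 : seq (term Phi)) (u : term Phi) (q : fvar).
Variables (xs : seq nat).
Let t := App c (ts1 ++ u :: ts2).
Let t' := App c (ts1 ++ fapp Phi q xs :: ts2).

Lemma tsort_replaced : tsort u = Some (fv_type q).2 -> (fv_type q).1 = size xs ->
  tsort t' = tsort t.
Proof.
move=> su sq; rewrite /= !map_cat /= su -map_comp sq.
have -> : map (@tsort Phi \o Var) xs = nseq (size xs) (Some ind).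
  by elim: xs => //= x xs' ->.
by rewrite eqxx.
Qed.

Lemma ivars_replaced : all (mem xs) (ivars t) -> all (mem xs) (ivars t').
Proof.
rewrite /= !flatten_subP !map_cat !all_cat /= => /and3P[-> _ ->].
by rewrite flatten_subP -map_comp all_map andbT; apply/allP => x /= ->.
Qed.

Lemma fvars_replaced (B : {pred fvar}) : q \in B ->
  all (mem B) (fvars t) -> all (mem B) (fvars t').
Proof.
move=> qB; rewrite /= !all_cat !flatten_subP !map_cat !all_cat /=.
move=> /and4P[-> -> _ ->]; rewrite /= -map_comp.
have -> : flatten (map (@fvars Phi \o Var) xs) = [::] by elim: xs.
by rewrite /= andbT; apply/andP.
Qed.

End ReplacedTerm.

Lemma fresh_fvar (ty : ftype) (ps : seq fvar) :
  exists2 q : fvar, q \notin ps & fv_type q = ty.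
Proof.
exists (ty, \max_(p <- ps) p.2.+1) => //; apply/negP => h.
by have := leq_bigmax_seq (P := xpredT) (F := fun p : fvar => p.2.+1) _ h isT; rewrite ltnn.
Qed.

Lemma reducible_term t : ~~ irreducible_term t ->
  exists c ts j, [/\ t = App c ts, j < size ts & ~~ immediate (nth Tt ts j)].
Proof.
case: t => // c ts; rewrite irreducible_all_immediate -has_predC => h.
exists c, ts, (find (predC (@immediate Phi)) ts).
by split; rewrite -?has_find//; apply: (nth_find Tt h).
Qed.

Lemma wf_equation_sub (ps qs : seq fvar) (e : equation Phi) : {subset ps <= qs} ->
  wf_equation ps e -> wf_equation qs e.
Proof.
move=> h /and5P[h1 h2 h3 /allP h4 h5]; apply/and5P; split => //.
by apply/allP => p /h4/h.
Qed.

(** The termination measure. A step makes one non-immediate proper subterm a whole right-hand side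
    and keeps the others, so the count drops by one. *)
Definition redexes (E : program Phi) : nat :=
  size (positions (Defs.head E)) + sumn [seq size (positions (rhs e)) | e <- body E].

Lemma size_positions_replaced c ts1 ts2 u q xs : ~~ immediate u ->
  size (positions (App c (ts1 ++ u :: ts2))) =
  (size (positions (App c (ts1 ++ fapp Phi q xs :: ts2))) + size (positions u)).+1.
Proof.
move=> nu_; have /perm_size := split_positions c ts1 ts2 xs (fun=> q) (fun=> q) nu_.
by rewrite size_cat !size_map /= addnS.
Qed.

Lemma red1_exists E : ~~ irreducible E ->
  exists2 F, red1 E F & redexes F < redexes E.
Proof.
rewrite /irreducible negb_and; case: (boolP (irreducible_term _)) => /= [_|+ _].
- rewrite -has_predC => /hasP[[[p xs] t] eE /= /reducible_term[c [Gs [j [tE jG nG]]]]].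
  have [] := wf_body eE; rewrite /params /lhs /rhs /= => sz ux vx vf ts.
  have [s sj] : exists s, tsort (nth Tt Gs j) = Some s.
    by move: ts; rewrite tE => /op_sort_args; apply; apply: mem_nth.
  have [q qE tq] := fresh_fvar ((fv_type p).1, s) (bound_fvars E).
  pose es := [:: (p, xs, App c (set_nth Tt Gs j (fapp Phi q xs))), (q, xs, nth Tt Gs j)
    & rem (p, xs, App c Gs) (body E)].
  rewrite tE in eE vx vf ts.
  have pb := perm_map (@lhs Phi) (perm_to_rem eE).
  have sub : {subset bound_fvars E <= map (@lhs Phi) es}.
    move=> r; rewrite (perm_mem pb) /= !inE => /orP[->//|->].
    by rewrite !orbT.
  have qes : q \in map (@lhs Phi) es by rewrite !inE eqxx orbT.
  have GE := split_nth Tt jG.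
  (* Among the equations only those of [p] and [q] need work; the others stay well-formed as the set
     of bound function variables grows. *)
  have wfE : wf_program (Defs.head E) es.
    have /and4P[w1 w2 /allP w3 /allP w4] := programP E.
    apply/and4P; split=> //.
    + have : uniq (q :: bound_fvars E) by rewrite /= qE uniq_bound.
      rewrite (perm_uniq (_ : perm_eq _ (map (@lhs Phi) es)))//.
      move: pb; rewrite -(perm_cons q) => /perm_trans; apply.
      exact/permPl/(perm_catCA [:: q] [:: p]).
    + by apply/allP => r /w3 /sub.
    + rewrite /= [all _ (rem _ _)](_ : _ = true); last first.
        by apply/allP => e /mem_rem/w4; apply: wf_equation_sub sub.
      rewrite andbT; apply/andP; split; apply/and5P; rewrite /params /lhs /rhs /=.
      * split=> //; first exact/eqP.
        - by rewrite set_nth_cat//; apply: (@ivars_replaced c _ _ (nth Tt Gs j)); rewrite -GE.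
        - rewrite set_nth_cat//; apply: (@fvars_replaced c _ _ (nth Tt Gs j)) => //.
          by rewrite -GE; apply: sub_all vf => r /sub.
        - apply/eqP; rewrite -ts set_nth_cat// [in RHS]GE.
          by apply: (@tsort_replaced c (take j Gs) (drop j.+1 Gs) (nth Tt Gs j) q xs);
            rewrite tq.
      * split=> //; first by rewrite tq sz.
        - by apply: (ivars_args vx); apply: mem_nth.
        - have /allP := fvars_args vf (mem_nth Tt jG).
          by move=> h; apply/allP => r /h /sub.
        - by rewrite sj tq.
  have wxE : wf_extprogram (Program wfE) (xvars E) := extprogramP E.
  exists (ExtProgram wxE).
    by apply: (red1_body (p := p) (xs := xs) (c := c) (Gs := Gs) (j := j) (q := q)) => //;
      rewrite /= ?tq.
  rewrite /redexes /= ltn_add2l.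
  rewrite (perm_sumn (perm_map _ (perm_to_rem eE))) /= addnA ltn_add2r /rhs /=.
  by rewrite set_nth_cat// [X in _ < size (positions (App c X))]GE
    (size_positions_replaced _ _ _ q xs nG) ltnS.
- move=> /reducible_term[c [Gs [j [tE jG nG]]]].
  have /and4P[w1 w2 w3 w4] := programP E; have /andP[ux vx] := extprogramP E.
  rewrite tE in w2 w3 vx.
  have [s sj] : exists s, tsort (nth Tt Gs j) = Some s.
    have := @wsorted_args _ c Gs w2 _ (mem_nth Tt jG); rewrite /wsorted.
    by case: tsort => // s; exists s.
  have [q qE tq] := fresh_fvar (size (xvars E), s) (bound_fvars E).
  pose es := (q, xvars E, nth Tt Gs j) :: body E.
  have sub : {subset bound_fvars E <= map (@lhs Phi) es}.
    by move=> r; rewrite inE orbC => ->.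
  have GE := split_nth Tt jG.
  have wfE : wf_program (App c (set_nth Tt Gs j (fapp Phi q (xvars E)))) es.
    apply/and4P; split=> //.
    + by rewrite /= w1 andbT.
    + by rewrite set_nth_cat// (@tsort_replaced c _ _ (nth Tt Gs j)) ?tq// -GE.
    + rewrite set_nth_cat//; apply: (@fvars_replaced c _ _ (nth Tt Gs j)) => //.
        by rewrite mem_head.
      by rewrite -GE; apply: sub_all w3 => r /sub.
    + apply/andP; split; last first.
        by apply: sub_all w4 => e; apply: wf_equation_sub sub.
      apply/and5P; rewrite /params /lhs /rhs /=; split=> //.
      * by rewrite tq.
      * by apply: (ivars_args vx); apply: mem_nth.
      * have /allP := fvars_args w3 (mem_nth Tt jG).
        by move=> h; apply/allP => r /h /sub.
      * by rewrite sj tq.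
  have wxE : wf_extprogram (Program wfE) (xvars E).
    apply/andP; split=> //; rewrite [Defs.head _]/=.
    by rewrite set_nth_cat//; apply: (@ivars_replaced c _ _ (nth Tt Gs j)); rewrite -GE.
  exists (ExtProgram wxE).
    by apply: (red1_head (c := c) (Gs := Gs) (j := j) (q := q)) => //; rewrite /= ?tq.
  rewrite /redexes [Defs.head (ExtProgram _)]/= [body (ExtProgram _)]/= tE.
  rewrite map_cons /= addnA ltn_add2r.
  by rewrite set_nth_cat// [X in _ < size (positions (App c X))]GE 
    (size_positions_replaced _ _ _ q (xvars E) nG) ltnS.
Qed.

Lemma rename_id t : rename id id t = t.
Proof.
elim/term_ind_mem: t => //= c ts IH; congr App; first by case: c {IH}.
by rewrite -[RHS]map_id; apply/eq_in_map.
Qed.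

Lemma congruent_refl (E : program Phi) : congruent E E.
Proof.
exists id, (fun _ => id); split; rewrite ?rename_id//.
  by move=> e _ x y.
rewrite map_id_in// => -[[p xs] t] _.
by rewrite /rename_equation /lhs /params /rhs /= map_id rename_id.
Qed.

Lemma canonical_form_exists E : exists F, canonical_form E F.
Proof.
suff [F iF EF] : exists2 F : extprogram Phi, irreducible F &
    clos_refl_trans_1n _ (@red1 Phi) E F.
  by exists F; split=> //; exists F => //; split=> //; apply: congruent_refl.
have [n] := ubnP (redexes E); elim: n E => // n IH E; rewrite ltnS => nE.
have [iE|/red1_exists[F EF FE]] := boolP (irreducible E).
  by exists E => //; apply: rt1n_refl.
have [G iG FG] := IH _ (leq_trans FE nE).
by exists G => //; apply: Relation_Operators.rt1n_trans EF FG.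
Qed.

End Reduction.

(** * The computed canonical form *)

Section CodedFlattening.
Variable Phi : signature.
Implicit Types (t u : term Phi) (ts : seq (term Phi)) (c : op Phi).
Implicit Types (E F G : extprogram Phi).

Lemma mem_positions c ts l u : (l, u) \in positions (App c ts) <->
  exists i m, [/\ l = i :: m, i < size ts, ~~ immediate (nth Tt ts i) &
    (m, u) \in ([::], nth Tt ts i) :: positions (nth Tt ts i)].
Proof.
rewrite positions_App; suff h j l' : (l', u) \in positions_from j ts <->
    exists i m, [/\ l' = (j + i) :: m, i < size ts, ~~ immediate (nth Tt ts i) &
    (m, u) \in ([::], nth Tt ts i) :: positions (nth Tt ts i)].
  exact: h.
elim: ts {l} j l' => [|t ts IH] j l /=; first by split=> // -[i [m []]].
rewrite mem_cat; split.
- move=> /orP[|h]; last first.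
    have [i [m [-> h1 h2 h3]]] := (IH j.+1 l).1 h.
    by exists i.+1, m; rewrite addnS -addSn.
  rewrite /position1; case: ifP => // it.
  rewrite inE => /predU1P[[-> ->]|/mapP[[m v] hm [-> ->]]].
    by exists 0, [::]; rewrite addn0 it mem_head.
  by exists 0, m; rewrite addn0 it in_cons hm orbT.
- move=> [[|i] [m [-> h1 h2 h3]]]; last first.
    by apply/orP; right; apply/IH; exists i, m; rewrite addSn addnS.
  apply/orP; left; rewrite /position1 addn0; move: h2 h3 => /= /negPf ->.
  rewrite !inE => /predU1P[[-> ->]|h]; first by rewrite eqxx.
  by apply/orP; right; apply/mapP; exists (m, u).
Qed.

Definition subterm_at t (l : seq nat) : term Phi :=
  foldl (fun u j => nth Tt (subterms u) j) t l.

Lemma path_name_rcons m t l j : path_name m t (rcons l j) =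
  newname (path_name m t l) j (sort_of (nth Tt (subterms (subterm_at t l)) j)).
Proof. by elim: l m t => //= i l IH m t; rewrite IH. Qed.

Lemma positions_induction (Q : term Phi -> seq nat -> term Phi -> Prop) :
  (forall t, Q t [::] t) ->
  (forall c ts i l u, i < size ts -> ~~ immediate (nth Tt ts i) ->
     Q (nth Tt ts i) l u -> Q (App c ts) (i :: l) u) ->
  forall t l u, (l, u) \in ([::], t) :: positions t -> Q t l u.
Proof.
move=> Q0 Q1; elim/term_ind_mem => [||v|c ts IH] l u;
  rewrite in_cons => /predU1P[[-> ->] //|//].
move=> /mem_positions[i [m [-> h1 h2 h3]]].
by apply: Q1 => //; apply: IH => //; apply: mem_nth.
Qed.

Lemma subterm_at_positions t l u :
  (l, u) \in ([::], t) :: positions t -> subterm_at t l = u.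
Proof.
by move: t l u; apply: positions_induction => // c ts i l u _ _; apply.
Qed.

Lemma fvars_positions (B : {pred fvar}) t l u :
  (l, u) \in ([::], t) :: positions t -> all (mem B) (fvars t) -> all (mem B) (fvars u).
Proof.
move: t l u; apply: positions_induction => // c ts i l u hi _ h1 /fvars_args h2.
exact/h1/h2/mem_nth.
Qed.

Lemma wsorted_positions t l u :
  (l, u) \in ([::], t) :: positions t -> wsorted t -> wsorted u.
Proof.
move: t l u; apply: positions_induction => // c ts i l u hi _ h1 /wsorted_args h2.
exact/h1/h2/mem_nth.
Qed.

Lemma positions_arg t l c ts j : (l, App c ts) \in ([::], t) :: positions t ->
  j < size ts -> ~~ immediate (nth Tt ts j) -> (rcons l j, nth Tt ts j) \in positions t.
Proof.
move=> h hj nj; pose Q t l u := u = App c ts -> (rcons l j, nth Tt ts j) \in positions t.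
suff : Q t l (App c ts) by apply.
apply: positions_induction h => {t l} [t ->|d us i l u hi ni IH /IH h].
  by apply/mem_positions; exists j, [::]; split => //; rewrite mem_head.
apply/mem_positions; exists i, (rcons l j).
by split=> //; rewrite in_cons h orbT.
Qed.

(** Recovers root and path from a name. In a [newname] of a name other than [Leaf], the leftmost
    grandchild is a [Node]; in a [code_fvar] the left child is a unary number, whose own left child,
    if any, is [Leaf]. *)
Fixpoint split_name (m : tree) : tree * seq tree :=
  match m with
  | Node (Node ((Node _ _) as m') j) _ =>
      let: (r, l) := split_name m' in (r, rcons l j)
  | _ => (m, [::])
  end.

Lemma split_path_name m t l : m != Leaf -> split_name (path_name m t l) =
  ((split_name m).1, (split_name m).2 ++ map code_nat l).
Proof.
elim: l m t => [|j l IH] m t hm /=; first by rewrite cats0; case: split_name.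
rewrite IH//; case: m hm => // a b _.
rewrite (_ : split_name (newname _ _ _) =
  let: (r, s) := split_name (Node a b) in (r, rcons s (code_nat j)))//.
by case: (split_name (Node a b)) => r s /=; rewrite cat_rcons.
Qed.

Lemma split_root_name o : split_name (root_name o) = (root_name o, [::]).
Proof. by case: o => [[[[|n] s] i]|]. Qed.

Lemma root_name_neq o : root_name o != Leaf.
Proof. by case: o. Qed.

Lemma root_name_inj : injective root_name.
Proof. by case=> [p|] [q|] // h; congr Some; apply: code_fvar_inj. Qed.

(** One entry for each equation of a canonical form: a part of [E] with a position in it. The empty
    path in the head is left out, since it gives the head of the canonical form. *)
Definition eqn_indices (E : extprogram Phi) :=
  [seq (None, xvars E, Defs.head E, x) | x <- positions (Defs.head E)] ++
  flatten [seq [seq (Some (lhs e), params e, rhs e, x) | x <- ([::], rhs e) :: positions (rhs e)]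
          | e <- body E].

Definition index_eqn (nu : option fvar -> seq nat -> fvar)
    (y : option fvar * seq nat * term Phi * (seq nat * term Phi)) : equation Phi :=
  flat_eqn (nu y.1.1.1) y.1.1.2 y.2.

Definition index_name (y : option fvar * seq nat * term Phi * (seq nat * term Phi)) : tree :=
  path_name (root_name y.1.1.1) y.1.2 y.2.1.

Lemma code_cf_indices E : code_cf E =
  code_part (Node Leaf Leaf) (xvars E) (Defs.head E) ::
  [seq code_part (index_name y) y.1.1.2 y.2.2 | y <- eqn_indices E].
Proof.
rewrite /code_cf /= /eqn_indices map_cat; congr (_ :: _ ++ _).
  by rewrite -map_comp.
by rewrite map_flatten -!map_comp; congr flatten; apply: eq_map => e /=; rewrite -map_comp.
Qed.

Lemma flattening_indices E G nu : flattening E G nu ->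
  perm_eq (body G) (map (index_eqn nu) (eqn_indices E)).
Proof.
move=> [_ _ _ h]; apply: perm_trans h _; rewrite /eqn_indices map_cat -map_comp.
rewrite perm_cat2l map_flatten -map_comp; apply/permP => P; congr (count P (flatten _)).
by apply: eq_map => e /=; rewrite -map_comp.
Qed.

Lemma eqn_indices_root E r l u : (r, (l, u)) \in eqn_indices E ->
  r \in root_parts E /\ (l, u) \in ([::], r.2) :: positions r.2.
Proof.
rewrite mem_cat => /orP[/mapP[x hx [-> ->]]|/flatten_mapP[e eE /mapP[x hx [-> ->]]]].
  by rewrite mem_head; split => //=; rewrite in_cons hx orbT.
split=> //.
by rewrite in_cons; apply/orP; right; apply/mapP; exists e.
Qed.

Lemma mem_eqn_indices E r x : r \in root_parts E -> x \in positions r.2 ->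
  (r, x) \in eqn_indices E.
Proof.
rewrite in_cons mem_cat => /predU1P[-> hx|/mapP[e eE ->] hx].
  by rewrite map_f.
by apply/orP; right; apply/flatten_mapP; exists e => //; rewrite map_f// in_cons hx orbT.
Qed.

Lemma mem_root_index E e : e \in body E ->
  ((Some (lhs e), params e, rhs e), ([::], rhs e)) \in eqn_indices E.
Proof.
move=> eE; rewrite mem_cat; apply/orP; right; apply/flatten_mapP; exists e => //.
by rewrite map_f// mem_head.
Qed.

Lemma fvars_root E r : r \in root_parts E -> all (mem (bound_fvars E)) (fvars r.2).
Proof.
rewrite in_cons => /predU1P[->|/mapP[e /wf_body[_ _ _ h _] ->] //].
exact: head_fvars.
Qed.

Lemma wsorted_root E r : r \in root_parts E -> wsorted r.2.
Proof.
rewrite in_cons => /predU1P[->|/mapP[e /wsorted_rhs h ->] //].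
exact: wsorted_head.
Qed.

(** * Path names for the equations of a given canonical form *)

Section Flattening.
Variables (E G : extprogram Phi) (nu : option fvar -> seq nat -> fvar).
Hypothesis EG : flattening E G nu.

Let IX := eqn_indices E.
Let lhs_of y := lhs (index_eqn nu y).

(** Injectivity of [nu] on the indices comes from [G] being a program, whose left-hand sides are
    distinct. *)
Lemma uniq_lhs_of : uniq (map lhs_of IX).
Proof.
rewrite map_comp -(perm_uniq (perm_map (@lhs Phi) (flattening_indices EG))).
exact: uniq_bound.
Qed.

(** The dictionary from the function variables chosen by the reduction to the names produced by the
    program. *)
Definition tree_name (p : fvar) : tree :=
  nth Leaf (map index_name IX) (index p (map lhs_of IX)).

Lemma tree_nameE y : y \in IX -> tree_name (lhs_of y) = index_name y.
Proof.
move=> yI; rewrite /tree_name (index_map_in (uniq_map_inj uniq_lhs_of))//.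
by rewrite (nth_map y) ?index_mem// nth_index.
Qed.

Lemma bound_index p : p \in bound_fvars G -> exists2 y, y \in IX & p = lhs_of y.
Proof.
rewrite (perm_mem (perm_map (@lhs Phi) (flattening_indices EG))) -map_comp.
by move=> /mapP[y yI ->]; exists y.
Qed.

Lemma tree_name_inj : {in bound_fvars G &, injective tree_name}.
Proof.
move=> _ _ /bound_index[[[[o xs] t] [l u]] yI ->] /bound_index[[[[o' xs'] t'] [l' u']] zI ->].
rewrite !tree_nameE// => /(congr1 split_name).
rewrite !split_path_name ?root_name_neq// !split_root_name /=.
by move=> [/root_name_inj -> /(inj_map code_nat_inj) ->].
Qed.

Lemma tree_name_bound p : p \in bound_fvars E -> tree_name p = code_fvar p.
Proof.
move=> pE; have [_ _ h _] := EG; have /mapP[e eE pe] := pE.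
have := tree_nameE (mem_root_index eE).
rewrite (_ : lhs_of _ = p); last by rewrite -[LHS]/(nu (Some (lhs e)) [::]) -pe h.
by rewrite /index_name /= -pe.
Qed.

Lemma index_eqn_body y : y \in IX -> index_eqn nu y \in body G.
Proof. by move=> yI; rewrite (perm_mem (flattening_indices EG)) map_f. Qed.

(** Since [G] is well-formed, the left-hand side has the sort of [top], in which arguments are
    replaced by calls. By induction these calls have the sorts of the arguments that they replace,
    so [top] has the sort of the original subterm. *)
Lemma sort_lhs_of y : y \in IX -> (fv_type (lhs_of y)).2 = sort_of y.2.2.
Proof.
have key z : z \in IX -> tsort (rhs (index_eqn nu z)) = Some (fv_type (lhs_of z)).2.
  by move=> /index_eqn_body/wf_body[].
move: y => -[r [l u]]; elim/term_ind_mem: u l => [||v|c ts IH] l yI; have := key _ yI;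
  rewrite /index_eqn /flat_eqn /rhs /sort_of /=; try by case=> <-.
suff -> : map (@tsort Phi) (top_args (nu r.1.1) l r.1.2 0 ts) = map (@tsort Phi) ts.
  by move=> ->.
have [rE lu] := eqn_indices_root yI.
have wts : {in ts, forall t, wsorted t}.
  exact/wsorted_args/(wsorted_positions lu)/(wsorted_root rE).
(* The prefix [ts1] keeps track of the index in the whole argument list, on which the names
   depend. *)
suff h ts1 ts2 : ts = ts1 ++ ts2 ->
    map (@tsort Phi) (top_args (nu r.1.1) l r.1.2 (size ts1) ts2) = map (@tsort Phi) ts2.
  exact: (h [::]).
elim: ts2 ts1 => //= t ts2 IHs ts1 e.
have := IHs (rcons ts1 t); rewrite size_rcons cat_rcons => -> //; congr (_ :: _).
case: ifP => // /negbT nt.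
have tE : nth Tt ts (size ts1) = t by rewrite e nth_cat ltnn subnn.
have sts : size ts1 < size ts by rewrite e size_cat /= addnS ltnS leq_addr.
have ytI : (r, (rcons l (size ts1), t)) \in IX.
  apply: mem_eqn_indices => //; rewrite -tE; apply: positions_arg lu _ _ => //.
  by rewrite tE.
have tts : t \in ts by rewrite -tE mem_nth.
have [szt _ _ _ _] := wf_body (index_eqn_body ytI).
rewrite /= -map_comp (_ : map _ _ = nseq (size r.1.2) (Some ind)); last first.
  by elim: (r.1.2) => //= x xs ->.
rewrite [size _]szt eqxx; have := IH t tts _ ytI; rewrite /lhs_of /lhs /= => ->.
by have := wts t tts; rewrite /wsorted /sort_of; case: tsort.
Qed.

Lemma tree_name_sort : {in bound_fvars G, forall p, sort_respecting tree_name p}.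
Proof.
move=> _ /bound_index[[r [l u]] yI ->]; rewrite /sort_respecting tree_nameE// sort_lhs_of//.
have [rE lu] := eqn_indices_root yI.
case/lastP: l => [|l j] in yI lu *.
  have ru : u = r.2 by have /= := subterm_at_positions lu.
  rewrite /index_name /= ru.
  move: rE yI; rewrite in_cons => /predU1P[->|/mapP[e eE ->] _] /=.
    (* The empty path cannot occur with the head: positions of proper subterms have nonempty
       paths. *)
    rewrite mem_cat => /orP[/mapP[x hx [xE]]|/flatten_mapP[e _ /mapP[x _ []]] //].
    by move: hx; rewrite -xE; case: (Defs.head E) => // c ts /mem_positions[i [m []]].
  have [_ _ _ _ h] := wf_body eE.
  by rewrite /sort_of h; apply: (sort_respecting_code_fvar (lhs e)).
rewrite /index_name path_name_rcons /=; congr (code_bool (is_boole (sort_of _))).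
by rewrite -(subterm_at_positions lu) /subterm_at foldl_rcons.
Qed.

Lemma code_gen_fvars_eq cn cn' t :
  {in fvars t, cn =1 cn'} -> code_gen cn t = code_gen cn' t.
Proof.
elim/term_ind_mem: t => //= c ts IH h.
have -> : map (code_gen cn) ts = map (code_gen cn') ts.
  apply/eq_in_map => t tts; apply: IH => // p hp; apply: h.
  by rewrite mem_cat; apply/orP; right; apply/flatten_mapP; exists t.
by case: c h {IH} => //= p h; rewrite h// mem_head.
Qed.

Lemma code_gen_top r l u : r \in root_parts E -> (l, u) \in ([::], r.2) :: positions r.2 ->
  code_gen tree_name (top (nu r.1.1) l r.1.2 u) =
  code_top (path_name (root_name r.1.1) r.2 l) r.1.2 u.
Proof.
move=> rE lu.
have fu := fvars_positions lu (fvars_root rE).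
case: u lu fu => // c ts lu fu; rewrite /top /code_top /=.
have -> : (if c is OpVar p then Node Leaf (tree_name p) else code_op c) = code_op c.
  by case: c fu {lu} => //= p /andP[pE _]; rewrite tree_name_bound.
congr (Node _ (Node _ (code_list _))).
suff h ts1 ts2 : ts = ts1 ++ ts2 ->
    map (code_gen tree_name) (top_args (nu r.1.1) l r.1.2 (size ts1) ts2) =
    code_topargs (path_name (root_name r.1.1) r.2 l) r.1.2 (size ts1) ts2.
  exact: (h [::]).
elim: ts2 ts1 => //= t ts2 IHs ts1 e.
have := IHs (rcons ts1 t); rewrite size_rcons cat_rcons => -> //; congr (_ :: _).
have tE : nth Tt ts (size ts1) = t by rewrite e nth_cat ltnn subnn.
have sts : size ts1 < size ts by rewrite e size_cat /= addnS ltnS leq_addr.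
have tts : t \in ts by rewrite -tE mem_nth.
case: ifP => [_|/negbT nt].
  by apply: code_gen_fvars_eq => p /(allP (fvars_args fu tts)); apply: tree_name_bound.
have ytI : (r, (rcons l (size ts1), t)) \in IX.
  apply: mem_eqn_indices => //; rewrite -tE; apply: positions_arg lu _ _ => //.
  by rewrite tE.
rewrite /= /code_call /code_seq -map_comp; congr (Node _ (Node (Node _ _) _)).
have := tree_nameE ytI; rewrite /lhs_of /lhs /= => ->.
by rewrite /index_name path_name_rcons (subterm_at_positions lu) /= tE.
Qed.

(** The computed list is thus the code of any irreducible [G] reached from [E], up to the order of
    its equations and the injective change of names [tree_name]. *)
Lemma code_cf_flattening : exists2 es, perm_eq (body G) es &
  code_list (code_cf E) =
  code_parts tree_name
    ((Node Leaf Leaf, xvars G, Defs.head G) :: body_parts tree_name es).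
Proof.
have [gx gh _ _] := EG.
exists (map (index_eqn nu) IX); first exact: flattening_indices.
rewrite code_cf_indices /code_parts /body_parts -map_comp map_cons; congr (code_list (_ :: _)).
  rewrite /code_part /code_eqn /= gx gh.
  by rewrite (@code_gen_top (None, xvars E, Defs.head E) [::])// mem_head.
rewrite -[RHS]/(map _ _) -map_comp; apply/eq_in_map => -[r [l u]] yI /=; have [rE lu] := eqn_indices_root yI.
by rewrite /code_part /code_eqn tree_nameE//= code_gen_top.
Qed.

End Flattening.
End CodedFlattening.

(** * Identities between irreducible terms *)

Section Identities.
Variables (Phi : signature) (A : structure Phi).
Implicit Types (t u : term Phi) (ts : seq (term Phi)) (c : op Phi).
Notation V := (A + bool)%type.
Notation valuation := (valuation A).

(** Here the outermost operation is itself an unknown, so the value is not determined by those of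
    the constituents; such terms are kept out of the table. *)
Definition opvar_app t : bool :=
  ~~ immediate t && (if t is App (OpVar _) _ then true else false).

Definition tame t : bool := [&& irreducible_term t, wsorted t & ~~ opvar_app t].

(* The value of an irreducible term which is not of the form
   [p(I_1, ..., I_n)] depends only on those of its immediate constituents. *)
Definition value_at t (ws : seq (option V)) : option V :=
  if immediate t then nth None ws 0 else
  match t with
  | Tt => Some (inr true)
  | Ff => Some (inr false)
  | App (OpSym f) _ => uapply (ucall (interp A f)) ws
  | App OpCond _ => ucond ws
  | _ => None
  end.

Lemma uden_value_at (rho : valuation) eta t : ~~ opvar_app t ->
  uden rho eta t = value_at t (map (uden rho eta) (term_args t)).
Proof.
rewrite /opvar_app /value_at /term_args.
by case: ifP => [//|]; case: t => // -[p|f|] ts //= ->.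
Qed.

(* The assignments of values to the terms of [L] that are realized by some values
   of the function variables and injective values of the individual variables. *)
Definition admissible (v : term Phi -> option V) (L : seq (term Phi)) : Prop :=
  [/\ forall x, Var x \in L -> exists a, v (Var x) = Some (inl a),
      forall x y, Var x \in L -> Var y \in L -> v (Var x) = v (Var y) -> x = y &
      forall p us w, App (OpVar p) us \in L -> v (App (OpVar p) us) = Some w ->
        vsort w = (fv_type p).2].

(** Abstract assignments [v], rather than valuations, are what can be moved between pairs with the
    same pattern. Sorts are compared separately, because terms undefined everywhere have equal
    values whatever their sorts. *)
Definition generically_equal t u : Prop :=
  tsort t = tsort u /\ forall v, admissible v (term_args t ++ term_args u) ->
    value_at t (map v (term_args t)) = value_at u (map v (term_args u)).

Definition flag_sort (fl : tree) : Defs.sort :=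
  if fl is Node (Node _ _) _ then boole else ind.

Lemma immediate_tsort t : immediate t -> wsorted t -> tsort t = Some (flag_sort (flag t)).
Proof.
case: t => // -[p|f|] ts //= _; rewrite /wsorted /=; case: ifP => // _ _.
by case: (fv_type p).2.
Qed.

Lemma flag_Var x t : immediate t -> flag t = flag (@Var Phi x) -> exists y, t = Var y.
Proof. by case: t => [||y|[p|f|] ts] // _ _; exists y. Qed.

Lemma flag_OpVar p us t : immediate t -> flag t = flag (App (@OpVar Phi p) us) ->
  exists q vs, t = App (OpVar q) vs /\ (fv_type q).2 = (fv_type p).2.
Proof.
case: t => [||y|[q|f|] vs] //= _ [] h; exists q, vs; split=> //.
by move: h; case: (fv_type q).2; case: (fv_type p).2.
Qed.

Lemma size_args_sym f ts : wsorted (App (OpSym f) ts) -> size ts = (typ f).1.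
Proof.
rewrite /wsorted /=; case: ifP => // /eqP/(congr1 size).
by rewrite size_map size_nseq.
Qed.

Lemma size_args_var p ts : wsorted (App (OpVar p) ts) -> size ts = (fv_type p).1.
Proof.
rewrite /wsorted /=; case: ifP => // /eqP/(congr1 size).
by rewrite size_map size_nseq.
Qed.

Lemma args_cond ts : wsorted (App OpCond ts) -> exists t0 t1 t2, ts = [:: t0; t1; t2].
Proof.
rewrite /wsorted /=.
case: ts => [//|t0 [|t1 [|t2 [|t3 ts]]]] /=; try by case: (tsort t0) => // -[].
by exists t0, t1, t2.
Qed.

Lemma tsort_cond t0 t1 t2 : wsorted (App OpCond [:: t0; t1; t2]) ->
  tsort (App OpCond [:: t0; t1; t2]) = tsort t1.
Proof. by rewrite /wsorted /=; case: (tsort t0) => // -[] //; case: ifP. Qed.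

Lemma term_args_wsorted t : wsorted t -> {in term_args t, forall u, wsorted u}.
Proof.
rewrite /term_args; case: ifP => _; first by move=> wt u; rewrite inE => /eqP ->.
by case: t => // c ts /wsorted_args.
Qed.

Lemma term_key_opvar t u : irreducible_term t -> term_key t = term_key u ->
  opvar_app t = opvar_app u.
Proof.
move=> _; rewrite /opvar_app /term_key.
case: (immediate t) (immediate u) => -[] //=.
- by case: u => // -[p|f|] us.
- by case: t => // -[p|f|] us.
- by case: t => [||x|[p|f|] ts]; case: u => [||y|[q|g|] us].
Qed.

Lemma term_key_eq t u : tame t -> tame u -> term_key t = term_key u ->
  size (term_args t) = size (term_args u) /\ value_at t =1 value_at u.
Proof.
move=> /and3P[_ wt nt] /and3P[_ wu nu]; rewrite /term_key /term_args /value_at.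
move: nt nu; rewrite /opvar_app.
case it : (immediate t); case iu : (immediate u) => //=.
- by case: u iu {wu} => // -[p|f|] us.
- by case: t it {wt} => // -[p|f|] us.
case: t it wt => [||x|[p|f|] ts] // _ wt; case: u iu wu => [||y|[q|g|] us] // _ wu _ _ //.
- move=> [/code_nat_inj/val_inj/enum_rank_inj fg]; subst g.
  by rewrite /= (size_args_sym wt) (size_args_sym wu).
- have [t0 [t1 [t2 ->]]] := args_cond wt.
  by have [u0 [u1 [u2 ->]]] := args_cond wu.
Qed.

Lemma term_key_tsort t u : tame t -> tame u -> term_key t = term_key u ->
  map (@flag Phi) (term_args t) = map (@flag Phi) (term_args u) -> tsort t = tsort u.
Proof.
move=> /and3P[irt wt nt] /and3P[iru wu nu]; rewrite /term_key /term_args.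
move: nt nu; rewrite /opvar_app.
case it : (immediate t); case iu : (immediate u) => //=.
- by move=> _ _ _ [h]; rewrite !immediate_tsort// h.
- by case: u iu {wu iru} => // -[p|f|] us.
- by case: t it {wt irt} => // -[p|f|] us.
case: t it wt irt => [||x|[p|f|] ts] // _ wt irt; case: u iu wu iru => [||y|[q|g|] us] // _ wu iru _ _ //.
- move=> [/code_nat_inj/val_inj/enum_rank_inj fg] _; subst g.
  by move: wt wu; rewrite /wsorted /=; case: ifP => // _; case: ifP.
- have [t0 [t1 [t2 te]]] := args_cond wt; have [u0 [u1 [u2 ue]]] := args_cond wu.
  subst ts us => _ [_ h _]; rewrite !tsort_cond//.
  have wt1 : wsorted t1 by apply: (wsorted_args wt); rewrite !inE eqxx orbT.
  have wu1 : wsorted u1 by apply: (wsorted_args wu); rewrite !inE eqxx orbT.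
  move: irt iru; rewrite !irreducible_all_immediate /= => /and4P[_ it1 _ _] /and4P[_ iu1 _ _].
  by rewrite !immediate_tsort// h.
Qed.

(** Equal keys give equal operations. An assignment for one pair is moved to the other position by
    position; equal indices of first occurrence make this consistent and keep distinct variables at
    distinct values. *)
Lemma pattern_generically_equal t u t' u' :
  tame t -> tame u -> tame t' -> tame u' ->
  pattern t u = pattern t' u' -> generically_equal t' u' -> generically_equal t u.
Proof.
move=> tt tu tt' tu' [kt ku /code_list_inj] + [st' gv].
set L := term_args t ++ term_args u; set L' := term_args t' ++ term_args u' => prof.
have [szt vt] := term_key_eq tt tt' kt; have [szu vu] := term_key_eq tu tu' ku.
have szL : size L = size L' by rewrite !size_cat szt szu.
have nthp i : i < size L -> flag (nth Tt L i) = flag (nth Tt L' i) /\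
    index (nth Tt L i) L = index (nth Tt L' i) L'.
  move=> iL; have := congr1 (nth Leaf ^~ i) prof.
  by rewrite /profile !(nth_map Tt) -?szL// => -[-> /code_nat_inj ->].
have flE : map (@flag Phi) L = map (@flag Phi) L'.
  apply: (@eq_from_nth _ Leaf); rewrite !size_map// => i iL.
  by rewrite !(nth_map Tt) -?szL//; have [] := nthp i iL.
have [flt flu] : map (@flag Phi) (term_args t) = map (@flag Phi) (term_args t') /\
    map (@flag Phi) (term_args u) = map (@flag Phi) (term_args u').
  move/eqP: flE; rewrite !map_cat eqseq_cat ?size_map//.
  by move=> /andP[/eqP -> /eqP ->].
split; first by rewrite (term_key_tsort tt tt')// (term_key_tsort tu tu').
(* A term of [L'] receives the value of the term of [L] standing at the place where it first occurs
   in [L']. *)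
move=> v [vv vi vty]; pose v' J := v (nth Tt L (index J L')).
have imL J : J \in L -> immediate J.
  have /and3P[it _ _] := tt; have /and3P[iu _ _] := tu.
  by rewrite mem_cat => /orP[/(allP (irreducible_args it))|/(allP (irreducible_args iu))].
have v'E : map v' L' = map v L.
  apply: (@eq_from_nth _ None); rewrite !size_map// => i iL.
  have iL' : i < size L by rewrite szL.
  rewrite !(nth_map Tt)// /v'; have [_ <-] := nthp i iL'.
  by rewrite nth_index// mem_nth.
have find J : J \in L' -> exists i, [/\ i < size L, nth Tt L' i = J, v' J = v (nth Tt L i) &
    flag (nth Tt L i) = flag J].
  move=> JL; exists (index J L'); have iL : index J L' < size L by rewrite szL index_mem.
  have [h _] := nthp _ iL; rewrite nth_index// in h.
  by rewrite nth_index.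
have adm : admissible v' L'.
  split.
  - move=> x /find[i [iL _ -> /flag_Var]] []; first exact/imL/mem_nth.
    by move=> y yE; rewrite yE; apply: vv; rewrite -yE mem_nth.
  (* Equal values make the variables at places [i] and [j] of [L] equal, hence their first indices
     in [L], hence those of [Var x] and [Var y] in [L']. *)
  - move=> x y /find[i [iL ix -> /flag_Var hx]] /find[j [jL jy -> /flag_Var hy]].
    have [x' xE] := hx (imL _ (mem_nth _ iL)); have [y' yE] := hy (imL _ (mem_nth _ jL)).
    rewrite xE yE => h; have xy : x' = y'.
      by apply: vi h; rewrite -?xE -?yE mem_nth.
    have [_ e1] := nthp _ iL; have [_ e2] := nthp _ jL.
    rewrite xE ix in e1; rewrite yE jy -xy e1 in e2.
    have : Var x = Var y :> term Phi.
      have xL' : Var x \in L' by rewrite -ix mem_nth -?szL.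
      have yL' : Var y \in L' by rewrite -jy mem_nth -?szL.
      by rewrite -(nth_index Tt xL') e2 nth_index.
    by case.
  - move=> p us w /find[i [iL _ -> /flag_OpVar]] []; first exact/imL/mem_nth.
    move=> q [vs [qE <-]]; rewrite qE; apply: vty.
    by rewrite -qE mem_nth.
have := gv v' adm; rewrite vt vu.
have := congr1 (take (size (term_args t))) v'E.
rewrite !map_cat !take_size_cat ?size_map// => ->.
have := congr1 (drop (size (term_args t))) v'E.
by rewrite !map_cat !drop_size_cat ?size_map// => ->.
Qed.

(** * Finiteness of the set of patterns *)

Definition tame_keys : seq tree :=
  [:: Leaf, Node (code_nat 0) Leaf, Node (code_nat 1) Leaf,
      Node (code_op (@OpCond Phi)) (Node Leaf Leaf) &
      [seq Node (code_op (OpSym f)) (Node Leaf Leaf) | f <- enum Phi]].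

Lemma mem_tame_keys t : tame t -> term_key t \in tame_keys.
Proof.
move=> /and3P[_ _]; rewrite /opvar_app /term_key; case: ifP => [_ _|_].
  by rewrite mem_head.
case: t => [||x|[p|f|] ts] //= _; rewrite !inE ?eqxx ?orbT//.
by rewrite map_f ?orbT// mem_enum.
Qed.

(** The constant 3 is the number of arguments of a conditional; it also covers the single
    constituent of an immediate term. *)
Definition args_bound : nat := maxn 3 (\max_(f : Phi) (typ f).1).

Lemma size_term_args t : tame t -> size (term_args t) <= args_bound.
Proof.
rewrite /tame /opvar_app /term_args /args_bound => /and3P[_ wt].
case: ifP => [_ _|_]; first by rewrite leq_max.
case: t wt => // -[p|f|] ts wt //= _.
  by rewrite (size_args_sym wt) leq_max (leq_bigmax f) orbT.
by have [t0 [t1 [t2 ->]]] := args_cond wt; rewrite leq_max.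
Qed.

(** Two terms have at most [args_bound + args_bound] constituents together; the successor lets
    [iota 0 n] reach that length. The three flags stand for an individual variable and for a
    function variable of either sort. *)
Definition tame_patterns : seq tree :=
  let n := (args_bound + args_bound).+1 in
  [seq Node k1 (Node x.1 (code_list x.2)) | k1 <- tame_keys,
     x <- [seq (k2, w) | k2 <- tame_keys, w <- flatten [seq words
       [seq Node fl (code_nat i)
       | fl <- [:: Leaf; Node Leaf Leaf; Node (Node Leaf Leaf) Leaf], i <- iota 0 n] m
       | m <- iota 0 n]]].

Lemma mem_tame_patterns t u : tame t -> tame u -> pattern t u \in tame_patterns.
Proof.
move=> tt tu; rewrite /tame_patterns; apply/allpairsP; rewrite /pattern.
set L := term_args t ++ term_args u.
have sL : size L <= args_bound + args_bound by rewrite size_cat leq_add// size_term_args.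
exists (term_key t, (term_key u, profile L L)); split; rewrite ?mem_tame_keys//.
apply/allpairsP; exists (term_key u, profile L L); split; rewrite ?mem_tame_keys//.
apply/flatten_mapP; exists (size L); first by rewrite mem_iota.
apply: mem_words; first by rewrite size_map.
apply/allP => _ /mapP[J JL ->]; apply/allpairsP; exists (flag J, index J L); split=> //.
  by case: J {JL} => [||x|[p|f|] ts] //=; case: (is_boole _).
by rewrite mem_iota /= ltnS (leq_trans _ sL)// index_size.
Qed.

(** A classical filter of the finite list of candidates. A pattern is kept when some pair having it
    is generically equal, and by [pattern_generically_equal] every tame pair having it then is. *)
Lemma table_exists : exists T : seq tree, forall t u,
  irreducible_term t -> wsorted t -> irreducible_term u -> wsorted u ->
  pattern t u \in T <-> [/\ tame t, tame u & generically_equal t u].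
Proof.
exists [seq x <- tame_patterns | `[< exists t u,
  [/\ tame t, tame u, pattern t u = x & generically_equal t u] >]] => t u it wt iu wu.
split; last first.
  by move=> [tt tu gv]; rewrite mem_filter mem_tame_patterns// andbT; apply/asboolP; exists t, u.
rewrite mem_filter => /andP[/asboolP[t' [u' [tt' tu' pE gv]]] _].
have [kt ku _] := pE; have /and3P[it' wt' nt'] := tt'; have /and3P[iu' wu' nu'] := tu'.
have tt : tame t by rewrite /tame it wt -(term_key_opvar it' kt).
have tu : tame u by rewrite /tame iu wu -(term_key_opvar iu' ku).
by split=> //; apply: pattern_generically_equal (esym pE) gv.
Qed.

Lemma infinite_injection (T : Type) : infinite_set [set: T]%classic ->
  exists f : nat -> T, injective f.
Proof.
move=> /infiniteP/card_leP[f].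
exists (fun n => set_val (f (SigSub (mem_set (I : [set: nat]%classic n))))) => m n.
by move=> /val_inj h; have := @inj _ _ _ f _ _ (mem_set I) (mem_set I) h => -[].
Qed.

Lemma strict_seq_some (s : seq A) : strict_seq (map Some s) = Some s.
Proof. by elim: s => //= a s ->. Qed.

Lemma uapply_some (g : seq A -> option V) (ts : seq (term Phi)) rho eta
    (b : term Phi -> A) :
  {in ts, forall t, uden rho eta t = Some (inl (b t))} ->
  uapply g (map (uden rho eta) ts) = g (map b ts).
Proof.
move=> h; rewrite /uapply -map_comp.
have -> : map (@as_ind Phi A \o uden rho eta) ts = map Some (map b ts).
  by rewrite -map_comp; apply/eq_in_map => t /h /= ->.
by rewrite strict_seq_some.
Qed.

Lemma immediateP t : immediate t ->
  (exists x, t = Var x) \/ (exists p us, t = fapp Phi p us).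
Proof.
case: t => [||x|[p|f|] ts] //= h; first by left; exists x.
right; exists p, [seq (if t is Var x then x else 0) | t <- ts].
rewrite /fapp; congr App; rewrite -map_comp -[LHS]map_id.
by apply/eq_in_map => t /(allP h); case: t.
Qed.

Lemma uden_fapp (rho : valuation) (y : nat -> A) p us :
  uden rho (fun x => Some (y x)) (fapp Phi p us) = rho p (map y us).
Proof.
rewrite /= (@uapply_some _ _ _ _ (fun t => if t is Var x then y x else y 0)).
  by rewrite -map_comp.
by move=> _ /mapP[x _ ->].
Qed.

Definition identical (xs : seq nat) t u : Prop :=
  forall (rho : valuation) a, typed_valuation rho -> size a = size xs ->
    uden rho (at_args xs a) t = uden rho (at_args xs a) u.

(** Total assignments allow values to be chosen for all variables at once, without reference to
    [xs]. *)
Lemma identical_total xs t u : all (mem xs) (ivars t) -> all (mem xs) (ivars u) ->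
  identical xs t u -> forall (rho : valuation) (y : nat -> A), typed_valuation rho ->
  uden rho (fun x => Some (y x)) t = uden rho (fun x => Some (y x)) u.
Proof.
move=> vt vu h rho y tr.
have hy v : all (mem xs) (ivars v) ->
    uden rho (fun x => Some (y x)) v = uden rho (at_args xs (map y xs)) v.
  move=> vv; apply: eq_in_uden => // x /(allP vv)/= xxs; rewrite /at_args.
  by rewrite onthE -map_comp (nth_map 0) ?index_mem// nth_index.
by rewrite !hy// h// size_map.
Qed.

Lemma identical_sym xs t u : identical xs t u -> identical xs u t.
Proof. by move=> h rho a tr ea; rewrite h. Qed.

(** * Identities over an infinite universe *)

Section Infinite.
Variable f : nat -> A.
Hypothesis f_inj : injective f.

Lemma opvar_app_args p ts : opvar_app (App (OpVar p) ts) ->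
  term_args (App (OpVar p) ts) = ts.
Proof. by rewrite /opvar_app /term_args => /andP[/negPf ->]. Qed.

(* The immediate constituents and the variables get pairwise distinct values,
   those of the variables having even indices in [f].  As one of the [I_j] is
   not a variable, the value of [p] at the values of the [I_j] is then needed
   for [p(I_1, ..., I_n)] only, and it may be defined or not. *)
Lemma opvar_app_rigid xs t u :
  irreducible_term t -> wsorted t -> irreducible_term u -> wsorted u ->
  all (mem xs) (ivars t) -> all (mem xs) (ivars u) ->
  opvar_app t -> identical xs t u -> t = u.
Proof.
move=> it wt iu wu vt vu + /(identical_total vt vu) idt.
case: t it wt vt idt => [||x|[p|g|] Is] it wt vt idt // ot; try by rewrite /opvar_app andbF in ot.
set L := Is ++ term_args u.
pose y x := f x.*2.
pose val J := if J is Var x then y x else f (index J L).*2.+1.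
pose S := map val Is.
(* [m p' s] holds of the immediate terms whose evaluation calls [p'] at the values [s]. *)
pose m p' s := [pred J : term Phi | `[< exists us, J = fapp Phi p' us /\ map y us = s >]].
(* [b] matters only for [p] at [S], where it decides between defined and undefined. Elsewhere [rho]
   gives each immediate term of individual sort in [L] its value [val]. *)
pose rho b p' s : option V :=
  if `[< p' = p /\ s = S >] then
    if b then Some (if (fv_type p).2 is ind then inl (f 0) else inr true) else None
  else if has (m p' s) L then
    Some (if (fv_type p').2 is ind then inl (val (nth Tt L (find (m p' s) L))) else inr true)
  else None.
have y_inj : injective y by move=> x1 x2 /f_inj/double_inj.
have wIs := wsorted_args wt.
have imL : {in L, forall J, immediate J}.
  move=> J; rewrite mem_cat => /orP[].
    by move: it; rewrite irreducible_all_immediate => /allP; apply.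
  exact: (allP (irreducible_args iu)).
have wL : {in L, forall J, wsorted J}.
  by move=> J; rewrite mem_cat => /orP[/wIs//|]; apply: term_args_wsorted.
have tr b : typed_valuation (rho b).
  move=> p' s w; rewrite /rho; case: asboolP => [[-> ->]|_].
    case: b => // -[<-]; rewrite size_map (size_args_var wt).
    by split=> //; case: (fv_type p).2.
  case: ifP => // hm [<-]; split; last by case: (fv_type p').2.
  have := nth_find Tt hm; have := mem_nth Tt (etrans (esym (has_find _ _)) hm).
  move=> /wL wJ /asboolP[us [JE <-]]; move: wJ; rewrite JE => /size_args_var.
  by rewrite !size_map.
(* A constituent of [Is] that is not a variable has a value of odd index in [f]. So [S] is no list
   of values of variables, and immediate terms do not depend on [b]. *)
have notS us : map y us <> S.
  move=> e; have /allPn[J JI nJ] : ~~ all (@is_var Phi) Is by case/andP: ot.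
  have szus : size us = size Is by have := congr1 size e; rewrite !size_map.
  have := congr1 (nth (f 0) ^~ (index J Is)) e.
  rewrite /S (nth_map Tt) ?index_mem// nth_index// (nth_map 0) ?szus ?index_mem//.
  by case: (J) nJ => [||x|c ts] //= _ /f_inj /(congr1 odd); rewrite /= !odd_double.
have immE b b' J : immediate J ->
    uden (rho b) (fun x => Some (y x)) J = uden (rho b') (fun x => Some (y x)) J.
  move=> /immediateP[[x ->] //|[q [us ->]]]; rewrite !uden_fapp /rho.
  by case: asboolP => // -[_ /notS].
have valE b J : J \in L -> tsort J = Some ind ->
    uden (rho b) (fun x => Some (y x)) J = Some (inl (val J)).
  move=> JL; have /immediateP[[x ->] //|[q [us JE]]] := imL _ JL.
  rewrite JE => sJ; rewrite uden_fapp /rho; case: asboolP => [[_ /notS]//|_].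
  have mJ : m q (map y us) J by apply/asboolP; exists us.
  have hJ : has (m q (map y us)) L by apply/hasP; exists J.
  rewrite hJ; have /asboolP[us' [-> /(inj_map y_inj) ->]] := nth_find Tt hJ.
  by move: sJ => /=; case: ifP => // _ [->].
have argsE b q ts : wsorted (App (OpVar q) ts) -> {subset ts <= L} ->
    uden (rho b) (fun x => Some (y x)) (App (OpVar q) ts) = rho b q (map val ts).
  move=> wq sL; apply: uapply_some => J Jts; apply: valE; first exact: sL.
  move: wq; rewrite /wsorted /=; case: ifP => // /eqP h _.
  have : tsort J \in map (@tsort Phi) ts by apply: map_f.
  by rewrite h mem_nseq => /andP[_ /eqP].
have tE b : uden (rho b) (fun x => Some (y x)) (App (OpVar p) Is) =
    if b then Some (if (fv_type p).2 is ind then inl (f 0) else inr true) else None.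
  rewrite argsE// => [|J JI]; last by rewrite mem_cat JI.
  by rewrite /rho; case: asboolP => // -[].
have neq : uden (rho true) (fun x => Some (y x)) u <>
    uden (rho false) (fun x => Some (y x)) u.
  by rewrite -!idt// !tE.
(* Otherwise the value of [u] is a fixed function of those of immediate terms and cannot depend on
   [b]. *)
have [ou|nou] := boolP (opvar_app u); last first.
  case: neq; rewrite !uden_value_at//; congr value_at; apply/eq_in_map => J Ju.
  by apply: immE; apply: imL; rewrite mem_cat Ju orbT.
have [q [Js uE]] : exists q Js, u = App (OpVar q) Js.
  by case: (u) ou => [||x|[q|g|] Js]; rewrite /opvar_app ?andbF// => _; exists q, Js.
have uJs : term_args u = Js by move: ou; rewrite uE; apply: opvar_app_args.
have sJ : {subset Js <= L} by move=> J Ju; rewrite mem_cat uJs Ju orbT.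
have sI : {subset Is <= L} by move=> J JI; rewrite mem_cat JI.
have [[qp Se]|nq] := EM (q = p /\ map val Js = S); last first.
  by case: neq; rewrite uE !argsE -?uE// /rho; case: asboolP.
rewrite uE qp; congr App; apply/esym; move: Se; rewrite /S.
(* [u] must call [p] at [S] too, and distinct terms of [L] have distinct values, so the two argument
   lists are equal. *)
have valI : {in L &, injective val}.
  have nvar J : J \in L -> (exists x, J = Var x) \/ val J = f (index J L).*2.+1.
    by case: J => [||x|c ts]; [right|right|left; exists x|right].
  move=> J K JL KL; case: (nvar J JL) => [[x ->]|->]; case: (nvar K KL) => [[z ->]|->].
  - by move=> /y_inj ->.
  - by move=> /f_inj /(congr1 odd); rewrite /= !odd_double.
  - by move=> /f_inj /(congr1 odd); rewrite /= !odd_double.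
  - move=> /f_inj [/double_inj e].
    by rewrite -(nth_index Tt JL) e nth_index.
elim: (Js) (Is) sJ sI => [|J js IH] [|I is_] //= hJ hI [h1 h2].
congr (_ :: _); first by apply: valI h1; [apply: hJ|apply: hI]; rewrite mem_head.
by apply: IH => // K Ks; [apply: hJ|apply: hI]; rewrite in_cons Ks orbT.
Qed.
Definition table_spec (T : seq tree) : Prop := forall t u,
  irreducible_term t -> wsorted t -> irreducible_term u -> wsorted u ->
  pattern t u \in T <-> [/\ tame t, tame u & generically_equal t u].

Lemma opvar_app_rename sg th t : opvar_app (rename sg th t) = opvar_app t.
Proof. by rewrite /opvar_app immediate_rename; case: t => // -[]. Qed.

Lemma tame_rename th t : tame (rename id th t) = tame t.
Proof.
by rewrite /tame irreducible_rename opvar_app_rename /wsorted tsort_rename.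
Qed.

Lemma rename_id_in th t : {in ivars t, th =1 id} -> rename id th t = t.
Proof.
elim/term_ind_mem: t => //= [v|c ts IH] h; first by rewrite h ?mem_head.
congr App; first by case: c.
rewrite -[RHS]map_id; apply/eq_in_map => t tts; apply: IH => // x xt; apply: h.
by apply/flatten_mapP; exists t.
Qed.

Lemma term_args_ivars (B : {pred nat}) t : all (mem B) (ivars t) ->
  {in term_args t, forall u, all (mem B) (ivars u)}.
Proof.
move=> ht u; rewrite /term_args; case: ifP => _; first by rewrite inE => /eqP ->.
by case: t ht => // c ts /ivars_args; apply.
Qed.

(** Denotations under a typed valuation form an admissible assignment as soon as the variables that
    occur have distinct values. *)
Lemma generically_equal_identity xs (rho : valuation) a t u :
  tame t -> tame u -> typed_valuation rho -> size a = size xs ->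
  all (mem xs) (ivars t) -> all (mem xs) (ivars u) ->
  {in ivars t ++ ivars u &, injective (at_args xs a)} ->
  generically_equal t u ->
  uden rho (at_args xs a) t = uden rho (at_args xs a) u.
Proof.
move=> /and3P[_ wt nt] /and3P[_ wu nu] tr ea vt vu inj [_ gv].
rewrite !uden_value_at//; apply: gv.
have sub : {in term_args t ++ term_args u, forall J, all (mem (ivars t ++ ivars u)) (ivars J)}.
  move=> J; rewrite mem_cat => /orP[]; apply: term_args_ivars;
    by apply/allP => x xt /=; rewrite mem_cat xt ?orbT.
split.
- move=> x /sub /=; rewrite andbT mem_cat => xtu.
  have xxs : x \in xs by move: xtu => /orP[/(allP vt)|/(allP vu)].
  have lt : index x xs < size a by rewrite ea index_mem.
  case: a ea inj lt => // a0 a' ea inj lt.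
  by exists (nth a0 (a0 :: a') (index x xs)); rewrite /at_args onthE (nth_map a0).
- move=> x z /sub /= + /sub /=; rewrite !andbT => hx hz.
  case ex : (at_args xs a x) => [b|]; case ez : (at_args xs a z) => [b'|] //=.
  + by move=> -[bb]; apply: inj => //; rewrite ex ez bb.
  + by move=> _; apply: inj => //; rewrite ex ez.
- move=> p us w _ /=; rewrite /uapply.
  by case: (strict_seq _) => //= s /tr[].
Qed.

Lemma infinite_avoid (s : seq (option V)) : exists N, forall n, N <= n ->
  ~ (exists2 i, i < size s & nth None s i = Some (inl (f n))).
Proof.
elim: s => [|w s [N IH]]; first by exists 0 => n _ [].
have [[m wm]|nw] := EM (exists m, w = Some (inl (f m))).
  exists (maxn N m.+1) => n; rewrite geq_max => /andP[Nn mn] [[|i] /= hi].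
    by rewrite wm => -[/f_inj e]; rewrite e ltnn in mn.
  by move=> hs; apply: (IH n Nn); exists i.
exists N => n Nn [[|i] /= hi]; first by move=> wn; apply: nw; exists n.
by move=> hs; apply: (IH n Nn); exists i.
Qed.

(** Only finitely many elements occur as values on [L]; variables outside [L] receive elements
    [f (N + x)] beyond all of them. *)
Lemma admissible_extension v L : admissible v L -> exists2 y : nat -> A,
  injective y & forall x, Var x \in L -> v (Var x) = Some (inl (y x)).
Proof.
move=> [vv vi _]; have [N hN] := infinite_avoid (map v L).
have valL x n : Var x \in L -> v (Var x) <> Some (inl (f (N + n))).
  move=> xL e; apply: (hN (N + n) (leq_addr _ _)); exists (index (Var x) L).
    by rewrite size_map index_mem.
  by rewrite (nth_map Tt) ?index_mem// nth_index.
have /choice[y hy] : forall x, exists b, if Var x \in L then v (Var x) = Some (inl b)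
    else b = f (N + x).
  by move=> x; case: (boolP (Var x \in L)) => [/vv//|_]; exists (f (N + x)).
exists y => [x z|x xL]; last by have := hy x; rewrite xL.
have := hy x; have := hy z.
case: (boolP (Var z \in L)) => zL hz; case: (boolP (Var x \in L)) => xL hx e.
- by apply: vi; rewrite // hx hz e.
- by case: (valL z x zL); rewrite hz -e hx.
- by case: (valL x z xL); rewrite hx e hz.
- by move: e; rewrite hx hz => /f_inj /addnI.
Qed.

(** [p] at [s] is given the value of a term [p(us)] of [L] whose variables have the values [s].
    Injectivity of [y] makes that term unique. *)
Lemma admissible_realizable v L (y : nat -> A) : admissible v L -> injective y ->
  (forall x, Var x \in L -> v (Var x) = Some (inl (y x))) ->
  {in L, forall J, immediate J} -> {in L, forall J, wsorted J} ->
  exists2 rho : valuation, typed_valuation rho &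
    {in L, forall J, uden rho (fun x => Some (y x)) J = v J}.
Proof.
move=> [_ _ vty] y_inj hy imL wL.
pose m p s := [pred J : term Phi | `[< exists us, J = fapp Phi p us /\ map y us = s >]].
exists (fun p s => if has (m p s) L then v (nth Tt L (find (m p s) L)) else None).
  move=> p s w; case: ifP => // hm.
  have := nth_find Tt hm; have := mem_nth Tt (etrans (esym (has_find _ _)) hm).
  move: (nth _ _ _) => J JL /asboolP[us [JE <-]]; rewrite JE in JL *; split.
    by have := size_args_var (wL _ JL); rewrite !size_map.
  exact: (vty p (map Var us) w JL).
move=> J JL; have /immediateP[[x JE]|[p [us JE]]] := imL J JL.
  by rewrite JE /= hy -?JE.
rewrite JE uden_fapp; have hm : has (m p (map y us)) L.
  by apply/hasP; exists J => //; apply/asboolP; exists us.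
by rewrite hm; have /asboolP[us' [-> /(inj_map y_inj) ->]] := nth_find Tt hm.
Qed.

(** Evaluating the renamed terms at an injective [y] is evaluating [t] and [u] at [y \o th], where
    they agree; every admissible assignment arises from such an evaluation. *)
Lemma identical_generically_equal xs (th : nat -> nat) t u :
  tame t -> tame u -> all (mem xs) (ivars t) -> all (mem xs) (ivars u) ->
  tsort t = tsort u -> identical xs t u ->
  generically_equal (rename id th t) (rename id th u).
Proof.
move=> tt tu vt vu stu idt; split; first by rewrite !tsort_rename.
move=> v adm; have [y y_inj hy] := admissible_extension adm.
have /and3P[it wt nt] : tame (rename id th t) by rewrite tame_rename.
have /and3P[iu wu nu] : tame (rename id th u) by rewrite tame_rename.
have [|J|rho tr hrho] := admissible_realizable adm y_inj hy.
- move=> J; rewrite mem_cat.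
  by move=> /orP[/(allP (irreducible_args it))|/(allP (irreducible_args iu))].
- by rewrite mem_cat => /orP[]; apply: term_args_wsorted.
have hv s : {subset term_args s <= term_args (rename id th t) ++ term_args (rename id th u)} ->
    map v (term_args s) = map (uden rho (fun x => Some (y x))) (term_args s).
  by move=> ss; apply/eq_in_map => J /ss/hrho.
rewrite !hv; first last.
- by move=> J Jt; rewrite mem_cat Jt.
- by move=> J Ju; rewrite mem_cat Ju orbT.
rewrite -!uden_value_at// !uden_rename.
exact: (identical_total vt vu idt (fun x => y (th x)) tr).
Qed.

(** Tame pairs are settled by the table, one entry per identification of variables; in all other
    pairs identity forces syntactic equality. *)
Lemma test_identical T xs t u : table_spec T ->
  irreducible_term t -> wsorted t -> irreducible_term u -> wsorted u ->
  all (mem xs) (ivars t) -> all (mem xs) (ivars u) ->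
  all (fun w => test T (rename id (subst_at xs w) t) (rename id (subst_at xs w) u))
    (words xs (size xs)) <-> tsort t = tsort u /\ identical xs t u.
Proof.
move=> Tspec it wt iu wu vt vu.
have spec w : pattern (rename id (subst_at xs w) t) (rename id (subst_at xs w) u) \in T <->
    [/\ tame t, tame u & generically_equal (rename id (subst_at xs w) t)
                            (rename id (subst_at xs w) u)].
  have := Tspec (rename id (subst_at xs w) t) (rename id (subst_at xs w) u).
  by rewrite !irreducible_rename /wsorted !tsort_rename// !tame_rename; apply.
split; last first.
  move=> [st idt]; apply/allP => w _; rewrite /test.
  have [tt|] := boolP (tame t && tame u).
    apply/orP; right; apply/spec; have /andP[? ?] := tt; split=> //.
    exact: identical_generically_equal idt.
  rewrite /tame it wt iu wu /= -negb_or negbK => /orP[ot|ou].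
    by rewrite (opvar_app_rigid it wt iu wu vt vu ot idt) eqxx.
  by rewrite -(opvar_app_rigid iu wu it wt vu vt ou (identical_sym idt)) eqxx.
move=> /allP htest.
have [/andP[tt tu]|ntu] := boolP (tame t && tame u); last first.
  (* The word [xs] is the identity substitution. The pattern of a pair that is not tame is not in
     the table, so the test leaves only [t = u]. *)
  have /htest : xs \in words xs (size xs) by apply: mem_words => //; apply/allP.
  have id_xs (s : term Phi) : all (mem xs) (ivars s) -> rename id (subst_at xs xs) s = s.
    move=> /allP vs; apply: rename_id_in => x /vs/= xxs.
    by rewrite /subst_at nth_index.
  rewrite /test => /orP[|/spec[tt tu _]]; last by rewrite tt tu in ntu.
  by rewrite !id_xs// => /eqP ->.
have ge w : w \in words xs (size xs) ->
    generically_equal (rename id (subst_at xs w) t) (rename id (subst_at xs w) u).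
  by move=> /htest /orP[/eqP ->|/spec[]//].
split.
  have /ge[] : xs \in words xs (size xs) by apply: mem_words => //; apply/allP.
  by rewrite !tsort_rename.
move=> rho a tr ea; pose eta := at_args xs a.
(* Each variable is replaced by the first one in [xs] having the same value. The variables that
   remain have distinct values, so generic equality applies. *)
pose th x := nth 0 xs (find (fun z => `[< eta z = eta x >]) xs).
have hfind x : x \in xs -> has (fun z => `[< eta z = eta x >]) xs.
  by move=> xxs; apply/hasP; exists x => //; apply/asboolP.
have thxs x : x \in xs -> th x \in xs by move=> /hfind h; rewrite mem_nth// -has_find.
have eta_th x : x \in xs -> eta (th x) = eta x.
  by move=> /hfind/(nth_find 0)/asboolP.
have sub x : x \in xs -> subst_at xs (map th xs) x = th x.
  by move=> xxs; rewrite /subst_at (nth_map 0) ?index_mem// nth_index.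
have uE (s : term Phi) : all (mem xs) (ivars s) ->
    uden rho eta s = uden rho eta (rename id (subst_at xs (map th xs)) s).
  move=> /allP vs; rewrite uden_rename; apply: eq_in_uden => // x /vs/= xxs.
  by rewrite sub// eta_th.
rewrite -/eta (uE t)// (uE u)//; apply: generically_equal_identity; rewrite ?tame_rename//.
- rewrite ivars_rename; apply/allP => _ /mapP[x /(allP vt)/= xxs ->].
  by rewrite /= sub// thxs.
- rewrite ivars_rename; apply/allP => _ /mapP[x /(allP vu)/= xxs ->].
  by rewrite /= sub// thxs.
- have hx x : x \in ivars (rename id (subst_at xs (map th xs)) t) ++
      ivars (rename id (subst_at xs (map th xs)) u) -> exists2 x0, x0 \in xs & x = th x0.
    rewrite mem_cat !ivars_rename => /orP[]/mapP[z + ->].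
      by move=> /(allP vt)/= zxs; exists z; rewrite ?sub.
    by move=> /(allP vu)/= zxs; exists z; rewrite ?sub.
  move=> x z /hx[x0 x0s ->] /hx[z0 z0s ->].
  by rewrite -/eta !eta_th// /th => ->.
- by apply: ge; apply: mem_words; [rewrite size_map|apply/allP => _ /mapP[x /thxs ? ->]].
Qed.

End Infinite.
End Identities.

(** * The decision procedure *)

Section Decision.
Variables (Phi : signature) (A : structure Phi) (T : seq tree) (f : nat -> A).
Implicit Types (t u : term Phi) (E F G H : extprogram Phi).
Hypothesis f_inj : injective f.
Hypothesis T_spec : table_spec A T.

Lemma lift_map_cancel (ps qs : seq fvar) : uniq qs -> size ps = size qs ->
  {in ps, cancel (lift_map ps qs) (lift_map qs ps)}.
Proof.
move=> u e p pps; rewrite [X in lift_map _ _ X]/lift_map.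
by rewrite index_lift_map ?nth_index// -e index_mem.
Qed.

Lemma same_part_testP (sg sg' : fvar -> fvar) (ps qs : seq fvar) xs t ys u :
  (forall p, fv_type (sg p) = fv_type p) -> (forall p, fv_type (sg' p) = fv_type p) ->
  {in ps, cancel sg sg'} -> {in qs, cancel sg' sg} -> uniq xs ->
  wsorted t -> wsorted u -> good_part ps xs t -> good_part qs ys u ->
  same_part_test T sg' xs t ys u <-> tsort t = tsort u /\ same_part A sg xs t ys u.
Proof.
move=> tsg tsg' K K' uxs wt wu [it /allP ht vt] [iu /allP hu vu].
rewrite /same_part_test; case: eqP => [exy|nxy] /=; last by split=> // -[_ []].
(* [u] written with the parameters and function variables of the first program, which reduces the
   comparison to an identity over one list [xs]. *)
pose u0 := rename sg' (subst_at ys xs) u.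
have renE w : rename sg' (subst_at ys w) u = rename id (subst_at xs w) u0.
  have idx y : y \in ys -> subst_at xs w (subst_at ys xs y) = subst_at ys w y.
    by move=> yys; rewrite /subst_at index_uniq// exy index_mem.
  rewrite rename_comp; move: vu; clear -idx; elim/term_ind_mem: u => //= [y|c ts IH].
    by rewrite andbT => /idx ->.
  rewrite flatten_subP all_map => /allP h; congr App.
  by apply/eq_in_map => t tts; apply: IH => //; apply: h.
have tu0 : tsort u0 = tsort u by apply: tsort_rename.
have vu0 : all (mem xs) (ivars u0).
  rewrite ivars_rename; apply/allP => _ /mapP[y /(allP vu)/= yys ->] /=.
  by rewrite /subst_at mem_nth// exy index_mem.
have uden_u0 (rho : valuation A) a : uden rho (at_args xs a) u0 =
    uden (fun p => rho (sg' p)) (at_args ys a) u.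
  rewrite uden_rename; apply: eq_in_uden => // y /(allP vu)/= yys.
  by rewrite /at_args /subst_at index_uniq// exy index_mem.
have iu0 : irreducible_term u0 by rewrite irreducible_rename.
have wu0 : wsorted u0 by rewrite /wsorted tu0.
have := test_identical f_inj T_spec it wt iu0 wu0 vt vu0; rewrite tu0.
rewrite (eq_all (a2 := fun w => test T (rename id (subst_at xs w) t)
  (rename sg' (subst_at ys w) u))); last by move=> w; rewrite renE.
move=> testE; split=> [/testE[st h]|[st h]]; [split=> //|apply/testE; split=> //].
- split=> // rho a tr ea.
  rewrite (h (fun p => rho (sg p)) a)//; last exact: typed_valuation_comp.
  by rewrite uden_u0; apply: eq_in_uden => // p /hu/= pqs s; rewrite K'.
- move=> rho a tr ea; rewrite uden_u0; case: h => _ <- //; last exact: typed_valuation_comp.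
  by apply: eq_in_uden => // p /ht/= pps s; rewrite K.
Qed.

Lemma good_part_head G : irreducible G ->
  good_part (bound_fvars G) (xvars G) (Defs.head G).
Proof.
move=> /andP[ih _]; split=> //; first exact: head_fvars.
by have /andP[] := extprogramP G.
Qed.

Lemma good_part_body G e : irreducible G -> e \in body G ->
  good_part (bound_fvars G) (params e) (rhs e).
Proof. by move=> /andP[_ /allP ib] eG; have [] := wf_body eG; split=> //; apply: ib. Qed.

Lemma good_part_mem (ps qs : seq fvar) xs t : ps =i qs ->
  good_part ps xs t -> good_part qs xs t.
Proof. by move=> h [h1 /allP h2 h3]; split=> //; apply/allP => p /h2; rewrite /= h. Qed.

Section Equivalent.
Variables (G H : extprogram Phi) (es fs : seq (equation Phi)).
Hypotheses (iG : irreducible G) (iH : irreducible H).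
Hypotheses (Ges : perm_eq (body G) es) (Hfs : perm_eq (body H) fs).

Let pG : perm_eq (bound_fvars G) (map (@lhs Phi) es) := perm_map _ Ges.

Lemma aligned_testP gs : perm_eq (body H) gs ->
  aligned_test T (xvars G) (Defs.head G) es (xvars H) (Defs.head H) gs <->
  [/\ map fv_type (map (@lhs Phi) es) = map fv_type (map (@lhs Phi) gs),
      tsort (Defs.head G) = tsort (Defs.head H),
      same_part A (lift_map (map (@lhs Phi) es) (map (@lhs Phi) gs))
        (xvars G) (Defs.head G) (xvars H) (Defs.head H) &
      all2 (fun e g => `[< same_part A (lift_map (map (@lhs Phi) es) (map (@lhs Phi) gs))
                          (params e) (rhs e) (params g) (rhs g) >]) es gs].
Proof.
move=> Hgs; have pH : perm_eq (bound_fvars H) (map (@lhs Phi) gs) := perm_map _ Hgs.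
have wfes : {in es, forall e, e \in body G} by move=> e; rewrite (perm_mem Ges).
have wfgs : {in gs, forall g, g \in body H} by move=> g; rewrite (perm_mem Hgs).
have typesE : same_types es gs <->
    map fv_type (map (@lhs Phi) es) = map fv_type (map (@lhs Phi) gs).
  move: wfes wfgs; rewrite /same_types.
  elim: (es) (gs) => [|e es' IH] [|g gs'] //= he hg.
  have := IH gs' (fun x xs => he x (mem_behead (s := e :: es') xs))
    (fun x xs => hg x (mem_behead (s := g :: gs') xs)) => {}IH.
  have [se _ _ _ _] := wf_body (he e (mem_head _ _)).
  have [sg _ _ _ _] := wf_body (hg g (mem_head _ _)).
  rewrite se sg; split; first by move=> /andP[/andP[/eqP h1 /eqP h2] /IH ->];
    congr (_ :: _); apply/eqP; rewrite -pair_eqE /= h1 h2 !eqxx.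
  by move=> [-> /IH ->]; rewrite !eqxx.
rewrite /aligned_test; set sg' := lift_map (map _ gs) _; set sg := lift_map (map _ es) _.
have [/typesE te|nt] := boolP (same_types es gs); last first.
  by split=> // -[/typesE h]; rewrite h in nt.
have sz : size (map (@lhs Phi) es) = size (map (@lhs Phi) gs).
  by have := congr1 size te; rewrite !size_map.
have tsg : forall p, fv_type (sg p) = fv_type p by apply: lift_map_type.
have tsg' : forall p, fv_type (sg' p) = fv_type p by apply: lift_map_type.
have ues : uniq (map (@lhs Phi) es) by rewrite -(perm_uniq pG) uniq_bound.
have ugs : uniq (map (@lhs Phi) gs) by rewrite -(perm_uniq pH) uniq_bound.
have K : {in map (@lhs Phi) es, cancel sg sg'} by apply: lift_map_cancel.
have K' : {in map (@lhs Phi) gs, cancel sg' sg} by apply: lift_map_cancel.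
have hP : same_part_test T sg' (xvars G) (Defs.head G) (xvars H) (Defs.head H) <->
    tsort (Defs.head G) = tsort (Defs.head H) /\
    same_part A sg (xvars G) (Defs.head G) (xvars H) (Defs.head H).
  apply: (same_part_testP tsg tsg' K K'); rewrite ?wsorted_head//.
  - by have /andP[] := extprogramP G.
  - exact: good_part_mem (perm_mem pG) (good_part_head iG).
  - exact: good_part_mem (perm_mem pH) (good_part_head iH).
have bP : all2 (fun e g => same_part_test T sg' (params e) (rhs e) (params g) (rhs g)) es gs =
    all2 (fun e g => `[< same_part A sg (params e) (rhs e) (params g) (rhs g) >]) es gs.
  have main e g : e \in es -> g \in gs -> fv_type (lhs e) = fv_type (lhs g) ->
      same_part_test T sg' (params e) (rhs e) (params g) (rhs g) =
      `[< same_part A sg (params e) (rhs e) (params g) (rhs g) >].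
    move=> ees ggs teg.
    have [_ ue _ _ se] := wf_body (wfes e ees); have [_ _ _ _ sg_] := wf_body (wfgs g ggs).
    have h : same_part_test T sg' (params e) (rhs e) (params g) (rhs g) <->
        tsort (rhs e) = tsort (rhs g) /\
        same_part A sg (params e) (rhs e) (params g) (rhs g).
      apply: (same_part_testP tsg tsg' K K') => //.
      - by rewrite /wsorted se.
      - by rewrite /wsorted sg_.
      - exact: good_part_mem (perm_mem pG) (good_part_body iG (wfes e ees)).
      - exact: good_part_mem (perm_mem pH) (good_part_body iH (wfgs g ggs)).
    apply/idP/asboolP => [/h[]//|hs]; apply/h; split=> //.
    by rewrite se sg_ teg.
  move: main te; elim: (es) (gs) => [|e es' IH] [|g gs'] //= main [te tes].
  rewrite main ?mem_head// IH// => e' g' h1 h2; apply: main; rewrite in_cons ?h1 ?h2 orbT//.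
rewrite bP /=; split; first by move=> /andP[/hP[]].
by move=> [_ h1 h2 h3]; apply/andP; split=> //; apply/hP.
Qed.

Lemma programs_testP :
  programs_test T (xvars G) (Defs.head G) es (xvars H) (Defs.head H) fs <->
  equivalent A G H.
Proof.
have ues : uniq (map (@lhs Phi) es) by rewrite -(perm_uniq pG) uniq_bound.
split.
- move=> /hasP[gs /mem_perms gsfs]; have Hgs : perm_eq (body H) gs.
    by rewrite (perm_trans Hfs)// perm_sym.
  have pH : perm_eq (bound_fvars H) (map (@lhs Phi) gs) := perm_map _ Hgs.
  have ugs : uniq (map (@lhs Phi) gs) by rewrite -(perm_uniq pH) uniq_bound.
  move=> /(aligned_testP Hgs)[te th hh hb]; split=> //.
  have sz : size (map (@lhs Phi) es) = size (map (@lhs Phi) gs).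
    by have := congr1 size te; rewrite !size_map.
  exists (lift_map (map (@lhs Phi) es) (map (@lhs Phi) gs)); split=> //.
  + exact: lift_map_type.
  + rewrite (perm_trans pH)// perm_sym (perm_trans (perm_map _ pG))//.
    suff -> : map (lift_map (map (@lhs Phi) es) (map (@lhs Phi) gs)) (map (@lhs Phi) es) =
      map (@lhs Phi) gs by [].
    have d : fvar := ((0, ind), 0).
    apply: (@eq_from_nth _ d); rewrite size_map// => i ip.
    by rewrite (nth_map d)// index_lift_map.
  + move=> e g; rewrite (perm_mem Ges) (perm_mem Hgs) => ees ggs.
    have ie : index e es < size es by rewrite index_mem.
    have szeg : size es = size gs by move: sz; rewrite !size_map.
    have -> : lhs e = nth (lhs e) (map (@lhs Phi) es) (index e es).
      by rewrite (nth_map e)// nth_index.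
    rewrite index_lift_map ?size_map// (nth_map e) -?szeg// => lg.
    have ge : g = nth e gs (index e es).
      by apply: (uniq_map_inj ugs) lg => //; rewrite mem_nth// -szeg.
    move: hb; rewrite all2E => /andP[_] /(all_nthP (e, e))/(_ (index e es)).
    by rewrite size_zip -szeg minnn nth_zip// nth_index// -ge => /(_ ie)/asboolP.
- move=> [th [sg [tsg psg hh hb]]].
  have eG e : e \in es -> exists2 g, g \in body H & lhs g = sg (lhs e).
    move=> ees; have : sg (lhs e) \in bound_fvars H.
      by rewrite (perm_mem psg) map_f// (perm_mem pG) map_f.
    by move=> /mapP[g gH ->]; exists g.
  (* The equation of the second program that [sg] pairs with [e]. Listing partners in the order of
     [es] gives the permutation on which the test succeeds. *)
  pose partner e := nth e fs (index (sg (lhs e)) (map (@lhs Phi) fs)).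
  have partnerP e : e \in es -> partner e \in body H /\ lhs (partner e) = sg (lhs e).
    move=> /eG[g gH ge]; have gf : g \in fs by rewrite -(perm_mem Hfs).
    have lf : sg (lhs e) \in map (@lhs Phi) fs by rewrite -ge map_f.
    have il : index (sg (lhs e)) (map (@lhs Phi) fs) < size fs.
      by rewrite -(size_map (@lhs Phi)) index_mem.
    split; first by rewrite (perm_mem Hfs) mem_nth.
    by rewrite /partner -(nth_map e (lhs e))// nth_index.
  pose gs := map partner es.
  have lgs : map (@lhs Phi) gs = map sg (map (@lhs Phi) es).
    by rewrite -!map_comp; apply/eq_in_map => e /partnerP[].
  have pgs : perm_eq (bound_fvars H) (map (@lhs Phi) gs).
    by rewrite lgs (perm_trans psg)// perm_map.
  have ugs : uniq gs by apply: (@map_uniq _ _ (@lhs Phi)); rewrite -(perm_uniq pgs) uniq_bound.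
  have Hgs : perm_eq (body H) gs.
    have uH : uniq (body H) := map_uniq (uniq_bound H).
    have sub : {subset gs <= body H} by move=> _ /mapP[e /partnerP[h _] ->].
    have [|_ h] := uniq_min_size ugs sub.
      by have := perm_size pgs; rewrite !size_map => ->.
    by apply: uniq_perm => // x; rewrite h.
  apply/hasP; exists gs; first by apply: perms_mem; rewrite -(permPr Hfs) perm_sym.
  have lm : {in map (@lhs Phi) es, sg =1 lift_map (map (@lhs Phi) es) (map (@lhs Phi) gs)}.
    by move=> p pes; rewrite /lift_map lgs (nth_map p) ?index_mem// nth_index.
  have same xs t ys u : all (mem (bound_fvars G)) (fvars t) -> same_part A sg xs t ys u ->
      same_part A (lift_map (map (@lhs Phi) es) (map (@lhs Phi) gs)) xs t ys u.
    move=> /allP ht [h1 h2]; split=> // rho a tr ea; rewrite -h2//.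
    apply: eq_in_uden => // p /ht/= pG' s; rewrite lm//.
    by rewrite -(perm_mem pG).
  apply/(aligned_testP Hgs); split=> //.
  + by rewrite lgs -[RHS]map_comp; apply: eq_map => p /=; rewrite tsg.
  + by apply: same hh; apply: head_fvars.
  + rewrite all2E size_map eqxx /=; apply/allP => -[e g] /(nthP (e, g))[i].
    rewrite size_zip size_map minnn => ie; rewrite nth_zip ?size_map// => -[ei gi].
    have ees : e \in es by rewrite -ei mem_nth.
    have gE : g = partner e by rewrite -gi (nth_map e)// ei.
    have [gH lg] := partnerP e ees; rewrite gE /=; apply/asboolP.
    have eG' : e \in body G by rewrite (perm_mem Ges).
    apply: same; first by have [] := wf_body eG'.
    exact: hb.
Qed.
End Equivalent.

(** The run starts from [E] and [F] alone, yet its answer is right for any canonical forms [E'] and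
    [F']: congruences preserve the recursor, so they are absorbed by transitivity. *)
Lemma run_main E F E' F' : canonical_form E E' -> canonical_form F F' ->
  exists2 b : bool, run (decision_program (sort_table Phi) (code_list T)) fn_main
      [:: code_extprogram E; code_extprogram F] (code_bool b) &
    b <-> recursor_eq (recursor_of A E') (recursor_of A F').
Proof.
move=> [iE' [G EG GE']] [iF' [H FH HF']].
have iG : irreducible G := congruent_irreducible GE'.2 iE'.
have iH : irreducible H := congruent_irreducible HF'.2 iF'.
have [nuE flE] := flattening_red EG iG; have [nuF flF] := flattening_red FH iH.
have [es Ges codeE] := code_cf_flattening flE.
have [fs Hfs codeF] := code_cf_flattening flF.
have mG := perm_mem (perm_map (@lhs Phi) Ges); have mH := perm_mem (perm_map (@lhs Phi) Hfs).
exists (programs_test T (xvars G) (Defs.head G) es (xvars H) (Defs.head H) fs).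
  apply: wp_run => /=.
  eexists; first exact: run_cf.
  eexists; first exact: run_cf.
  eexists; last by [].
  rewrite codeE codeF; apply: run_check => //.
  - by move=> p q; rewrite -!mG; apply: tree_name_inj flE p q.
  - by move=> p q; rewrite -!mH; apply: tree_name_inj flF p q.
  - by move=> p; rewrite -mG; apply: tree_name_sort flE p.
  - by move=> p; rewrite -mH; apply: tree_name_sort flF p.
  - exact: good_part_mem mG (good_part_head iG).
  - exact: good_part_mem mH (good_part_head iH).
  - move=> e; rewrite -(perm_mem Ges) => eG.
    exact: good_part_mem mG (good_part_body iG eG).
  - move=> e; rewrite -(perm_mem Hfs) => eH.
    exact: good_part_mem mH (good_part_body iH eH).
have cE := congruent_equivalent A GE'; have cF := congruent_equivalent A HF'.
split.
- move=> /(programs_testP iG iH Ges Hfs) GH; apply/recursor_eqP.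
  exact: equivalent_trans (equivalent_sym cE) (equivalent_trans GH cF).
- move=> /recursor_eqP EF; apply/(programs_testP iG iH Ges Hfs).
  exact: equivalent_trans cE (equivalent_trans EF (equivalent_sym cF)).
Qed.

End Decision.

Theorem theorem5p1 (Phi : signature) (A : structure Phi)
  (A_infinite : infinite_set [set: A]%classic) :
  decidable_relation (@code_extprogram Phi) (@intensionally_equivalent Phi A).
Proof.
have [f f_inj] := infinite_injection A_infinite.
have [T T_spec] := table_exists A.
exists (decision_program (sort_table Phi) (code_list T)) => E F; split.
- move=> [E' [F' [cE cF EF]]]; have [b hb eqb] := run_main f_inj T_spec cE cF.
  by move: hb; rewrite eqb.2.
(* Halting on a pair that is not equivalent rests on the existence of canonical forms, since
   non-equivalence provides none. *)
- have [E' cE] := canonical_form_exists E; have [F' cF] := canonical_form_exists F.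
  have [b hb eqb] := run_main f_inj T_spec cE cF => nEF.
  by case: b eqb hb => // -[eqb _]; case: nEF; exists E', F'; split=> //; apply: eqb.
Qed.
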